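(* Let $n\ge3$, $s\in(0,1)$, $K>0$, and let $u\in C(\mathbb{R}^n)\cap L^1_{\omega_s}(\mathbb{R}^n)$. Let $x\in\mathbb{R}^n$ be a point where there is a $C^2$-function touching $u$ from above, and assume $$\mathcal{I}^s u(x,y+z)+\mathcal{I}^s u(x,y-z)-2\,\mathcal{I}^s u(x,y)\le 2K|z|^{2s}\qquad\text{for a.e. } y,z\in\mathbb{R}^n.$$ Let $Q_1,Q_2\in\mathcal{S}^n_+$ be such that $Q_2^2>Q_1^2$, and assume that $\mathcal{L}^s_{Q_i}u(x)>-\infty$ for $i=1,2$. Then $$\mathcal{L}^s_{Q_2}u(x)-\mathcal{L}^s_{Q_1}u(x)\le c_{K,s}\,\big(\operatorname{tr}(Q_2^2-Q_1^2)\big)^s,\qquad\text{where}\quad c_{K,s}:=K\cdot\frac{\omega_{n-1}}{4n^s}\cdot\frac{C_{n,s}}{1-s},$$ and $c_{K,s}\to K$ as $s\to1$.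
   Context: $\mathcal{S}^n_+$ is the set of symmetric positive definite real $n\times n$ matrices; $P>Q$ means $P-Q$ is positive definite. $\omega_{n-1}=\mathcal{H}^{n-1}(\mathbb{S}^{n-1})$ is the surface measure of the unit sphere of $\mathbb{R}^n$. $L^1_{\omega_s}(\mathbb{R}^n)$ is the set of $u$ with $\int_{\mathbb{R}^n}\frac{|u(y)|}{1+|y|^{n+2s}}\,dy<\infty$. Let $C_{n,s}=\dfrac{4^s s\,\Gamma(\frac{n+2s}{2})}{\pi^{n/2}\Gamma(1-s)}$, $\delta u(x,y)=u(x+y)+u(x-y)-2u(x)$, and $$\mathcal{L}^s_Qu(x)=\frac{C_{n,s}}2\int_{\mathbb{R}^n}\frac{\delta u(x,Qy)}{|y|^{n+2s}}\,dy,\qquad \mathcal{I}^su(x,y)=(1-s)\int_{-\infty}^\infty\frac{\delta u(x,ry)}{|r|^{1+2s}}\,dr.$$ A $C^2$-function touches $u$ from above at $x$ if there are an open neighborhood $N$ of $x$ and $\psi\in C^2(N)$ with $\psi(x)=u(x)$ and $\psi(y)>u(y)$ for all $y\in N\setminus\{x\}$. Under the hypotheses, $\mathcal{I}^su(x,\cdot)$ is finite almost everywhere. *)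

(* Defs.v *)
From HB Require Import structures.
From mathcomp Require Import all_boot all_order all_algebra.
From mathcomp Require Import all_classical all_reals all_analysis.

Set Implicit Arguments.
Unset Strict Implicit.
Unset Printing Implicit Defensive.
Import Order.TTheory GRing.Theory Num.Theory.
Import numFieldNormedType.Exports.

Local Open Scope classical_set_scope.
Local Open Scope ring_scope.

(* R^n is 'cV[R]_n. The library norm `|x| on it is the sup norm; it has the
   right topology, but every |x| of the mathematics below is enorm. *)
Definition enorm (R : realType) (n : nat) (x : 'cV[R]_n) : R :=
  Num.sqrt (\sum_(i < n) x i 0 ^+ 2).

(* The Borel sigma-algebra of R^n, generated by the n coordinate maps. *)
Definition cV_display : measure_display.
Proof. exact: default_measure_display. Qed.

Section measurable_cV.
Context (R : realType) (n : nat).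

Let coord (i : 'I_n) (x : 'cV[R]_n) : measurableTypeR R := x i 0.

Let cV_set0 : g_sigma_preimage coord set0.
Proof. exact: sigma_algebra0. Qed.

Let cV_setC A : g_sigma_preimage coord A -> g_sigma_preimage coord (~` A).
Proof. exact: sigma_algebraC. Qed.

Let cV_bigcup (F : (set 'cV[R]_n)^nat) :
  (forall i, g_sigma_preimage coord (F i)) ->
  g_sigma_preimage coord (\bigcup_i F i).
Proof. exact: sigma_algebra_bigcup. Qed.

HB.instance Definition _ := @isMeasurable.Build cV_display
  'cV[R]_n (g_sigma_preimage coord) cV_set0 cV_setC cV_bigcup.

End measurable_cV.

Section lebesgue_cV.
Context (R : realType).

Definition cV_cons (n : nat) (p : measurableTypeR R * 'cV[R]_n) : 'cV[R]_n.+1 :=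
  \col_i oapp (fun j => p.2 j 0) p.1 (unlift ord0 i).

Definition cV_uncons (n : nat) (x : 'cV[R]_n.+1) :
    measurableTypeR R * 'cV[R]_n :=
  (x ord0 0, \col_j x (lift ord0 j) 0).

Lemma cV_unconsK n : cancel (@cV_uncons n) (@cV_cons n).
Proof.
move=> x; apply/matrixP => i j; rewrite !mxE (ord1 j).
by case: unliftP => [k ->|->]//=; rewrite mxE.
Qed.

Lemma cV_consK n : cancel (@cV_cons n) (@cV_uncons n).
Proof.
move=> [t v]; congr pair; first by rewrite mxE unlift_none.
by apply/matrixP => i j; rewrite !mxE liftK (ord1 j).
Qed.

Lemma measurable_coord n (i : 'I_n) :
  measurable_fun [set: 'cV[R]_n] (fun x => x i 0 : measurableTypeR R).
Proof.
move=> _ Y mY; rewrite setTI; apply: sub_sigma_algebra => /=.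
rewrite -bigcup_seq/=; exists i => /=; first by rewrite mem_index_enum.
by exists Y => //; rewrite setTI.
Qed.

Lemma measurable_fun_coordP d (T : measurableType d) n (f : T -> 'cV[R]_n) :
  measurable_fun [set: T] f <->
  forall i, measurable_fun [set: T] (fun t => f t i 0 : measurableTypeR R).
Proof.
split=> [mf i|mf].
  exact: (measurableT_comp (@measurable_coord n i) mf).
apply: measurability; first by reflexivity.
move=> _ [A + <-]; rewrite -bigcup_seq => -[i _ [B mB <-]].
by rewrite setTI setTI -(setTI (_ @^-1` _)); exact: mf.
Qed.

Lemma measurable_cV_cons n : measurable_fun setT (@cV_cons n).
Proof.
apply/measurable_fun_coordP => i.
case: (unliftP ord0 i) => [j ->|->].
- rewrite [X in measurable_fun _ X](_ : _ =
    (fun x : 'cV[R]_n => x j 0) \o snd); last first.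
    by apply/funext => p /=; rewrite mxE liftK.
  exact: (measurableT_comp (@measurable_coord n j) measurable_snd).
- rewrite [X in measurable_fun _ X](_ : _ = fst); first exact: measurable_fst.
  by apply/funext => p /=; rewrite mxE unlift_none.
Qed.

Lemma measurable_cV_uncons n : measurable_fun setT (@cV_uncons n).
Proof.
apply/measurable_fun_pairP; split; first exact: measurable_coord.
apply/measurable_fun_coordP => i.
rewrite [X in measurable_fun _ X](_ : _ =
  fun x : 'cV[R]_n.+1 => x (lift ord0 i) 0).
  exact: measurable_coord.
by apply/funext => p /=; rewrite mxE.
Qed.

Section step.
Variables (n : nat) (mu : {sigma_finite_measure set 'cV[R]_n -> \bar R}).

Definition lebesgue_step : set 'cV[R]_n.+1 -> \bar R :=
  pushforward (lebesgue_measure \x mu)%E (@cV_cons n).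

Let pushforward_measure :=
  measure_function_pushforward__canonical__measure_function_Measure
    (lebesgue_measure \x mu)%E (@measurable_cV_cons n).

Let lebesgue_step0 : (lebesgue_step set0 = 0)%E.
Proof. exact: (measure0 pushforward_measure). Qed.

Let lebesgue_step_ge0 A : (0 <= lebesgue_step A)%E.
Proof. exact: (measure_ge0 pushforward_measure). Qed.

Let lebesgue_step_sigma_additive : semi_sigma_additive lebesgue_step.
Proof. exact: (@measure_semi_sigma_additive _ _ _ pushforward_measure). Qed.

HB.instance Definition _ := isMeasure.Build _ _ _ lebesgue_step
  lebesgue_step0 lebesgue_step_ge0 lebesgue_step_sigma_additive.

Let lebesgue_step_sigma_finite : sigma_finite setT lebesgue_step.
Proof.
have /sigma_finiteP[F [TF ndF Foo]] :=
  sigma_finiteT (@lebesgue_measure R : {sigma_finite_measure set _ -> \bar R}).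
have /sigma_finiteP[G [TG ndG Goo]] := sigma_finiteT mu.
exists (fun k => @cV_uncons n @^-1` (F k `*` G k)).
  rewrite -preimage_bigcup (_ : \bigcup_k _ = setT) ?preimage_setT//.
  rewrite -setXTT TF TG predeqE => -[x y]; split.
    by move=> [k _ []/= ? ?]; split; exists k.
  move=> [/= [k _ Fkx] [l _ Gly]]; exists (maxn k l) => //; split.
  - by move: x Fkx; exact/subsetPset/ndF/leq_maxl.
  - by move: y Gly; exact/subsetPset/ndG/leq_maxr.
move=> k; have [mF F_oo] := Foo k; have [mG G_oo] := Goo k; split.
  by rewrite -[X in measurable X]setTI;
    apply: measurable_cV_uncons => //; exact: measurableX.
rewrite /lebesgue_step /pushforward -comp_preimage.
rewrite (_ : _ \o _ = id); last by apply/funext => p /=; rewrite cV_consK.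
by rewrite preimage_id product_measure1E// lte_mul_pinfty// ge0_fin_numE.
Qed.

HB.instance Definition _ := Measure_isSigmaFinite.Build _ _ _
  lebesgue_step lebesgue_step_sigma_finite.

End step.

(* n-dimensional Lebesgue measure on the Borel sets of R^n, as the n-fold
   product of the one-dimensional one *)
Fixpoint lebesgue_cV (n : nat) : {sigma_finite_measure set 'cV[R]_n -> \bar R} :=
  match n with
  | 0 => [the {sigma_finite_measure set 'cV[R]_0 -> \bar R} of
           @dirac _ 'cV[R]_0 (0 : 'cV[R]_0) R]
  | n.+1 => lebesgue_step (lebesgue_cV n)
  end.

End lebesgue_cV.

(* Hausdorff measure for the Euclidean distance. The covers are by arbitrary
   sets; empty members contribute nothing (their diameter is -oo here). *)
Section hausdorff.
Context (R : realType) (n : nat).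

Definition diameter (U : set 'cV[R]_n) : \bar R :=
  ereal_sup [set (enorm (p.1 - p.2))%:E | p in U `*` U].

Definition hausdorff_content (m : nat) (delta : R) (A : set 'cV[R]_n) : \bar R :=
  ereal_inf [set (\sum_(k <oo | U k != set0) diameter (U k) ^+ m)%E |
    U in [set U : (set 'cV[R]_n)^nat |
      A `<=` \bigcup_k U k /\ forall k, (diameter (U k) <= delta%:E)%E]].

Definition hausdorff_unnormalized (m : nat) (A : set 'cV[R]_n) : \bar R :=
  ereal_sup [set hausdorff_content m delta A | delta in [set d : R | 0 < d]].

End hausdorff.

(* The constant is the usual one, which makes H^m the Lebesgue measure on R^m:
   the unit cube of R^m has H^m-measure 1. *)
Definition hausdorff (R : realType) (n m : nat) (A : set 'cV[R]_n) : \bar R :=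
  (hausdorff_unnormalized m A /
   hausdorff_unnormalized m [set x : 'cV[R]_m | forall i, 0 <= x i 0 <= 1]%R)%E.

Definition unit_sphere (R : realType) (n : nat) : set 'cV[R]_n :=
  [set x | enorm x = 1].

(* sphere_area R n is omega_(n-1). *)
Definition sphere_area (R : realType) (n : nat) : R :=
  fine (hausdorff n.-1 (@unit_sphere R n)).

Definition Gamma (R : realType) (a : R) : R :=
  \int[lebesgue_measure]_(t in `]0, +oo[) (t `^ (a - 1) * expR (- t)).

Section nonlocal_operators.
Context (R : realType) (n : nat).
Implicit Types (s : R) (u : 'cV[R]_n -> R) (x y : 'cV[R]_n).

Definition frac_const s : R :=
  4 `^ s * s * Gamma ((n%:R + 2 * s) / 2) / (pi `^ (n%:R / 2) * Gamma (1 - s)).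

Definition second_diff u x y : R := u (x + y) + u (x - y) - 2 * u x.

Definition frac_op s (Q : 'M[R]_n) u x : \bar R :=
  ((frac_const s / 2)%:E * \int[lebesgue_cV R n]_y
     (second_diff u x (Q *m y) / enorm y `^ (n%:R + 2 * s))%:E)%E.

Definition line_op s u x y : \bar R :=
  ((1 - s)%:E * \int[lebesgue_measure]_r
     (second_diff u x (r *: y) / `|r| `^ (1 + 2 * s))%:E)%E.

Definition L1_omega s u : Prop :=
  measurable_fun setT u /\
  (\int[lebesgue_cV R n]_y
     (`|u y| / (1 + enorm y `^ (n%:R + 2 * s)))%:E < +oo)%E.

Definition cKs (K s : R) : R :=
  K * (sphere_area R n / (4 * n%:R `^ s)) * (frac_const s / (1 - s)).

End nonlocal_operators.

Section touching.
Context (R : realType) (n : nat).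

(* f is C^k on the open set N: all partial derivatives of order at most k exist
   and are continuous at every point of N. *)
Fixpoint Cclass (k : nat) (N : set 'cV[R]_n) (f : 'cV[R]_n -> R) : Prop :=
  (forall y, N y -> {for y, continuous f}) /\
  (if k is k'.+1 then
     forall i : 'I_n, let e : 'cV[R]_n := delta_mx i 0 in
       (forall y, N y -> derivable f y e) /\ Cclass k' N ('D_e f)
   else True).

Definition C2_touches_from_above (u : 'cV[R]_n -> R) (x : 'cV[R]_n) : Prop :=
  exists (N : set 'cV[R]_n) (psi : 'cV[R]_n -> R),
    [/\ open N, N x, Cclass 2 N psi, psi x = u x &
        forall y, N y -> y != x -> u y < psi y].

End touching.

Definition posdef (R : realType) (n : nat) (P : 'M[R]_n) : Prop :=
  P^T = P /\ forall v : 'cV[R]_n, v != 0 -> 0 < (v^T *m P *m v) 0 0.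

(* Main.v *)
(* Averaging the line operator against the Gaussian exp(-|y|^2) gives back the
   n-dimensional operator: by Tonelli and scaling, the Gaussian integral of
   y |-> I^s u(x, Q y) is a constant multiple of L^s_Q u(x), and the constant
   depends neither on u nor on Q. If Q2^2 = Q1^2 + L L^T then Q1 Y + L Z and
   Q1 Y - L Z have the law of Q2 Y for independent Gaussian vectors Y and Z.
   Hence the assumed inequality at (Q1 y, L z), integrated against both
   Gaussians, compares the operators for Q2 and Q1 with the error
   2 K E|L Z|^(2s), which concavity of t^s and rotation invariance bound by
   2 K (tr(L L^T) / n)^s E|Z|^(2s). The touching function and the growth of u
   make the positive part of the second difference integrable against the
   kernel, so that L^s_Q u(x) > -oo makes the negative part integrable too.

   The moment E|Z|^(2s) and the limit of the constant involve the Hausdorff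
   measure of the sphere. It is found by cutting the Gaussian along cones of
   aperture t about the points of the sphere: a cone meets the sphere in a cap,
   whose Hausdorff measure is that of its projection on the tangent hyperplane
   up to a factor that tends to 1 as t -> 1. *)
From HB Require Import structures.
Require Import Defs.
From mathcomp Require Import all_boot all_order all_algebra.
From mathcomp Require Import all_classical all_reals all_analysis.
From mathcomp Require Import measurable_realfun.
From mathcomp Require Import ring lra.
Import Order.TTheory GRing.Theory Num.Theory.
Import numFieldNormedType.Exports.

Set Implicit Arguments.
Unset Strict Implicit.
Unset Printing Implicit Defensive.

Local Open Scope classical_set_scope.
Local Open Scope ring_scope.

(** * Measurability and change of measure *)

(** While the hypothesis is being averaged no integral is known to be finite: [line_op] is a
    difference of two integrals with values in [0, +oo]. The pointwise inequality is therefore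
    rearranged so that every term is nonnegative, and Tonelli is the only exchange of integrals.
    Subtraction comes last, when the four averages are known to be finite. Since the inequality
    holds only almost everywhere, it is pulled back by (y, z) -> (Q1 y, L z), which requires an
    invertible [L].

    The multiple c in the averaging identity is never evaluated. The same identity for the function
    |y|^(n+2s) exp(-|y|^2), combined with the area of the sphere, shows that the integral of
    |z|^(2s) exp(-|z|^2) is c omega_(n-1) / 2, so c cancels. In [cKs], the 4 is the product of this
    2 and of the 2 in C_(n,s) / 2, the n^s comes from (tr / n)^s, and 1 / (1 - s) undoes the factor
    in [line_op].

    The limit follows from (1 - s) Gamma(1 - s) = Gamma(2 - s) and omega_(n-1) Gamma(n/2 + 1) = n
    pi^(n/2). The area, the Gamma function and the moments are all reached through Tonelli for
    suitable kernels, without polar coordinates. *)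

Section measurability.
Context (R : realType).

Lemma measurable_mx_add d (T : measurableType d) n (f g : T -> 'cV[R]_n) :
  measurable_fun setT f -> measurable_fun setT g ->
  measurable_fun setT (fun t => f t + g t).
Proof.
move=> /measurable_fun_coordP mf /measurable_fun_coordP mg.
apply/measurable_fun_coordP => i.
under eq_fun do rewrite mxE.
by apply: measurable_funD; [exact: mf|exact: mg].
Qed.

Lemma measurable_mx_opp d (T : measurableType d) n (f : T -> 'cV[R]_n) :
  measurable_fun setT f -> measurable_fun setT (fun t => - f t).
Proof.
move=> /measurable_fun_coordP mf.
apply/measurable_fun_coordP => i.
under eq_fun do rewrite mxE.
by apply: measurable_funN; exact: mf.
Qed.

Lemma measurable_mx_sub d (T : measurableType d) n (f g : T -> 'cV[R]_n) :
  measurable_fun setT f -> measurable_fun setT g ->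
  measurable_fun setT (fun t => f t - g t).
Proof. by move=> mf mg; apply: measurable_mx_add => //; exact: measurable_mx_opp. Qed.

Lemma measurable_mx_scale d (T : measurableType d) n (f : T -> R)
    (g : T -> 'cV[R]_n) :
  measurable_fun setT f -> measurable_fun setT g ->
  measurable_fun setT (fun t => f t *: g t).
Proof.
move=> mf /measurable_fun_coordP mg.
apply/measurable_fun_coordP => i.
under eq_fun do rewrite mxE.
by apply: measurable_funM => //; exact: mg.
Qed.

Lemma measurable_mx_mul d (T : measurableType d) m n (A : 'M[R]_(m, n))
    (f : T -> 'cV[R]_n) :
  measurable_fun setT f -> measurable_fun setT (fun t => A *m f t).
Proof.
move=> /measurable_fun_coordP mf.
apply/measurable_fun_coordP => i.
under eq_fun do rewrite mxE.
apply: measurable_sum => j.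
by apply: measurable_funM => //; exact: mf.
Qed.

Definition sqnorm n (x : 'cV[R]_n) : R := \sum_(i < n) x i 0 ^+ 2.

Lemma measurable_sqnorm d (T : measurableType d) n (f : T -> 'cV[R]_n) :
  measurable_fun setT f -> measurable_fun setT (fun t => sqnorm (f t)).
Proof.
move=> /measurable_fun_coordP mf; apply: measurable_sum => j.
by apply: measurable_funX; exact: mf.
Qed.

Lemma measurable_enorm d (T : measurableType d) n (f : T -> 'cV[R]_n) :
  measurable_fun setT f -> measurable_fun setT (fun t => enorm (f t)).
Proof.
move=> mf.
have ms : measurable_fun setT (@Num.sqrt R).
  by apply: continuous_measurable_fun; exact: sqrt_continuous.
exact: (measurableT_comp ms (measurable_sqnorm mf)).
Qed.

Lemma measurable_expR_comp d (T : measurableType d) (f : T -> R) :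
  measurable_fun setT f -> measurable_fun setT (fun t => expR (f t)).
Proof. by move=> mf; exact: (measurableT_comp (@measurable_expR R) mf). Qed.

End measurability.

Section change_of_measure.
Local Open Scope ereal_scope.

(** Common source of the rules for shifts, dilations and linear maps: only the effect of [phi] on
    the measure of sets has to be found, up to a factor [c]. *)
Lemma ge0_integral_comp d1 d2 (X : measurableType d1) (Y : measurableType d2)
    (R : realType) (phi : X -> Y) (c : {nonneg R})
    (mu : {measure set X -> \bar R}) (nu : {measure set Y -> \bar R})
    (f : Y -> \bar R) :
  measurable_fun setT phi ->
  (forall A, measurable A -> mu (phi @^-1` A) = c%:num%:E * nu A) ->
  measurable_fun setT f -> (forall y, 0 <= f y) ->
  \int[mu]_x f (phi x) = c%:num%:E * \int[nu]_y f y.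
Proof.
move=> mphi munu mf f0.
have := @ge0_integral_pushforward _ _ X Y R phi mphi mu setT f measurableT mf.
rewrite preimage_setT => <-; last by [].
rewrite -ge0_integral_mscale//.
apply: eq_measure_integral => A mA _.
exact: munu.
Qed.

Lemma ge0_integral_preserving d1 d2 (X : measurableType d1)
    (Y : measurableType d2) (R : realType) (phi : X -> Y)
    (mu : {measure set X -> \bar R}) (nu : {measure set Y -> \bar R})
    (f : Y -> \bar R) :
  measurable_fun setT phi ->
  (forall A, measurable A -> mu (phi @^-1` A) = nu A) ->
  measurable_fun setT f -> (forall y, 0 <= f y) ->
  \int[mu]_x f (phi x) = \int[nu]_y f y.
Proof.
move=> mphi munu mf f0.
rewrite (@ge0_integral_comp _ _ _ _ _ phi (1%:nng%R : {nonneg R}) mu nu)//= ?mul1e//.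
by move=> A mA; rewrite mul1e munu.
Qed.

Lemma ge0_integralZlT d (T : measurableType d) (R : realType)
    (mu : {measure set T -> \bar R}) (f : T -> \bar R) (k : \bar R) :
  measurable_fun setT f -> (forall x, 0 <= f x) -> 0 <= k ->
  \int[mu]_x (k * f x) = k * \int[mu]_x f x.
Proof. by move=> mf f0 k0; rewrite ge0_integralZl. Qed.

Lemma ge0_le_integralT d (T : measurableType d) (R : realType)
    (mu : {measure set T -> \bar R}) (f g : T -> \bar R) :
  measurable_fun setT f -> measurable_fun setT g ->
  (forall x, 0 <= f x) -> (forall x, f x <= g x) ->
  \int[mu]_x f x <= \int[mu]_x g x.
Proof. by move=> mf mg f0 fg; apply: ge0_le_integral. Qed.

End change_of_measure.

Section lebesgue1.
Context (R : realType).
Local Open Scope ereal_scope.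

Lemma lebesgue_measure_shift (a : R) (A : set (measurableTypeR R)) : measurable A ->
  lebesgue_measure ((fun t : measurableTypeR R => (t + a)%R : measurableTypeR R) @^-1` A)
  = lebesgue_measure A.
Proof.
have mphi : measurable_fun setT (fun t : measurableTypeR R => (t + a)%R : measurableTypeR R).
  by apply: measurable_funD.
pose mu := pushforward (@lebesgue_measure R) (fun t : measurableTypeR R => (t + a)%R : measurableTypeR R).
pose mu' := [the {measure set (measurableTypeR R) -> \bar R} of measure_function_pushforward__canonical__measure_function_Measure (@lebesgue_measure R) mphi].
move=> mA; apply/esym; apply: (@lebesgue_measure_unique _ mu') => //.
move=> _ [[x y] _ <-] /=; rewrite /pushforward.
rewrite (_ : _ @^-1` _ = `](x - a)%R, (y - a)%R]%classic); last first.
  by apply/seteqP; split=> z /=; rewrite !in_itv/= ltrBlDr lerBrDr.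
by rewrite !lebesgue_measure_itv/= !lte_fin ltrD2r; case: ifP => // _; rewrite -!EFinD; congr EFin; ring.
Qed.

(** By uniqueness of Lebesgue measure it suffices to test |a| times the image measure on intervals
    ]x, y]. For a < 0 their preimages are [y/a, x/a[, hence the two cases. *)
Lemma lebesgue_measure_scale (a : R) (A : set (measurableTypeR R)) : (a != 0)%R ->
  measurable A ->
  lebesgue_measure ((fun t : measurableTypeR R => (a * t)%R : measurableTypeR R) @^-1` A)
  = (`|a|^-1)%:E * lebesgue_measure A.
Proof.
move=> a0.
have mphi : measurable_fun setT (fun t : measurableTypeR R => (a * t)%R : measurableTypeR R).
  by apply: measurable_funM.
pose mu' := [the {measure set (measurableTypeR R) -> \bar R} of measure_function_pushforward__canonical__measure_function_Measure (@lebesgue_measure R) mphi].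
have an : (0 <= `|a|)%R by [].
pose mu2 := [the {measure set (measurableTypeR R) -> \bar R} of mscale (NngNum an) mu'].
move=> mA.
have -> : lebesgue_measure A = mu2 A.
  apply: (@lebesgue_measure_unique _ mu2) => //.
  move=> _ [[x y] _ <-] /=; rewrite /mscale/= /pushforward.
  have [an'|ap|a00] := ltgtP a 0%R; last by rewrite a00 eqxx in a0.
  all: swap 1 2.
  - rewrite (_ : _ @^-1` _ = `](x / a)%R, (y / a)%R]%classic); last first.
      by apply/seteqP; split=> z /=; rewrite !in_itv/= [in (a * z)%R]mulrC ltr_pdivrMr// ler_pdivlMr//.
    rewrite !lebesgue_measure_itv/= !lte_fin ltr_pM2r ?invr_gt0//; case: ifP => // _; last by rewrite mule0.
    by rewrite gtr0_norm// -!EFinD -EFinM; congr EFin; field.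
  - rewrite (_ : _ @^-1` _ = `[(y / a)%R, (x / a)%R[%classic); last first.
      by apply/seteqP; split=> z /=; rewrite !in_itv/= [in (a * z)%R]mulrC ltr_ndivlMr// ler_ndivrMr// andbC.
    rewrite !lebesgue_measure_itv/= !lte_fin ltr_nM2r ?invr_lt0//; case: ifP => // _; last by rewrite mule0.
    by rewrite ltr0_norm// -!EFinD -EFinM; congr EFin; field.
rewrite /mu2 /= /mscale/= /pushforward muleA -EFinM mulVf ?mul1e//.
by rewrite normr_eq0.
Qed.

Lemma ge0_integral_shift (a : R) (f : R -> \bar R) :
  measurable_fun setT f -> (forall y, 0 <= f y) ->
  \int[lebesgue_measure]_t f (t + a)%R = \int[lebesgue_measure]_t f t.
Proof.
move=> mf f0.
apply: (@ge0_integral_preserving _ _ (measurableTypeR R) (measurableTypeR R) R (fun t => (t + a)%R) lebesgue_measure lebesgue_measure f) => //.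
  by apply: measurable_funD.
by move=> A mA; exact: lebesgue_measure_shift.
Qed.

Lemma ge0_integral_scale (a : R) (f : R -> \bar R) : (a != 0)%R ->
  measurable_fun setT f -> (forall y, 0 <= f y) ->
  \int[lebesgue_measure]_t f (a * t)%R = (`|a|^-1)%:E * \int[lebesgue_measure]_t f t.
Proof.
move=> a0 mf f0.
have an : (0 <= `|a|^-1)%R by rewrite invr_ge0.
apply: (@ge0_integral_comp _ _ (measurableTypeR R) (measurableTypeR R) R (fun t => (a * t)%R) (NngNum an) lebesgue_measure lebesgue_measure f) => //=.
  by apply: measurable_funM.
by move=> A mA; exact: lebesgue_measure_scale.
Qed.

End lebesgue1.

Section sigma_finite_pack.
Context d (T : measurableType d) (R : realType) (mu : {measure set T -> \bar R}).
Hypothesis sf : sigma_finite setT mu.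

(** A measure built inside a proof comes with sigma-finiteness as a mere fact, whereas Tonelli asks
    for the structure. Taking the fact as an argument gives a constant to which the structure can be
    attached. *)
Definition sf_measure of sigma_finite setT mu : set T -> \bar R := mu.

Let mu0 : sf_measure sf set0 = 0%E. Proof. exact: measure0. Qed.

Let mu_ge0 A : (0 <= sf_measure sf A)%E. Proof. exact: measure_ge0. Qed.

Let mu_sigma_additive : semi_sigma_additive (sf_measure sf).
Proof. exact: measure_semi_sigma_additive. Qed.

HB.instance Definition _ := isMeasure.Build _ _ _ (sf_measure sf)
  mu0 mu_ge0 mu_sigma_additive.

HB.instance Definition _ := Measure_isSigmaFinite.Build _ _ _ (sf_measure sf) sf.

Lemma sf_measureP : exists2 nu : {sigma_finite_measure set T -> \bar R},
  (forall A, nu A = mu A) & (nu : set T -> \bar R) = mu.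
Proof. by exists (sf_measure sf). Qed.

End sigma_finite_pack.

(** * Lebesgue measure on R^n *)

Section lebesgue_cV_theory.
Context (R : realType).
Local Open Scope ereal_scope.
Local Notation LC n := (lebesgue_cV R n).

Lemma ge0_integral_cVS n (f : 'cV[R]_n.+1 -> \bar R) :
  measurable_fun setT f -> (forall x, 0 <= f x) ->
  \int[LC n.+1]_x f x =
  \int[lebesgue_measure]_t \int[LC n]_v f (cV_cons (t, v)).
Proof.
move=> mf f0.
have mc := @measurable_cV_cons R n.
have E := @ge0_integral_pushforward _ _ _ _ R (@cV_cons R n) mc
  (lebesgue_measure \x LC n) setT f measurableT mf.
rewrite [LHS]E ?preimage_setT; last by [].
rewrite fubini_tonelli1//; last by move=> x; exact: f0.
exact: measurableT_comp mf mc.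
Qed.

Lemma measurable_cV_cons2 n (t : R) :
  measurable_fun setT (fun v : 'cV[R]_n => cV_cons (t, v)).
Proof.
have mc := @measurable_cV_cons R n.
by apply: (measurableT_comp mc); exact: measurable_pair1.
Qed.

Lemma cV_consD n (t s : R) (v w : 'cV[R]_n) :
  (cV_cons (t, v) + cV_cons (s, w) = cV_cons ((t + s)%R, (v + w)%R))%R.
Proof.
apply/matrixP => i j; rewrite !mxE.
by case: unliftP => [k _|_] //=; rewrite !mxE.
Qed.

Lemma cV_consE n (x : 'cV[R]_n.+1) :
  x = cV_cons (x ord0 0%R, \col_j x (lift ord0 j) 0%R)%R.
Proof. by rewrite -[LHS](@cV_unconsK R n x). Qed.

(** By induction on the dimension: the tail of [w] is removed in the inner integral by the induction
    hypothesis, its first coordinate in the outer one by the one-dimensional case. *)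
Lemma ge0_integral_cV_shift n (w : 'cV[R]_n) (f : 'cV[R]_n -> \bar R) :
  measurable_fun setT f -> (forall x, 0 <= f x) ->
  \int[LC n]_x f (x + w)%R = \int[LC n]_x f x.
Proof.
elim: n w f => [|n IH] w f mf f0.
  have -> : w = 0%R by apply/matrixP => -[].
  by apply: eq_integral => x _; rewrite addr0.
have mfw : measurable_fun setT (fun x : 'cV[R]_n.+1 => f (x + w)%R).
  by apply: (measurableT_comp mf); apply: measurable_mx_add => //.
rewrite (ge0_integral_cVS mf f0) (ge0_integral_cVS mfw (fun x => f0 (x + w)%R)).
rewrite (cV_consE w) /=; set w0 := w _ _; set w' := \col_j _.
transitivity (\int[lebesgue_measure]_t
   (fun s : R => \int[LC n]_v f (cV_cons (s, v))) (t + w0)%R).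
  apply: eq_integral => t _ /=.
  rewrite -(IH w' (fun v => f (cV_cons ((t + w0)%R, v))))//; last first.
    by apply: (measurableT_comp mf); exact: measurable_cV_cons2.
  by apply: eq_integral => v _; rewrite cV_consD.
apply: ge0_integral_shift => //; last first.
  by move=> y; apply: integral_ge0 => *; exact: f0.
have mc := @measurable_cV_cons R n.
exact: (@measurable_fun_fubini_tonelli_F _ _ _ _ R (LC n) (fun p => f (cV_cons p)) (measurableT_comp mf mc)).
Qed.

Lemma measurable_cV_shift n (w : 'cV[R]_n) : measurable_fun setT (fun x : 'cV[R]_n => x + w)%R.
Proof. by apply: measurable_mx_add => //; exact: measurable_id. Qed.

Lemma measurable_cV_subl n (w : 'cV[R]_n) : measurable_fun setT (fun x : 'cV[R]_n => w - x)%R.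
Proof. by apply: measurable_mx_sub => //; exact: measurable_id. Qed.

Lemma measurable_cV_opp n : measurable_fun setT (fun x : 'cV[R]_n => - x)%R.
Proof. by apply: measurable_mx_opp => //; exact: measurable_id. Qed.

Lemma preimage_measurable d d' (T : measurableType d) (U : measurableType d') (f : T -> U)
  (A : set U) : measurable_fun setT f -> measurable A -> measurable (f @^-1` A).
Proof. by move=> mf mA; rewrite -[X in measurable X]setTI; exact: mf. Qed.

Lemma lebesgue_cV_shift n (w : 'cV[R]_n) (A : set 'cV[R]_n) : measurable A ->
  LC n ((fun x => x + w)%R @^-1` A) = LC n A.
Proof.
move=> mA.
have mw := measurable_cV_shift w.
rewrite -[X in LC n X = _]setIT -[LHS]integral_indic//; last exact: preimage_measurable.
rewrite -[X in _ = LC n X]setIT -[RHS]integral_indic//.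
have mi : measurable_fun setT (fun x : 'cV[R]_n => (\1_A x : R)%:E).
  exact/measurable_EFinP/measurable_indic.
by rewrite -(ge0_integral_cV_shift w mi).
Qed.

(* Tonelli for 1_A(x) 1_B(x + y); with A fixed, mu is a multiple of LC. *)
Lemma translation_invariant_uniq n
    (mu : {sigma_finite_measure set 'cV[R]_n -> \bar R}) (A B : set 'cV[R]_n) :
  (forall (w : 'cV[R]_n) (A : set 'cV[R]_n), measurable A ->
     mu ((fun x => x + w)%R @^-1` A) = mu A) ->
  measurable A -> measurable B ->
  mu A * LC n B = mu B * LC n ((fun x => - x)%R @^-1` A).
Proof.
move=> muT mA mB.
pose g (p : 'cV[R]_n * 'cV[R]_n) : \bar R :=
  (\1_A p.1 : R)%:E * (\1_B (p.1 + p.2)%R : R)%:E.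
pose h (p : 'cV[R]_n * 'cV[R]_n) : \bar R :=
  (\1_A (p.1 - p.2)%R : R)%:E * (\1_B p.1 : R)%:E.
have m1 (C : set 'cV[R]_n) : measurable C -> measurable_fun setT (fun x => (\1_C x : R)%:E).
  by move=> mC; exact/measurable_EFinP/measurable_indic.
have mg : measurable_fun setT g.
  apply: emeasurable_funM.
    exact: (measurableT_comp (m1 _ mA) measurable_fst).
  apply: (measurableT_comp (m1 _ mB)); apply: measurable_mx_add.
    exact: measurable_fst.
  exact: measurable_snd.
have mh : measurable_fun setT h.
  apply: emeasurable_funM; last exact: (measurableT_comp (m1 _ mB) measurable_fst).
  apply: (measurableT_comp (m1 _ mA)); apply: measurable_mx_sub.
    exact: measurable_fst.
  exact: measurable_snd.
have g0 p : 0 <= g p by rewrite mule_ge0// lee_fin.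
have h0 p : 0 <= h p by rewrite mule_ge0// lee_fin.
have mshift w := measurable_cV_shift (n := n) w.
have intC (nu : {measure set 'cV[R]_n -> \bar R}) C : measurable C ->
    \int[nu]_x (\1_C x : R)%:E = nu C.
  by move=> mC; rewrite integral_indic// setIT.
have L : \int[mu]_x \int[LC n]_y g (x, y) = mu A * LC n B.
  transitivity (\int[mu]_x ((\1_A x : R)%:E * LC n B)).
    apply: eq_integral => x _; rewrite /g/=.
    rewrite ge0_integralZl//; last first.
      by apply: (measurableT_comp (m1 _ mB)); apply: measurable_mx_add.
    congr (_ * _); rewrite -(intC _ _ mB).
    rewrite -(ge0_integral_cV_shift x (f := fun y => (\1_B y : R)%:E))//; last exact: m1.
    by apply: eq_integral => y _; rewrite addrC.
  by rewrite ge0_integralZr// ?intC//; exact: m1.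
rewrite -L (@fubini_tonelli _ _ _ _ R mu (LC n) g mg g0).
(* For fixed y, the invariance of [mu] allows x to be replaced by x - y. After a second exchange [A]
   is seen by the Lebesgue variable through y -> x - y, which is where the reflection of [A] comes
   from. *)
transitivity (\int[LC n]_y \int[mu]_x h (x, y)).
  apply: eq_integral => y _.
  rewrite -(@ge0_integral_preserving _ _ _ _ R (fun x : 'cV[R]_n => x + y)%R mu mu (fun x => h (x, y)))//.
  - by apply: eq_integral => x _; rewrite /g /h/= addrK.
  - by move=> C mC; exact: muT.
  - exact: (measurableT_comp mh (measurable_pair2 y)).
rewrite -(@fubini_tonelli _ _ _ _ R mu (LC n) h mh h0).
have mopp := @measurable_cV_opp n.
have mA' : measurable ((fun x => - x)%R @^-1` A) by exact: preimage_measurable.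
transitivity (\int[mu]_x ((\1_B x : R)%:E * LC n ((fun x => - x)%R @^-1` A))).
  apply: eq_integral => x _; rewrite /h/=.
  rewrite ge0_integralZr//; last first.
    by apply: (measurableT_comp (m1 _ mA)); exact: measurable_cV_subl.
  rewrite muleC; congr (_ * _).
  rewrite -(intC _ _ mA').
  rewrite -(ge0_integral_cV_shift (- x)%R (f := fun y => (\1_(-%R @^-1` A) y : R)%:E))//; last exact: m1.
  apply: eq_integral => y _; congr EFin.
  by rewrite /indic -(opprB y x); congr ((_ : bool)%:R); apply/idP/idP => /set_mem ?; apply/mem_set.
by rewrite ge0_integralZr// ?intC//; exact: m1.
Qed.

End lebesgue_cV_theory.

(** * Linear changes of variables *)

Section linear_change_of_variables.
Context (R : realType).
Local Open Scope ereal_scope.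
Local Notation LC n := (lebesgue_cV R n).

Lemma measurable_cV_mul m n (A : 'M[R]_(m, n)) :
  measurable_fun setT (fun x : 'cV[R]_n => A *m x).
Proof. by apply: measurable_mx_mul. Qed.

(** The cube by which [hausdorff] is normalised; it also serves as the reference set that fixes the
    factor between two translation-invariant measures. *)
Definition ucube n : set 'cV[R]_n := [set x | forall i, (0 <= x i 0 <= 1)%R].

Lemma measurable_box n (a b : R) :
  measurable [set x : 'cV[R]_n | forall i, (a <= x i 0 <= b)%R].
Proof.
rewrite (_ : [set x | _] = \bigcap_(i in [set: 'I_n]) ((fun x : 'cV[R]_n => x i 0%R : measurableTypeR R) @^-1` `[a, b])); last first.
  by apply/seteqP; split=> [x /= h i _ /=|x /= h i]; [rewrite in_itv/= h|have := h i Logic.I; rewrite /= in_itv].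
apply: fin_bigcap_measurable; first exact: finite_finset.
move=> i _; apply: preimage_measurable; first exact: measurable_coord.
exact: measurable_itv.
Qed.

Lemma lebesgue_cVS n (A : set 'cV[R]_n.+1) :
  LC n.+1 A = (lebesgue_measure \x LC n) (@cV_cons R n @^-1` A).
Proof. by []. Qed.

Lemma lebesgue_box n (a b : R) : (a <= b)%R ->
  LC n [set x : 'cV[R]_n | forall i, (a <= x i 0 <= b)%R] = ((b - a) ^+ n)%:E.
Proof.
move=> ab; elim: n => [|n IH].
  rewrite [LHS]diracE expr0 mem_set//=.
  by move=> i; case: i.
rewrite lebesgue_cVS.
rewrite (_ : _ @^-1` _ = `[a, b] `*` [set x : 'cV[R]_n | forall i, (a <= x i 0 <= b)%R]); last first.
  apply/seteqP; split=> [[t v] /= h|[t v] /= [h1 h2] i].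
    split; first by have := h ord0; rewrite mxE unlift_none/= in_itv.
    by move=> i; have := h (lift ord0 i); rewrite mxE liftK.
  rewrite mxE; case: unliftP => [j _|_] /=; first exact: h2.
  by move: h1; rewrite in_itv.
rewrite product_measure1E//; last exact: measurable_box.
have E1 := @lebesgue_measure_itv R `[a, b].
rewrite [X in _ * X]IH [X in X * _]E1/= lte_fin.
have [ab'|ba] := ltP a b; first by rewrite -EFinD -EFinM exprS.
have -> : (b - a = 0)%R by apply/eqP; rewrite subr_eq0 eq_le ba ab.
by rewrite mul0e expr0n.
Qed.

Lemma measurable_ucube n : measurable (@ucube n).
Proof. exact: measurable_box. Qed.

Lemma lebesgue_ucube n : LC n (@ucube n) = 1%E.
Proof. by rewrite lebesgue_box// subr0 expr1n. Qed.

(** The case of [translation_invariant_uniq] in which [mu] is Lebesgue measure itself and [B] the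
    unit cube. *)
Lemma lebesgue_cV_opp n (A : set 'cV[R]_n) : measurable A ->
  LC n ((fun x => - x)%R @^-1` A) = LC n A.
Proof.
move=> mA.
have := @translation_invariant_uniq R n (LC n) A (@ucube n)
  (@lebesgue_cV_shift R n) mA (@measurable_ucube n).
by rewrite lebesgue_ucube mul1e mule1 => ->.
Qed.

Lemma lebesgue_bounded_fin n (A : set 'cV[R]_n) (b : R) :
  measurable A -> (0 <= b)%R -> (forall x i, A x -> (`|x i 0| <= b)%R) -> LC n A < +oo.
Proof.
move=> mA b0 Ab.
have : LC n A <= ((b - - b) ^+ n)%:E.
  rewrite -lebesgue_box; last by lra.
  apply: le_measure; rewrite ?inE//; first exact: measurable_box.
  by move=> x Ax i; rewrite -ler_norml; exact: Ab.
by move=> /le_lt_trans; apply; rewrite ltry.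
Qed.

Lemma mulmx_bound m n (A : 'M[R]_(m, n)) (x : 'cV[R]_n) (b : R) :
  (0 <= b -> (forall i, `|x i 0| <= b) ->
  forall i, `|(A *m x) i 0| <= (\sum_i \sum_j `|A i j|) * b)%R.
Proof.
move=> b0 xb i; rewrite mxE.
rewrite (le_trans (ler_norm_sum _ _ _))//.
rewrite (@le_trans _ _ (\sum_j `|A i j| * b)%R)//.
  by apply: ler_sum => j _; rewrite normrM ler_wpM2l.
rewrite -mulr_suml ler_wpM2r//.
rewrite [leRHS](bigD1 i)//= lerDl; apply: sumr_ge0 => k _.
by apply: sumr_ge0 => j _.
Qed.

(** The image of Lebesgue measure under [A] is translation invariant and finite on boxes, hence a
    multiple of Lebesgue measure. The factor is left abstract: where its value matters, it is found
    by testing on one box or on the Gaussian. *)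
Lemma lebesgue_cV_linear n (A : 'M[R]_n) : A \in unitmx ->
  exists2 c : R, (0 < c)%R &
    forall B : set 'cV[R]_n, measurable B ->
      LC n ((fun x => A *m x) @^-1` B) = c%:E * LC n B.
Proof.
move=> Au.
have mA := measurable_cV_mul A.
pose mu : {measure set 'cV[R]_n -> \bar R} :=
  measure_function_pushforward__canonical__measure_function_Measure (LC n) mA.
have muE B : mu B = LC n ((fun x => A *m x) @^-1` B) by [].
have preE (a b : R) : (fun x => A *m x) @^-1` [set x : 'cV[R]_n | forall i, (a <= x i 0 <= b)%R] =
  [set x : 'cV[R]_n | forall i, (a <= (A *m x) i 0 <= b)%R] by [].
have boxfin (b : R) : (0 <= b)%R -> mu [set x : 'cV[R]_n | forall i, (- b <= x i 0 <= b)%R] < +oo.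
  move=> b0; rewrite muE.
  apply: (@lebesgue_bounded_fin _ _ ((\sum_i \sum_j `|invmx A i j|) * b)%R).
  - by apply: preimage_measurable => //; exact: measurable_box.
  - apply: mulr_ge0 => //; apply: sumr_ge0 => i _; apply: sumr_ge0 => j _ //.
  - move=> x i /= h; rewrite -[x]mul1mx -(mulVmx Au) -mulmxA.
    by apply: mulmx_bound => // j; rewrite ler_norml h.
have sf : sigma_finite setT mu.
  exists (fun k => [set x : 'cV[R]_n | forall i, (- k%:R <= x i 0 <= k%:R)%R]).
    apply/seteqP; split=> x // _.
    have [k xk] : exists k : nat, (\sum_i `|x i 0| <= k%:R)%R.
      exists (Num.bound (\sum_i `|x i 0|)%R); apply/ltW.
      by apply: archi_boundP; apply: sumr_ge0.
    exists k => //= i; rewrite -ler_norml; apply: le_trans xk.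
    by rewrite (bigD1 i)//= lerDl; apply: sumr_ge0.
  by move=> k; split; [exact: measurable_box|exact: boxfin].
have [mu' mu'E _] := sf_measureP sf.
have inv (w : 'cV[R]_n) (B : set 'cV[R]_n) : measurable B ->
     mu' ((fun x => x + w)%R @^-1` B) = mu' B.
  move=> mB; rewrite !mu'E !muE.
  have := @lebesgue_cV_shift R n (invmx A *m w) ((fun x => A *m x) @^-1` B).
  rewrite /pushforward => <-; last exact: preimage_measurable.
  congr (LC n _); apply/seteqP; split=> x /=;
  by rewrite mulmxDr mulmxA mulmxV// mul1mx.
have main (B : set 'cV[R]_n) : measurable B -> mu' B = mu' (@ucube n) * LC n B.
  move=> mB; have := translation_invariant_uniq inv mB (@measurable_ucube n).
  by rewrite lebesgue_ucube mule1 lebesgue_cV_opp.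
have fin : mu' (@ucube n) < +oo.
  rewrite mu'E.
  apply: le_lt_trans (boxfin 1%R ler01).
  apply: le_measure; rewrite ?inE; [exact: measurable_ucube|exact: measurable_box|].
  by move=> x /= h i; have := h i; lra.
have cfin : mu' (@ucube n) \is a fin_num by rewrite ge0_fin_numE.
exists (fine (mu' (@ucube n))); last first.
  by move=> B mB; rewrite fineK// -muE -mu'E; exact: main.
have pos : 0 < mu' (@ucube n).
  (* A zero factor would give measure 0 to the whole space. *)
  rewrite lt0e measure_ge0 andbT; apply/eqP => c0.
  have := main setT measurableT; rewrite c0 mul0e mu'E muE preimage_setT => T0.
  have : LC n (@ucube n) <= LC n setT.
    by apply: le_measure; rewrite ?inE//; exact: measurable_ucube.
  by rewrite lebesgue_ucube T0 leNgt lte_fin ltr01.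
by rewrite fine_gt0// pos fin.
Qed.

Lemma ge0_integral_linear n (A : 'M[R]_n) : A \in unitmx ->
  exists2 c : R, (0 < c)%R &
    forall f : 'cV[R]_n -> \bar R, measurable_fun setT f -> (forall x, 0 <= f x) ->
      \int[LC n]_x f (A *m x) = c%:E * \int[LC n]_x f x.
Proof.
move=> Au; have [c c0 cP] := lebesgue_cV_linear Au.
exists c => // f mf f0.
apply: (@ge0_integral_comp _ _ _ _ R (fun x => A *m x) (NngNum (ltW c0)) (LC n) (LC n) f) => //.
exact: measurable_cV_mul.
Qed.

Lemma lebesgue_cV_scale n (r : R) (B : set 'cV[R]_n) : (r != 0)%R -> measurable B ->
  LC n ((fun x => r *: x)%R @^-1` B) = (`|r| ^- n)%:E * LC n B.
Proof.
move=> r0 mB.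
have u : (r%:M : 'M[R]_n) \in unitmx.
  by rewrite unitmxE det_scalar unitrX// unitfE.
have [c c0 cP] := lebesgue_cV_linear u.
have E (C : set 'cV[R]_n) : measurable C -> LC n ((fun x => r *: x)%R @^-1` C) = c%:E * LC n C.
  move=> mC; rewrite -cP//; congr (LC n _); apply/seteqP; split => x /=;
  by rewrite mul_scalar_mx.
rewrite E//; congr (_%:E * _).
(* The box of half-side |r| pulls back to the box of half-side 1 whatever the sign of [r], so 2^n =
   c (2 |r|)^n. *)
pose b : R := `|r|%R.
have b0 : (0 < b)%R by rewrite normr_gt0.
have := E _ (@measurable_box n (- b) b).
rewrite lebesgue_box; last by lra.
rewrite (_ : _ @^-1` _ = [set x : 'cV[R]_n | forall i, (- 1 <= x i 0 <= 1)%R]); last first.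
  apply/seteqP; split=> x /= h i; have := h i; rewrite !mxE -!ler_norml normrM.
    by rewrite -[leRHS]mulr1 ler_pM2l.
  by rewrite -[in X in _ -> X](mulr1 b) ler_pM2l.
rewrite lebesgue_box; last by lra.
have -> : (1 - -1 = 2 :> R)%R by lra.
have -> : (b - - b = 2 * b)%R by lra.
rewrite exprMn -EFinM => -[] /esym.
move=> /(congr1 (fun z => z / (2 ^+ n * b ^+ n)))%R.
rewrite mulfK; last by rewrite mulf_neq0// expf_neq0// lt0r_neq0.
move=> ->; rewrite invfM mulrA mulfV ?mul1r// expf_neq0//.
Qed.

Lemma ge0_integral_cV_scale n (r : R) (f : 'cV[R]_n -> \bar R) : (r != 0)%R ->
  measurable_fun setT f -> (forall x, 0 <= f x) ->
  \int[LC n]_x f (r *: x)%R = (`|r| ^- n)%:E * \int[LC n]_x f x.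
Proof.
move=> r0 mf f0.
have rn : (0 <= `|r| ^- n)%R by rewrite invr_ge0 exprn_ge0.
apply: (@ge0_integral_comp _ _ _ _ R (fun x : 'cV[R]_n => r *: x)%R (NngNum rn) (LC n) (LC n) f) => //.
  by apply: measurable_mx_scale.
by move=> B mB; exact: lebesgue_cV_scale.
Qed.

End linear_change_of_variables.

(** * Euclidean geometry *)

Section linear_algebra.
Context (R : realType).

Definition dot n (u v : 'cV[R]_n) : R := (u^T *m v) 0 0.

Lemma dotE n (u v : 'cV[R]_n) : dot u v = \sum_(i < n) u i 0 * v i 0.
Proof. by rewrite /dot mxE; apply: eq_bigr => i _; rewrite mxE. Qed.

Lemma dotxx n (u : 'cV[R]_n) : dot u u = sqnorm u.
Proof. by rewrite dotE; apply: eq_bigr => i _; rewrite expr2. Qed.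

Lemma dotC n (u v : 'cV[R]_n) : dot u v = dot v u.
Proof. by rewrite !dotE; apply: eq_bigr => i _; rewrite mulrC. Qed.

Lemma dotDl n (u v w : 'cV[R]_n) : dot (u + v) w = dot u w + dot v w.
Proof. by rewrite /dot linearD mulmxDl mxE. Qed.

Lemma dotDr n (u v w : 'cV[R]_n) : dot w (u + v) = dot w u + dot w v.
Proof. by rewrite /dot mulmxDr mxE. Qed.

Lemma dotNl n (u w : 'cV[R]_n) : dot (- u) w = - dot u w.
Proof. by rewrite /dot linearN mulNmx mxE. Qed.

Lemma dotNr n (u w : 'cV[R]_n) : dot w (- u) = - dot w u.
Proof. by rewrite /dot mulmxN mxE. Qed.

Lemma dotZl n a (u w : 'cV[R]_n) : dot (a *: u) w = a * dot u w.
Proof. by rewrite /dot linearZ/= -scalemxAl mxE. Qed.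

Lemma dotZr n a (u w : 'cV[R]_n) : dot w (a *: u) = a * dot w u.
Proof. by rewrite /dot -scalemxAr mxE. Qed.

Lemma dotMl m n (A : 'M[R]_(m, n)) u w : dot (A *m u) w = dot u (A^T *m w).
Proof. by rewrite /dot trmx_mul mulmxA. Qed.

Lemma dotMr m n (A : 'M[R]_(m, n)) u w : dot u (A *m w) = dot (A^T *m u) w.
Proof. by rewrite dotMl trmxK. Qed.

Lemma sqnorm_ge0 n (u : 'cV[R]_n) : 0 <= sqnorm u.
Proof. by apply: sumr_ge0 => i _; exact: sqr_ge0. Qed.

Lemma sqnorm_eq0 n (u : 'cV[R]_n) : (sqnorm u == 0) = (u == 0).
Proof.
apply/eqP/eqP => [h|->]; last by rewrite /sqnorm big1// => i _; rewrite mxE expr0n.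
apply/matrixP => i j; rewrite (ord1 j) mxE; apply/eqP.
by rewrite -sqrf_eq0; move/eqP: h; rewrite psumr_eq0 => [/allP/(_ i)|k _]; [apply; rewrite mem_index_enum|exact: sqr_ge0].
Qed.

Lemma sqnorm_gt0 n (u : 'cV[R]_n) : (0 < sqnorm u) = (u != 0).
Proof. by rewrite lt0r sqnorm_eq0 sqnorm_ge0 andbT. Qed.

Lemma sqnorm0 n : sqnorm (0 : 'cV[R]_n) = 0.
Proof. by apply/eqP; rewrite sqnorm_eq0. Qed.

Lemma sqnormD n (u v : 'cV[R]_n) : sqnorm (u + v) = sqnorm u + 2 * dot u v + sqnorm v.
Proof. by rewrite -!dotxx dotDl !dotDr (dotC v u); ring. Qed.

Lemma sqnormB n (u v : 'cV[R]_n) : sqnorm (u - v) = sqnorm u - 2 * dot u v + sqnorm v.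
Proof. by rewrite sqnormD -!dotxx dotNl !dotNr; ring. Qed.

Lemma sqnormN n (u : 'cV[R]_n) : sqnorm (- u) = sqnorm u.
Proof. by rewrite -!dotxx dotNl dotNr opprK. Qed.

Lemma sqnormZ n a (u : 'cV[R]_n) : sqnorm (a *: u) = a ^+ 2 * sqnorm u.
Proof. by rewrite -!dotxx dotZl dotZr; ring. Qed.

Lemma enormE n (u : 'cV[R]_n) : enorm u = Num.sqrt (sqnorm u).
Proof. by []. Qed.

Lemma sqr_enorm n (u : 'cV[R]_n) : enorm u ^+ 2 = sqnorm u.
Proof. by rewrite sqr_sqrtr// sqnorm_ge0. Qed.

Lemma enorm_ge0 n (u : 'cV[R]_n) : 0 <= enorm u.
Proof. exact: sqrtr_ge0. Qed.

Lemma enorm_eq0 n (u : 'cV[R]_n) : (enorm u == 0) = (u == 0).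
Proof. by rewrite -sqnorm_eq0 -sqr_enorm sqrf_eq0. Qed.

Lemma enorm_gt0 n (u : 'cV[R]_n) : (0 < enorm u) = (u != 0).
Proof. by rewrite lt0r enorm_eq0 enorm_ge0 andbT. Qed.

Lemma enormZ n a (u : 'cV[R]_n) : enorm (a *: u) = `|a| * enorm u.
Proof. by rewrite !enormE sqnormZ sqrtrM ?sqr_ge0// sqrtr_sqr. Qed.

Lemma enormN n (u : 'cV[R]_n) : enorm (- u) = enorm u.
Proof. by rewrite !enormE sqnormN. Qed.

Lemma enorm0 n : enorm (0 : 'cV[R]_n) = 0.
Proof. by apply/eqP; rewrite enorm_eq0. Qed.

Lemma cauchy_schwarz n (u v : 'cV[R]_n) : dot u v <= enorm u * enorm v.
Proof.
have [->|u0] := eqVneq u 0.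
  by rewrite enorm0 mul0r dotE big1// => i _; rewrite mxE mul0r.
have [->|v0] := eqVneq v 0.
  by rewrite enorm0 mulr0 dotE big1// => i _; rewrite mxE mulr0.
move: u0 v0; rewrite -!enorm_gt0 => u0 v0.
have := sqnorm_ge0 ((enorm v) *: u - (enorm u) *: v).
rewrite sqnormB !sqnormZ -!sqr_enorm dotZl dotZr => h.
have uv0 : 0 < enorm u * enorm v by rewrite mulr_gt0.
rewrite -(ler_pM2l uv0); nra.
Qed.

Lemma ler_enormD n (u v : 'cV[R]_n) : enorm (u + v) <= enorm u + enorm v.
Proof.
rewrite -(@ler_pXn2r _ 2)// ?nnegrE ?addr_ge0 ?enorm_ge0//.
rewrite sqr_enorm sqnormD -!sqr_enorm.
have := cauchy_schwarz u v; nra.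
Qed.

Lemma coord_le_enorm n (u : 'cV[R]_n) i : `|u i 0| <= enorm u.
Proof.
rewrite -sqrtr_sqr; apply: ler_wsqrtr; rewrite /sqnorm (bigD1 i)//= lerDl.
by apply: sumr_ge0 => j _; exact: sqr_ge0.
Qed.

Lemma enorm_le_sum n (u : 'cV[R]_n) : enorm u <= \sum_i `|u i 0|.
Proof.
have -> : u = \sum_i (u i 0 *: delta_mx i 0).
  rewrite [LHS]matrix_sum_delta; apply: eq_bigr => i _.
  by rewrite big_ord_recl big_ord0 addr0.
apply: (@big_ind2 _ _ (fun a b => enorm a <= b)).
- by rewrite enorm0.
- by move=> a b c d ab cd; apply: le_trans (ler_enormD _ _) _; exact: lerD.
- move=> i _; rewrite enormZ.
  have -> : enorm (delta_mx i 0 : 'cV[R]_n) = 1.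
    rewrite enormE /sqnorm (bigD1 i)//= big1.
      by rewrite mxE !eqxx expr1n addr0 sqrtr1.
    by move=> j ji; rewrite mxE (negbTE ji) expr0n.
  rewrite mulr1 summxE (bigD1 i)//= !mxE !eqxx mulr1 big1 ?addr0//.
  by move=> j ji; rewrite !mxE eq_sym (negbTE ji) mulr0.
Qed.

Lemma enorm_mulmx_le m n (A : 'M[R]_(m, n)) :
  exists2 C : R, 0 < C & forall x, enorm (A *m x) <= C * enorm x.
Proof.
exists (1 + \sum_i \sum_j `|A i j|).
  by rewrite ltr_pwDl// sumr_ge0// => i _; apply: sumr_ge0.
move=> x; apply: le_trans (enorm_le_sum _) _.
rewrite mulrDl mul1r ler_wpDl ?enorm_ge0// mulr_suml; apply: ler_sum => i _.
rewrite mxE (le_trans (ler_norm_sum _ _ _))// mulr_suml.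
by apply: ler_sum => j _; rewrite normrM ler_wpM2l// coord_le_enorm.
Qed.

Lemma posdef_unitmx n (P : 'M[R]_n) : posdef P -> P \in unitmx.
Proof.
move=> [Psym Ppos]; rewrite -row_free_unit; apply/row_freeP.
suff : row_free P by move/row_freeP.
rewrite -kermx_eq0; apply/eqP/row_matrixP => i; rewrite row0.
set w := row i _.
have wP : w *m P = 0 by rewrite /w -row_mul mulmx_ker row0.
apply/eqP/negP => /negP w0.
have := Ppos w^T; rewrite trmxK wP mul0mx mxE ltxx => h.
by have : false by apply: h; rewrite trmx_eq0.
Qed.

(** By induction through the Schur complement of the upper left entry. Invertibility of [L] is read
    off from that of L L^T; it is what later makes z -> L z preserve null sets. *)
Lemma posdef_cholesky n (D : 'M[R]_n) : posdef D ->
  exists2 L : 'M[R]_n, L \in unitmx & L *m L^T = D.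
Proof.
suff H : posdef D -> exists L : 'M[R]_n, L *m L^T = D.
  move=> pD; have [L LD] := H pD; exists L => //.
  by have := posdef_unitmx pD; rewrite -LD unitmx_mul => /andP[].
elim: n D => [|n IH] D [Dsym Dpos].
  by exists 0; apply/matrixP => -[].
pose D1 : 'M[R]_(1 + n) := D.
pose a := D1 0 0.
pose b : 'cV[R]_n := dlsubmx D1.
pose D' : 'M[R]_n := drsubmx D1.
have D1sym : D1^T = D1 by exact: Dsym.
have ulE : ulsubmx D1 = a%:M.
  by apply/matrixP => i j; rewrite !ord1 !mxE/= mulr1n; congr (D1 _ _); apply/val_inj.
have urE : ursubmx D1 = b^T by rewrite -[in LHS]D1sym -trmx_dlsub.
have DE : D1 = block_mx a%:M b^T b D' by rewrite -ulE -urE submxK.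
have a0 : 0 < a.
  have e0 : delta_mx 0 0 != 0 :> 'cV[R]_n.+1.
    by apply/eqP => /matrixP/(_ 0 0)/eqP; rewrite !mxE eqxx oner_eq0.
  have := Dpos _ e0.
  by rewrite -mulmxA -colE trmx_delta -rowE !mxE.
pose S : 'M[R]_n := D' - a^-1 *: (b *m b^T).
have Spos : posdef S.
  split.
    rewrite /S linearB/= linearZ/= trmx_mul trmxK; congr (_ - _).
    by rewrite /D' trmx_drsub D1sym.
  move=> v v0.
  (* The first entry minimises the quadratic form of [D] for the given [v]: then D w has upper entry
     0, and w^T D w = v^T S v. *)
  pose w : 'cV[R]_(1 + n) := col_mx (- (a^-1 *: (b^T *m v))) v.
  have w0 : w != 0.
    apply: contra_neq v0 => w0; rewrite -(col_mxKd (- (a^-1 *: (b^T *m v))) v).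
    by rewrite -/w w0 linear0.
  have DwE : D1 *m w = col_mx 0 (S *m v).
    rewrite DE /w mul_block_col; congr col_mx.
      rewrite mul_scalar_mx scalerN scalerA divff ?gt_eqF// scale1r addrC subrr //.
    by rewrite /S mulmxBl mulmxN -scalemxAr -scalemxAl mulmxA addrC.
  have := Dpos (w : 'cV[R]_n.+1) w0.
  by rewrite -mulmxA [X in w^T *m X]DwE /w tr_col_mx mul_row_col mulmx0 add0r mulmxA.
have [L' L'E] := IH S Spos.
pose L : 'M[R]_(1 + n) := block_mx (Num.sqrt a)%:M 0 ((Num.sqrt a)^-1 *: b) L'.
exists (L : 'M[R]_n.+1).
have sa : Num.sqrt a != 0 by rewrite gt_eqF// sqrtr_gt0.
have -> : L *m L^T = D1; last by [].
rewrite DE /L tr_block_mx mulmx_block trmx0 !mulmx0 !mul0mx !addr0 tr_scalar_mx.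
rewrite L'E linearZ/=; congr block_mx.
- by rewrite -scalar_mxM -expr2 sqr_sqrtr// ltW.
- by rewrite mul_scalar_mx scalerA divff// scale1r.
- by rewrite mul_mx_scalar scalerA divff// scale1r.
- rewrite -scalemxAl -scalemxAr scalerA -invfM -expr2 sqr_sqrtr; last exact: ltW.
  by rewrite /S addrC subrK.
Qed.

Lemma dot_orthogonal n (B : 'M[R]_n) (u v : 'cV[R]_n) :
  B^T *m B = 1%:M -> dot (B *m u) (B *m v) = dot u v.
Proof. by move=> BTB; rewrite dotMl mulmxA BTB mul1mx. Qed.

Lemma enorm_orthogonal n (B : 'M[R]_n) (u : 'cV[R]_n) :
  B^T *m B = 1%:M -> enorm (B *m u) = enorm u.
Proof. by move=> BTB; rewrite !enormE -!dotxx dot_orthogonal. Qed.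

(** The reflection in the hyperplane orthogonal to u - v exchanges u and v, because |u| = |v| gives
    |u - v|^2 = 2 (u - v).u. It supplies the rotation that carries the first basis vector to any
    unit vector. *)
Lemma householder n (u v : 'cV[R]_n) : enorm u = 1 -> enorm v = 1 ->
  exists2 O : 'M[R]_n, O^T *m O = 1%:M & O *m u = v.
Proof.
move=> u1 v1; have [->|uv] := eqVneq u v.
  by exists 1%:M; rewrite ?mul1mx// trmx1 mulmx1.
pose w := u - v.
have w0 : 0 < sqnorm w by rewrite sqnorm_gt0 subr_eq0.
have wE : sqnorm w = 2 * dot w u.
  rewrite sqnormB -!sqr_enorm u1 v1 dotDl dotNl dotxx -sqr_enorm u1 (dotC v).
  by ring.
pose O : 'M[R]_n := 1%:M - (2 / sqnorm w) *: (w *m w^T).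
have Osym : O^T = O.
  by rewrite /O linearB/= linearZ/= trmx1 trmx_mul trmxK.
have OE (x : 'cV[R]_n) : O *m x = x - (2 / sqnorm w * dot w x) *: w.
  rewrite /O mulmxBl mul1mx -scalemxAl -mulmxA -scalerA; congr (_ - _ *: _).
  by rewrite (mx11_scalar (w^T *m x)) mul_mx_scalar.
have OO (x : 'cV[R]_n) : O *m (O *m x) = x.
  rewrite !OE dotDr dotNr dotZr dotxx -addrA -opprD -scalerDl.
  set k := (k in _ - k *: w).
  have -> : k = 0 by rewrite /k; field; rewrite gt_eqF.
  by rewrite scale0r subr0.
exists O; last first.
  have du0 : dot w u != 0 by apply: contraTneq w0 => du0; rewrite wE du0 mulr0 ltxx.
  rewrite OE; set k := (k in _ - k *: w).
  have -> : k = 1 by rewrite /k wE; field.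
  by rewrite scale1r /w opprB addrC subrK.
rewrite Osym; apply/matrixP => i j.
have := OO (delta_mx j 0) => /matrixP /(_ i 0).
by rewrite mulmxA -colE !mxE eqxx andbT.
Qed.

End linear_algebra.

(** * Gaussian integrals *)

Section gaussian.
Context (R : realType).
Local Open Scope ereal_scope.
Local Notation LC n := (lebesgue_cV R n).

Definition gam n (x : 'cV[R]_n) : R := expR (- sqnorm x).

Lemma gam_ge0 n (x : 'cV[R]_n) : (0 <= gam x)%R.
Proof. exact: expR_ge0. Qed.

Lemma measurable_gam d (T : measurableType d) n (f : T -> 'cV[R]_n) :
  measurable_fun setT f -> measurable_fun setT (fun t => gam (f t)).
Proof.
move=> mf; rewrite /gam; apply: measurable_expR_comp.
by apply: measurable_funN; exact: measurable_sqnorm.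
Qed.

Lemma sqnorm_cons n (t : R) (v : 'cV[R]_n) : sqnorm (cV_cons (t, v)) = (t ^+ 2 + sqnorm v)%R.
Proof.
rewrite /sqnorm big_ord_recl/= mxE unlift_none/=; congr (_ + _)%R.
by apply: eq_bigr => i _; rewrite mxE liftK.
Qed.

Lemma integral_gam n : \int[LC n]_x (gam x)%:E = (Num.sqrt pi ^+ n)%:E.
Proof.
have mg k : measurable_fun setT (fun x : 'cV[R]_k => (gam x)%:E).
  by apply/measurable_EFinP; apply: measurable_gam.
have g0 k (x : 'cV[R]_k) : 0 <= (gam x)%:E by rewrite lee_fin gam_ge0.
elim: n => [|n IH].
  rewrite expr0 [LHS](integral_dirac _ _ (mg 0%N))//.
  by rewrite diracE mem_set// mul1e /gam sqnorm0 oppr0 expR0.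
rewrite ge0_integral_cVS//.
transitivity (\int[lebesgue_measure]_(t in [set: R]) ((gauss_fun t)%:E * (Num.sqrt pi ^+ n)%:E)).
  apply: eq_integral => t _.
  rewrite -IH -ge0_integralZl//; last 2 first.
  - exact: mg.
  - by rewrite lee_fin gauss_fun_ge0.
  by apply: eq_integral => v _; rewrite /gam sqnorm_cons opprD expRD EFinM.
rewrite ge0_integralZr//.
- by rewrite integralT_gauss -EFinM -exprS.
- by apply/measurable_EFinP; exact: measurable_gauss_fun.
- by move=> x _; rewrite lee_fin gauss_fun_ge0.
Qed.

Lemma gam_orthogonal n (B : 'M[R]_n) (x : 'cV[R]_n) :
  (B^T *m B = 1%:M)%R -> gam (B *m x) = gam x.
Proof. by move=> BTB; rewrite /gam -!sqr_enorm enorm_orthogonal. Qed.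

(** The factor of [ge0_integral_linear] is 1 because the Gaussian is fixed by [B] and its integral
    is positive and finite. *)
Lemma ge0_integral_orthogonal n (B : 'M[R]_n) (f : 'cV[R]_n -> \bar R) :
  (B^T *m B = 1%:M)%R -> measurable_fun setT f -> (forall x, 0 <= f x) ->
  \int[LC n]_x f (B *m x) = \int[LC n]_x f x.
Proof.
move=> BTB mf f0; have Bu : B \in unitmx by have [] := mulmx1_unit BTB.
have [c c0 cP] := ge0_integral_linear Bu; rewrite cP// -[RHS]mul1e; congr (_%:E * _).
have mg : measurable_fun setT (fun x : 'cV[R]_n => (gam x)%:E).
  by apply/measurable_EFinP; apply: measurable_gam.
have := cP _ mg (fun x => gam_ge0 x).
under eq_integral do rewrite gam_orthogonal//.
rewrite integral_gam -EFinM => -[] /esym /eqP.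
rewrite -subr_eq0 -[X in (_ - X)%R]mul1r -mulrBl mulf_eq0 subr_eq0 => /orP[/eqP//|].
by rewrite expf_eq0 sqrtr_eq0 leNgt pi_gt0 andbF.
Qed.

(** The substitution v = A1 y + L z is made in y, so that [L] can also be 0 or -L. Completing the
    square in z then splits the exponent into |A2^-1 v|^2 and a form in a translate of z, whose
    integral no longer depends on v. *)
Lemma gauss_convolution n (A1 L A2 : 'M[R]_n) (h : 'cV[R]_n -> \bar R) :
  A1 \in unitmx -> A2 \in unitmx ->
  (A1 *m A1^T + L *m L^T = A2 *m A2^T)%R ->
  measurable_fun setT h -> (forall x, 0 <= h x) ->
  \int[LC n]_z \int[LC n]_y (h (A1 *m y + L *m z)%R * (gam y * gam z)%:E)
  = (Num.sqrt pi ^+ n)%:E * \int[LC n]_w (h (A2 *m w) * (gam w)%:E).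
Proof.
move=> A1u A2u AE.
pose N := invmx A1 *m L.
pose M : 'M[R]_n := (1%:M + N^T *m N)%R.
have Mpos : posdef M.
  split; first by rewrite /M linearD/= trmx1 trmx_mul trmxK.
  move=> v v0; rewrite -mulmxA -/(dot v (M *m v)) /M mulmxDl mul1mx dotDr -mulmxA.
  rewrite dotMr trmxK !dotxx; apply: ltr_pwDl; last exact: sqnorm_ge0.
  by rewrite sqnorm_gt0.
have Mu := posdef_unitmx Mpos.
have Msym : M^T = M by case: Mpos.
(* Woodbury's formula for the inverse of 1 + N N^T. *)
have key : ((1%:M + N *m N^T) *m (1%:M - N *m invmx M *m N^T) = 1%:M)%R.
  rewrite mulmxBr mulmx1 mulmxDl mul1mx.
  have -> : (N *m N^T *m (N *m invmx M *m N^T) = N *m (N^T *m N) *m invmx M *m N^T)%R.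
    by rewrite !mulmxA.
  have -> : (N^T *m N = M - 1%:M)%R by rewrite /M [(1%:M + _)%R]addrC addrK.
  rewrite mulmxBr mulmx1 mulmxBl -(mulmxA N M) mulmxV// mulmx1 mulmxBl.
  by rewrite [X in (_ - X)%R]addrC subrK addrK.
(* Since A2 A2^T = A1 (1 + N N^T) A1^T, both sides are the quadratic form of the inverse of A2
   A2^T. *)
have key2 (v : 'cV[R]_n) :
    (dot (invmx A1 *m v) ((1%:M - N *m invmx M *m N^T) *m (invmx A1 *m v)) = sqnorm (invmx A2 *m v))%R.
  have NE : (A1 *m (1%:M + N *m N^T) *m A1^T = A2 *m A2^T)%R.
    rewrite -AE mulmxDr mulmx1 mulmxDl; congr (_ + _)%R.
    by rewrite /N trmx_mul !mulmxA mulmxV// mul1mx -!mulmxA -trmx_mul mulmxV// trmx1 mulmx1.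
  set a := invmx A1 *m v; set b := invmx A2 *m v.
  set a' := (_ *m a).
  pose x := invmx A1^T *m a'.
  have A1Tu : A1^T \in unitmx by rewrite unitmx_tr.
  have a'E : a' = A1^T *m x by rewrite /x mulmxA mulmxV// mul1mx.
  have vE : v = A2 *m (A2^T *m x).
    have E : ((1%:M + N *m N^T) *m a' = a)%R by rewrite /a' mulmxA key mul1mx.
    rewrite mulmxA -NE -(mulmxA _ A1^T) -a'E -mulmxA E.
    by rewrite /a mulmxA mulmxV// mul1mx.
  have bE : A2^T *m x = b by rewrite /b [in RHS]vE (mulmxA (invmx A2) A2) mulVmx// mul1mx.
  rewrite a'E -dotMl /a mulmxA mulmxV// mul1mx {1}vE dotMl bE.
  by rewrite -dotxx.
(* The completed square: for given v, the left side is minimal at z = M^-1 N^T A1^-1 v, with minimum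
   |A2^-1 v|^2. *)
have key3 (v z : 'cV[R]_n) :
   (sqnorm (invmx A1 *m (v - L *m z)) + sqnorm z =
    dot (z - invmx M *m N^T *m invmx A1 *m v) (M *m (z - invmx M *m N^T *m invmx A1 *m v))
    + sqnorm (invmx A2 *m v))%R.
  rewrite -key2 mulmxBr mulmxA -/N sqnormB.
  rewrite -(mulmxA _ _ v); set a := invmx A1 *m v.
  rewrite -(mulmxA _ _ a); set m := invmx M *m (N^T *m a).
  have Mm : M *m m = N^T *m a by rewrite /m (mulmxA M (invmx M)) mulmxV// mul1mx.
  have zMz : dot z (M *m z) = (sqnorm z + sqnorm (N *m z))%R.
    by rewrite /M mulmxDl mul1mx dotDr -mulmxA dotMr trmxK !dotxx.
  have mMz : dot m (M *m z) = dot a (N *m z).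
    by rewrite dotMr Msym Mm dotMl trmxK.
  have zMm : dot z (M *m m) = dot a (N *m z).
    by rewrite Mm dotC dotMl trmxK.
  have mMm : dot m (M *m m) = dot a (N *m invmx M *m N^T *m a).
    by rewrite Mm dotC dotMl trmxK /m !mulmxA.
  rewrite mulmxBr mulmxBl mul1mx !(dotDl, dotDr, dotNl, dotNr) zMz mMz zMm mMm dotxx.
  ring.
have [c1 c10 c1P] := ge0_integral_linear A1u.
have [c2 c20 c2P] := ge0_integral_linear A2u.
pose W z := dot z (M *m z).
pose G := \int[LC n]_z (expR (- W z))%:E.
have mW : measurable_fun setT W.
  rewrite (_ : W = fun z => \sum_(i < n) z i 0 * (M *m z) i 0)%R; last by apply/funext => z; rewrite /W dotE.
  apply: measurable_sum => i; apply: measurable_funM; first exact: measurable_coord.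
  exact: measurableT_comp (@measurable_coord R n i) (measurable_cV_mul M).
have meW : measurable_fun setT (fun z => (expR (- W z))%:E).
  apply/measurable_EFinP; apply: measurable_expR_comp.
  exact: measurable_funN.
have general (f : 'cV[R]_n -> \bar R) : measurable_fun setT f -> (forall x, 0 <= f x) ->
    \int[LC n]_z \int[LC n]_y (f (A1 *m y + L *m z)%R * (gam y * gam z)%:E)
  = c1%:E * G * c2^-1%:E * \int[LC n]_w (f (A2 *m w) * (gam w)%:E).
  move=> mf f0.
  have mfA (B : 'M[R]_n) : measurable_fun setT (fun v : 'cV[R]_n => f v * (gam (B *m v))%:E).
    apply: emeasurable_funM => //; apply/measurable_EFinP; apply: measurable_gam.
    exact: measurable_cV_mul.
  pose F (p : 'cV[R]_n * 'cV[R]_n) : \bar R :=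
    f p.2 * (gam (invmx A1 *m (p.2 - L *m p.1)) * gam p.1)%:E.
  have mF : measurable_fun setT F.
    apply: emeasurable_funM; first exact: measurableT_comp mf measurable_snd.
    apply/measurable_EFinP; apply: measurable_funM; last exact: measurable_gam.
    by apply: measurable_gam; apply: measurable_mx_mul; apply: measurable_mx_sub => //; apply: measurable_mx_mul.
  have F0 p : 0 <= F p by rewrite mule_ge0// lee_fin mulr_ge0// gam_ge0.
  transitivity (\int[LC n]_z (c1%:E * \int[LC n]_v F (z, v))).
    apply: eq_integral => z _.
    have mFz : measurable_fun setT (fun v => F (z, v)) by exact: measurableT_comp mF (measurable_pair1 z).
    rewrite -(ge0_integral_cV_shift (L *m z) mFz)//.
    have mFw : measurable_fun setT (fun v : 'cV[R]_n => F (z, (v + L *m z)%R)).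
      exact: measurableT_comp mFz (measurable_cV_shift (L *m z)).
    rewrite -[RHS](c1P _ mFw (fun v => F0 _)).
    by apply: eq_integral => y _; rewrite /F/= addrK mulmxA mulVmx// mul1mx.
  rewrite ge0_integralZl//; last 3 first.
  - exact: measurable_fun_fubini_tonelli_F.
  - by move=> z _; apply: integral_ge0 => v _; exact: F0.
  - by rewrite lee_fin ltW.
  rewrite (@fubini_tonelli _ _ _ _ R (LC n) (LC n) F mF F0).
  rewrite -!muleA; congr (_ * _).
  transitivity (\int[LC n]_v (G * (f v * (gam (invmx A2 *m v))%:E))).
    apply: eq_integral => v _.
    pose w := (- (invmx M *m N^T *m invmx A1 *m v))%R.
    rewrite /G -(ge0_integral_cV_shift w meW); last by move=> z; rewrite lee_fin expR_ge0.
    have mWw : measurable_fun setT (fun z : 'cV[R]_n => (expR (- W (z + w)))%:E).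
      exact: measurableT_comp meW (measurable_cV_shift w).
    rewrite -ge0_integralZr//; last by rewrite mule_ge0// lee_fin gam_ge0.
    apply: eq_integral => z _; rewrite /F/= muleCA -EFinM; congr (_ * _%:E).
    rewrite /gam -!expRD; congr expR.
    by rewrite -opprD key3 opprD.
  rewrite ge0_integralZl//; last 2 first.
  - by move=> v _; rewrite mule_ge0// lee_fin gam_ge0.
  - by apply: integral_ge0 => z _; rewrite lee_fin expR_ge0.
  congr (_ * _).
  have fA0 v : 0 <= f v * (gam (invmx A2 *m v))%:E by rewrite mule_ge0// lee_fin gam_ge0.
  have -> : \int[LC n]_w (f (A2 *m w) * (gam w)%:E) =
      c2%:E * \int[LC n]_v (f v * (gam (invmx A2 *m v))%:E).
    rewrite -[RHS](c2P _ (mfA _) fA0).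
    by apply: eq_integral => w _; rewrite mulmxA mulVmx// mul1mx.
  by rewrite muleA -EFinM mulVf ?gt_eqF// mul1e.
move=> mh h0; rewrite (general h mh h0); congr (_ * _).
(* The factor in [general] does not depend on the function, so the constant function 1 reveals
   it. *)
have := general (fun=> 1) (measurable_cst _) (fun=> lee01).
under eq_integral do under eq_integral do rewrite mul1e EFinM.
under [in X in _ = X -> _]eq_integral do rewrite mul1e.
have mg : measurable_fun setT (fun x : 'cV[R]_n => (gam x)%:E).
  by apply/measurable_EFinP; apply: measurable_gam.
have g0 (x : 'cV[R]_n) : 0 <= (gam x)%:E by rewrite lee_fin gam_ge0.
under eq_integral do rewrite ge0_integralZr// integral_gam.
rewrite ge0_integralZl// integral_gam ?lee_fin ?exprn_ge0// => E.
have p0 : (0 < Num.sqrt pi ^+ n :> R)%R by rewrite exprn_gt0// sqrtr_gt0 pi_gt0.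
have Ki (a b : \bar R) : a * (Num.sqrt pi ^+ n)%:E = b * (Num.sqrt pi ^+ n)%:E -> a = b.
  move=> /(congr1 (fun z => z * (Num.sqrt pi ^+ n)^-1%:E)).
  by rewrite -!muleA -EFinM divff ?gt_eqF// !mule1.
by apply/esym/Ki.
Qed.

End gaussian.

(** * Hausdorff measure *)

Section diameter_power.
Context (R : realType) (n m : nat).
Local Open Scope ereal_scope.
Implicit Types (U A B : set 'cV[R]_n).

Lemma diameter_ge0 U : U !=set0 -> 0 <= diameter U.
Proof.
move=> [x Ux]; apply: ereal_sup_ubound; exists (x, x) => //=.
by rewrite subrr enorm0.
Qed.

Lemma diameter_ub U x y : U x -> U y -> (enorm (x - y))%:E <= diameter U.
Proof. by move=> Ux Uy; apply: ereal_sup_ubound; exists (x, y). Qed.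

Lemma diameter_le U (d : \bar R) :
  (forall x y, U x -> U y -> (enorm (x - y))%:E <= d) -> diameter U <= d.
Proof. by move=> h; apply: ge_ereal_sup => _ [[x y] [/= Ux Uy] <-]; exact: h. Qed.

(** The summand of [hausdorff_content] as a function of all sets. The test keeps the diameter -oo of
    the empty set out of the power. *)
Definition diam_pow U : \bar R := if U != set0 then diameter U ^+ m else 0.

Lemma diam_pow0 : diam_pow set0 = 0.
Proof. by rewrite /diam_pow eqxx. Qed.

Lemma diam_pow_ge0 U : 0 <= diam_pow U.
Proof.
rewrite /diam_pow; case: ifPn => // /set0P/diameter_ge0; exact: expe_ge0.
Qed.

Lemma lee_expe2 (a b : \bar R) k : 0 <= a -> a <= b -> a ^+ k <= b ^+ k.
Proof.
move=> a0 ab; elim: k => [|k IH]; first by rewrite !expe0.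
by rewrite !expeS; apply: lee_pmul => //; exact: expe_ge0.
Qed.

End diameter_power.

(** Diameters may be infinite and [m] may be 0, where every nonempty set counts 1; hence the
    separate induction for +oo. *)
Lemma diam_pow_le (R : realType) n p m (U : set 'cV[R]_n) (V : set 'cV[R]_p) (c : R) : (0 < c)%R ->
  (V !=set0 -> U !=set0 /\ diameter V <= c%:E * diameter U)%E ->
  (diam_pow m V <= (c ^+ m)%:E * diam_pow m U)%E.
Proof.
move=> c0 h; rewrite {1}/diam_pow; case: ifPn => [/set0P V0|_]; last first.
  by rewrite mule_ge0// ?diam_pow_ge0// lee_fin exprn_ge0// ltW.
have [U0 VU] := h V0.
rewrite /diam_pow; move/set0P : (U0) => ->.
apply: le_trans (lee_expe2 m (diameter_ge0 V0) VU) _.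
have := diameter_ge0 U0; case: (diameter U) => [r|_|//].
  by move=> _; rewrite -EFinM -!EFin_expe -EFinM exprMn.
have cy : (0 <= c%:E * +oo)%E by rewrite mule_ge0// lee_fin ltW.
elim: m => [|k IH]; first by rewrite !expe0 expr0 mul1e.
rewrite !expeS exprS EFinM [leRHS]muleACA; apply: lee_pmul => //.
exact: expe_ge0.
Qed.

Section hausdorff_outer_measure.
Context (R : realType) (n m : nat).
Local Open Scope ereal_scope.
Implicit Types (U A B : set 'cV[R]_n).
Local Notation diam_pow := (@diam_pow R n m).

Lemma diam_pow_mono A B : A `<=` B -> diam_pow A <= diam_pow B.
Proof.
move=> AB; have := @diam_pow_le R n n m B A 1%R ltr01; rewrite expr1n !mul1e; apply.
move=> [x Ax]; split; first by exists x; exact: AB.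
by apply: diameter_le => y z Ay Az; apply: diameter_ub; exact: AB.
Qed.

(** A copy of R^n in which every set is measurable: the covers that define [mu_ext] there are covers
    by arbitrary sets, as in [hausdorff_content]. *)
Definition discrete_cV := 'cV[R]_n.

HB.instance Definition _ := Pointed.on discrete_cV.

HB.instance Definition _ := @isMeasurable.Build default_measure_display discrete_cV
  setT I (fun _ _ => I) (fun _ _ => I).

(** The size restriction on covers is turned into an infinite price for large sets. The content
    becomes the outer measure generated by a set function, which brings countable subadditivity. *)
Definition diam_pow_small (delta : R) (U : set discrete_cV) : \bar R :=
  if (U == set0) || (diameter U <= delta%:E) then diam_pow U else +oo.

Lemma diam_pow_small_ge0 delta U : 0 <= diam_pow_small delta U.
Proof. by rewrite /diam_pow_small; case: ifP => // _; exact: diam_pow_ge0. Qed.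

Lemma diam_pow_small0 delta : diam_pow_small delta set0 = 0.
Proof. by rewrite /diam_pow_small eqxx/= diam_pow0. Qed.

Lemma hausdorff_contentE delta A :
  hausdorff_content m delta A = mu_ext (diam_pow_small delta) A.
Proof.
apply/eqP; rewrite eq_le; apply/andP; split; apply: le_ereal_inf_tmp.
- move=> _ [U [mU AU] <-].
  have [allsmall|] := pselect (forall k, (U k == set0) || (diameter (U k) <= delta%:E)); last first.
    move/existsNP => [k /negP Uk].
    rewrite (@eseries_pinfty _ _ xpredT k) ?leey//.
    - by move=> i _; rewrite gt_eqF// (lt_le_trans _ (diam_pow_small_ge0 _ _)).
    - by rewrite /diam_pow_small (negbTE Uk).
  apply: ereal_inf_lbound; exists U.
    split => // k; have /orP[/eqP ->|//] := allsmall k.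
    by rewrite /diameter set0X image_set0 ereal_sup0 leNye.
  rewrite eseries_mkcond; apply: eq_eseriesr => k _.
  by rewrite /diam_pow_small allsmall.
- move=> _ [U [AU Us] <-]; apply: ereal_inf_lbound; exists U; first by split.
  rewrite [RHS]eseries_mkcond; apply: eq_eseriesr => k _.
  by rewrite /diam_pow_small Us orbT.
Qed.

Lemma hausdorff_content_sup delta A : (0 < delta)%R ->
  hausdorff_content m delta A <= hausdorff_unnormalized m A.
Proof. by move=> d0; apply: ereal_sup_ubound; exists delta. Qed.

Lemma hausdorff_content_ge0 delta A : 0 <= hausdorff_content m delta A.
Proof. by rewrite hausdorff_contentE; apply: mu_ext_ge0; exact: diam_pow_small_ge0. Qed.

Lemma hausdorff_content0 delta : hausdorff_content m delta (@set0 'cV[R]_n) = 0.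
Proof.
rewrite hausdorff_contentE mu_ext0//.
- exact: diam_pow_small0.
- exact: diam_pow_small_ge0.
Qed.

Lemma le_hausdorff_content delta :
  {homo @hausdorff_content R n m delta : A B / A `<=` B >-> A <= B}.
Proof. by move=> A B AB; rewrite !hausdorff_contentE; exact: le_mu_ext. Qed.

Lemma hausdorff_content_sigma_subadditive delta :
  sigma_subadditive (@hausdorff_content R n m delta).
Proof.
move=> F; rewrite hausdorff_contentE.
under eq_eseriesr do rewrite hausdorff_contentE.
exact: (@mu_ext_sigma_subadditive _ discrete_cV R (diam_pow_small delta)
  (@diam_pow_small_ge0 delta) F).
Qed.

HB.instance Definition _ delta := isOuterMeasure.Build R 'cV[R]_n
  (@hausdorff_content R n m delta) (hausdorff_content0 delta)
  (hausdorff_content_ge0 delta) (@le_hausdorff_content delta)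
  (@hausdorff_content_sigma_subadditive delta).

Lemma hausdorff_unnormalized_ge0 A : 0 <= hausdorff_unnormalized m A.
Proof. exact: le_trans (hausdorff_content_ge0 1 A) (hausdorff_content_sup _ ltr01). Qed.

Lemma hausdorff_unnormalized0 : hausdorff_unnormalized m (@set0 'cV[R]_n) = 0.
Proof.
apply/eqP; rewrite eq_le hausdorff_unnormalized_ge0 andbT.
by apply: ge_ereal_sup => _ [d _ <-]; rewrite hausdorff_content0.
Qed.

Lemma le_hausdorff_unnormalized :
  {homo @hausdorff_unnormalized R n m : A B / A `<=` B >-> A <= B}.
Proof.
move=> A B AB; apply: ge_ereal_sup => _ [d d0 <-].
by apply: le_trans (hausdorff_content_sup _ d0); exact: le_hausdorff_content.
Qed.

Lemma hausdorff_sigma_subadditive :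
  sigma_subadditive (@hausdorff_unnormalized R n m).
Proof.
move=> F; apply: ge_ereal_sup => _ [d d0 <-].
apply: le_trans; first exact: hausdorff_content_sigma_subadditive.
apply: lee_nneseries => [k _ _|k _]; first exact: hausdorff_content_ge0.
exact: hausdorff_content_sup.
Qed.

HB.instance Definition _ := isOuterMeasure.Build R 'cV[R]_n
  (@hausdorff_unnormalized R n m) hausdorff_unnormalized0
  hausdorff_unnormalized_ge0 le_hausdorff_unnormalized
  hausdorff_sigma_subadditive.

Lemma hausdorff_content_le delta delta' A : (delta <= delta')%R ->
  hausdorff_content m delta' A <= hausdorff_content m delta A.
Proof.
move=> dd; apply: le_ereal_inf_tmp => _ [U [AU Us] <-].
apply: ereal_inf_lbound; exists U => //; split => // k.
by apply: le_trans (Us k) _; rewrite lee_fin.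
Qed.

(** A set of diameter at most [delta] < [eta] cannot meet both [A] and [B], so each member of a
    cover of the union is charged to one of them only. *)
Lemma hausdorff_content_separated delta eta A B : (delta < eta)%R ->
  (forall a b, A a -> B b -> (eta <= enorm (a - b))%R) ->
  hausdorff_content m delta A + hausdorff_content m delta B <=
  hausdorff_content m delta (A `|` B).
Proof.
move=> de sep; apply: le_ereal_inf_tmp => _ [U [ABU Us] <-].
rewrite eseries_mkcond.
apply: (@le_trans _ _ (\sum_(k <oo) diam_pow (U k `&` A) + \sum_(k <oo) diam_pow (U k `&` B))).
  have main C : C `<=` A `|` B -> hausdorff_content m delta C <= \sum_(k <oo) diam_pow (U k `&` C).
    move=> CAB; apply: ereal_inf_lbound; exists (fun k => U k `&` C).
      split.
        by move=> x Cx; have [k _ Ukx] := ABU x (CAB x Cx); exists k.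
      move=> k; apply: le_trans (Us k); apply: diameter_le => x y [Ux _] [Uy _].
      exact: diameter_ub.
    by rewrite eseries_mkcond.
  by apply: leeD; apply: main => x; [left|right].
rewrite -nneseriesD; last 2 first.
  by move=> k _ _; exact: diam_pow_ge0.
  by move=> k _ _; exact: diam_pow_ge0.
apply: lee_nneseries => [k _ _|k _].
  by rewrite adde_ge0// diam_pow_ge0.
have [A0|/eqP/set0P[a [Ua Aa]]] := pselect (U k `&` A = set0).
  rewrite A0 diam_pow0 add0e; apply: diam_pow_mono; exact: subIsetl.
have [B0|/eqP/set0P[b [Ub Bb]]] := pselect (U k `&` B = set0).
  rewrite B0 diam_pow0 adde0; apply: diam_pow_mono; exact: subIsetl.
have := le_trans (diameter_ub Ua Ub) (Us k).
by rewrite lee_fin => /(le_trans (sep _ _ Aa Bb)); rewrite leNgt de.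
Qed.

Lemma hausdorff_separated (eta : R) A B : (0 < eta)%R ->
  (forall a b, A a -> B b -> (eta <= enorm (a - b))%R) ->
  hausdorff_unnormalized m A + hausdorff_unnormalized m B <=
  hausdorff_unnormalized m (A `|` B).
Proof.
move=> eta0 sep.
set X := hausdorff_unnormalized m (A `|` B).
have [->|Xfin] := eqVneq X +oo; first by rewrite leey.
have Xnum : X \is a fin_num.
  by rewrite ge0_fin_numE ?hausdorff_unnormalized_ge0// ltey.
(* Contents grow as the scale shrinks, so a common scale [d] below [eta] serves for any d1 and d2.
   The two suprema are then taken one after the other, by subtracting finite quantities. *)
have sum (d1 d2 : R) : (0 < d1)%R -> (0 < d2)%R ->
    hausdorff_content m d1 A + hausdorff_content m d2 B <= X.
  move=> d10 d20; pose d := (Num.min (eta / 2) (Num.min d1 d2))%R.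
  have d0 : (0 < d)%R by rewrite !lt_min d10 d20 divr_gt0.
  apply: le_trans (hausdorff_content_sup _ d0).
  apply: le_trans (hausdorff_content_separated _ sep); last first.
    by rewrite !gt_min ltr_pdivrMr// ltr_pMr// ltr1n.
  by apply: leeD; apply: hausdorff_content_le; rewrite !ge_min lexx ?orbT.
have Bnum d : (0 < d)%R -> hausdorff_content m d B \is a fin_num.
  move=> d0; rewrite ge0_fin_numE ?hausdorff_content_ge0//.
  apply: le_lt_trans (hausdorff_content_sup B d0) _.
  apply: (@le_lt_trans _ _ X); last by rewrite ltey.
  by apply: le_hausdorff_unnormalized; right.
have Anum : hausdorff_unnormalized m A \is a fin_num.
  rewrite ge0_fin_numE ?hausdorff_unnormalized_ge0//.
  apply: (@le_lt_trans _ _ X); last by rewrite ltey.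
  by apply: le_hausdorff_unnormalized; left.
rewrite addeC -leeBrDr//; apply: ge_ereal_sup => _ [d d0 <-].
rewrite leeBrDr// addeC -leeBrDr ?Bnum//; apply: ge_ereal_sup => _ [d' d'0 <-].
by rewrite leeBrDr ?Bnum//; exact: sum.
Qed.

End hausdorff_outer_measure.

(** * Borel sets are measurable for Hausdorff measure *)

Section hausdorff_borel_measure.
Context (R : realType) (n m : nat).
Local Open Scope ereal_scope.
Local Notation H := (@hausdorff_unnormalized R n m).

(* Caratheodory's criterion for a half-space: the layers at distances between
   1/(k+2) and 1/(k+1) from it are separated two by two, hence the total
   measure of the even ones, and of the odd ones, is finite. *)
Lemma caratheodory_halfspace (i : 'I_n) (t : R) :
  H.-caratheodory [set x : 'cV[R]_n | (x i 0 <= t)%R].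
Proof.
apply: le_caratheodory_measurable => X; set E := [set x | _].
change (H (X `&` E) + H (X `&` ~` E) <= H X).
have [->|HXfin] := eqVneq (H X) +oo; first by rewrite leey.
have dist (x y : 'cV[R]_n) : (x i 0 - y i 0 <= enorm (x - y))%R.
  by have := coord_le_enorm (x - y) i; rewrite !mxE; apply: le_trans; exact: ler_norm.
have dist' (x y : 'cV[R]_n) : (y i 0 - x i 0 <= enorm (x - y))%R.
  by rewrite -opprB -(opprB y x) enormN opprB; exact: dist.
pose a k : R := k.+1%:R^-1%R.
have a_gt0 k : (0 < a k)%R by rewrite invr_gt0.
have a_dec k l : (k < l)%N -> (a l < a k)%R.
  by move=> kl; rewrite ltf_pV2 ?posrE// ltr_nat ltnS.
have a_dec' k l : (k <= l)%N -> (a l <= a k)%R.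
  by move=> kl; rewrite lef_pV2 ?posrE// ler_nat ltnS.
pose P k := X `&` [set x : 'cV[R]_n | (a k < x i 0 - t)%R].
pose L k := X `&` [set x : 'cV[R]_n | (a k.+1 < x i 0 - t <= a k)%R].
have EP k : H (X `&` E) + H (P k) <= H X.
  apply: (@le_trans _ _ (H (X `&` E `|` P k))); last first.
    by apply: le_hausdorff_unnormalized => x [[]|[]].
  apply: (@hausdorff_separated R n m (a k) _ _ (a_gt0 k)) => x y [_ /= Ex] [_ /= Py].
  have {}Ex : (x i 0 <= t)%R by [].
  by apply: le_trans (dist' x y); lra.
have PL k : X `&` ~` E `<=` P k `|` \bigcup_(j in ~` `I_k) L j.
  move=> x [Xx /negP]; rewrite -ltNge => tx.
  have [xk|xk] := ltP (a k) (x i 0 - t)%R; first by left.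
  right.
  have ex : exists j, (a j < x i 0 - t)%R.
    exists (Num.bound (x i 0 - t)^-1%R); rewrite /a invf_plt ?posrE ?subr_gt0//.
    apply: (lt_trans (archi_boundP _)); first by rewrite invr_ge0 subr_ge0 ltW.
    by rewrite ltr_nat.
  case: (ex_minnP ex) => -[|j] aj minj.
    by have := lt_le_trans aj xk; rewrite ltNge a_dec'.
  have jx : (x i 0 - t <= a j)%R.
    by rewrite leNgt; apply/negP => /minj; rewrite ltnn.
  exists j; last by split => //=; rewrite aj jx.
  move=> /= jk; have := lt_le_trans aj xk; rewrite ltNge => /negP; apply.
  exact: a_dec'.
(* If [c] skips at least one index each time, any two of the chosen layers have a skipped layer
   between them, hence a positive distance. It is applied to 2j and to 2j + 1. *)
have sepL (c : nat -> nat) : (forall j, (c j).+1 < c j.+1)%N -> forall N,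
    \sum_(0 <= j < N) H (L (c j)) <= H X.
  move=> cP N.
  have cmono k l : (k < l)%N -> ((c k).+1 < c l)%N.
    elim: l => // l IH; rewrite ltnS leq_eqVlt => /orP[/eqP ->//|/IH h].
    by apply: ltn_trans h (ltn_trans _ (cP l)).
  apply: (@le_trans _ _ (H (\big[setU/set0]_(0 <= j < N) L (c j)))); last first.
    apply: le_hausdorff_unnormalized; rewrite -bigcup_seq => x [j _ [Xx _]].
    exact: Xx.
  elim: N => [|N IH]; first by rewrite !big_nil hausdorff_unnormalized0.
  rewrite !big_nat_recr//=; apply: le_trans (leeD2r _ IH) _.
  have [|N0] := posnP N.
    move=> ->; rewrite !big_nil set0U hausdorff_unnormalized0 add0e//.
  have gap : (0 < a (c N.-1).+1 - a (c N))%R.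
    by rewrite subr_gt0 a_dec// cmono// prednK.
  apply: (@hausdorff_separated R n m _ _ _ gap) => x y; rewrite -bigcup_seq.
  move=> [j /=]; rewrite mem_index_iota => /andP[_ jN] [_ /= /andP[xj _]] [_ /= /andP[_ yN]].
  have : (a (c N.-1).+1 <= a (c j).+1)%R.
    apply: a_dec'; rewrite ltnS; have : (j <= N.-1)%N by rewrite -ltnS prednK.
    rewrite leq_eqVlt => /orP[/eqP ->//|/cmono h].
    by apply: ltnW; apply: ltn_trans h.
  move=> h; apply: le_trans (dist x y); lra.
have HXlt : H X < +oo by rewrite ltey.
have sumL : \sum_(j <oo) H (L j) < +oo.
  apply: (@le_lt_trans _ _ (H X + H X)); last by rewrite lte_add_pinfty.
  apply: lime_le; first by apply: is_cvg_nneseries => k _ _; exact: hausdorff_unnormalized_ge0.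
  apply: nearW => N.
  apply: (@le_trans _ _ (\sum_(0 <= j < N.*2) H (L j))).
    apply: lee_sum_nneg_natr => //; last by rewrite -addnn leq_addr.
    by move=> k _ _; exact: hausdorff_unnormalized_ge0.
  have -> : \sum_(0 <= j < N.*2) H (L j) =
      \sum_(0 <= j < N) H (L j.*2) + \sum_(0 <= j < N) H (L j.*2.+1).
    elim: N => [|N IH]; first by rewrite !big_nil adde0.
    by rewrite doubleS !big_nat_recr//= IH -!addeA; congr (_ + _); rewrite addeCA.
  apply: leeD.
    by apply: (sepL (fun j => j.*2)) => j; rewrite doubleS.
  by apply: (sepL (fun j => j.*2.+1)) => j; rewrite doubleS.
have tail := @nneseries_tail_cvg _ (fun j => H (L j)) xpredT sumL
  (fun k _ => hausdorff_unnormalized_ge0 _ _).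
have bound k : H (X `&` E) + H (X `&` ~` E) <= H X + \sum_(k <= j <oo) H (L j).
  apply: (@le_trans _ _ (H (X `&` E) + (H (P k) + \sum_(k <= j <oo) H (L j)))).
    rewrite leeD2l//; apply: le_trans (le_hausdorff_unnormalized _ (PL k)) _.
    apply: le_trans (outer_measureU2 H _ _) _.
    by rewrite leeD2l//; exact: outer_measure_sigma_subadditive_tail.
  by rewrite addeA leeD2r.
have lim : H X + \sum_(k <= j <oo) H (L j) @[k --> \oo] --> H X + 0.
  by apply: cvgeD => //; [exact: fin_num_adde_defl|exact: cvg_cst].
rewrite -[leRHS]adde0 -(cvg_lim _ lim)//; apply: lime_ge; first by apply/cvg_ex; exists (H X + 0).
exact: nearW.
Qed.

Let idc (x : caratheodory_type H) : 'cV[R]_n := x.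

(** Half-spaces generate the Borel sets, so each Borel set satisfies Caratheodory's condition; this
    is stated as measurability of the identity between the two sigma-algebras. *)
Lemma measurable_hausdorff_id : measurable_fun setT idc.
Proof.
apply/measurable_fun_coordP => i.
apply: (measurability _ (RGenOInfty.measurableE R)) => _ [_ [t ->] <-].
rewrite setTI.
have := caratheodory_measurable_setC (caratheodory_halfspace i t).
rewrite (_ : ~` _ = (fun x : caratheodory_type H => idc x i 0%R) @^-1` `]t, +oo[)//.
by apply/seteqP; split=> x /=; rewrite in_itv/= andbT; [move/negP; rewrite -ltNge|move=> h; apply/negP; rewrite -ltNge].
Qed.

Let Ho : {outer_measure set 'cV[R]_n -> \bar R} := H.

Let Hc : {measure set (caratheodory_type H) -> \bar R} :=
  [the {measure set (caratheodory_type Ho) -> \bar R} of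
    (Ho : set (caratheodory_type Ho) -> \bar R)].

(** The push-forward by the identity restricts the measure from the Caratheodory sets to the Borel
    sets. *)
Definition hausdorff_measure : {measure set 'cV[R]_n -> \bar R} :=
  measure_function_pushforward__canonical__measure_function_Measure
    Hc measurable_hausdorff_id.

Lemma hausdorff_measureE A : hausdorff_measure A = H A.
Proof. by []. Qed.

End hausdorff_borel_measure.

Section hausdorff_lipschitz.
Context (R : realType).
Local Open Scope ereal_scope.

(** The members of a cover are cut by [A] before taking images, because [f] is controlled only on
    [A]. *)
Lemma hausdorff_content_lipschitz n p m (f : 'cV[R]_n -> 'cV[R]_p)
    (A : set 'cV[R]_n) (L delta : R) : (0 < L)%R ->
  (forall x y, A x -> A y -> enorm (f x - f y) <= L * enorm (x - y))%R ->
  hausdorff_content m (L * delta)%R (f @` A) <=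
  (L ^+ m)%:E * hausdorff_content m delta A.
Proof.
move=> L0 fL.
have Lm : (0 < L ^+ m)%R by rewrite exprn_gt0.
have main : (L ^- m)%:E * hausdorff_content m (L * delta)%R (f @` A) <=
     hausdorff_content m delta A.
  apply: le_ereal_inf_tmp => _ [U [AU Us] <-].
  rewrite eseries_mkcond.
  have VU k : f @` (U k `&` A) !=set0 -> U k !=set0 /\
       diameter (f @` (U k `&` A)) <= L%:E * diameter (U k).
    move=> [_ [x [Ux Ax] _]]; split; first by exists x.
    apply: diameter_le => _ _ [y [Uy Ay] <-] [z [Uz Az] <-].
    apply: (@le_trans _ _ (L%:E * (enorm (y - z))%:E)).
      by rewrite -EFinM lee_fin; exact: fL.
    by rewrite lee_pmul2l// ?lte_fin//; exact: diameter_ub.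
  apply: (@le_trans _ _ ((L ^- m)%:E * \sum_(k <oo) diam_pow m (f @` (U k `&` A)))).
    rewrite lee_pmul2l ?lte_fin ?invr_gt0//; apply: ereal_inf_lbound.
    exists (fun k => f @` (U k `&` A)); last by rewrite eseries_mkcond.
    split.
      by move=> _ [x Ax <-]; have [k _ Uk] := AU x Ax; exists k => //; exists x.
    move=> k; have [V0|] := pselect (f @` (U k `&` A) !=set0).
      have [U0 h] := VU k V0; apply: le_trans h _.
      by rewrite EFinM lee_pmul2l// ?lte_fin.
    move=> /set0P/negP/negPn/eqP ->.
    by rewrite /diameter set0X image_set0 ereal_sup0 leNye.
  rewrite -nneseriesZl; last by move=> k _; exact: diam_pow_ge0.
  apply: lee_nneseries => [k _ _|k _].
    by rewrite mule_ge0// ?diam_pow_ge0// lee_fin invr_ge0 ltW.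
  apply: (@le_trans _ _ ((L ^- m)%:E * ((L ^+ m)%:E * diam_pow m (U k)))).
    rewrite lee_pmul2l ?lte_fin ?invr_gt0//; exact: (diam_pow_le m L0 (VU k)).
  have E : (L ^- m)%:E * ((L ^+ m)%:E * diam_pow m (U k)) = diam_pow m (U k).
    by rewrite muleA -EFinM mulVf ?mul1e// gt_eqF.
  by rewrite E.
have := lee_pmul (ltW (Lm : (0 < (L ^+ m)%:E))) (mule_ge0 _ (hausdorff_content_ge0 _ _ _)) (lexx _) main.
rewrite muleA -EFinM divff ?gt_eqF// mul1e; apply.
by rewrite lee_fin invr_ge0 ltW.
Qed.

Lemma hausdorff_lipschitz n p m (f : 'cV[R]_n -> 'cV[R]_p)
    (A : set 'cV[R]_n) (L : R) : (0 < L)%R ->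
  (forall x y, A x -> A y -> enorm (f x - f y) <= L * enorm (x - y))%R ->
  hausdorff_unnormalized m (f @` A) <= (L ^+ m)%:E * hausdorff_unnormalized m A.
Proof.
move=> L0 fL; apply: ge_ereal_sup => _ [d d0 <-].
have -> : d = (L * (d / L))%R by rewrite mulrCA divff ?gt_eqF// mulr1.
apply: le_trans (hausdorff_content_lipschitz m _ L0 fL) _.
rewrite lee_pmul2l ?lte_fin ?exprn_gt0//; apply: hausdorff_content_sup.
exact: divr_gt0.
Qed.

Lemma hausdorff_isometry n p m (f : 'cV[R]_n -> 'cV[R]_p) (g : 'cV[R]_p -> 'cV[R]_n)
    (A : set 'cV[R]_n) :
  (forall x y, enorm (f x - f y) = enorm (x - y))%R ->
  cancel f g -> hausdorff_unnormalized m (f @` A) = hausdorff_unnormalized m A.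
Proof.
move=> fiso fg; apply/eqP; rewrite eq_le; apply/andP; split.
  have := @hausdorff_lipschitz _ _ m f A 1%R ltr01; rewrite expr1n mul1e; apply.
  by move=> x y _ _; rewrite fiso mul1r.
have := @hausdorff_lipschitz _ _ m g (f @` A) 1%R ltr01; rewrite expr1n mul1e.
have -> : g @` (f @` A) = A.
  by rewrite image_comp (_ : g \o f = id) ?image_id//; apply/funext => x /=; exact: fg.
apply=> _ _ [x _ <-] [y _ <-]; by rewrite !fg fiso mul1r.
Qed.

End hausdorff_lipschitz.

(** * Hausdorff measure in full dimension *)

Section hausdorff_lebesgue.
Context (R : realType) (m : nat).
Local Open Scope ereal_scope.
Local Notation LC n := (lebesgue_cV R n).
Local Notation H := (@hausdorff_unnormalized R m m).

Lemma outer_measure_bigsetU (T I : Type) (mu : {outer_measure set T -> \bar R}) (s : seq I)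
    (F : I -> set T) :
  mu (\big[setU/set0]_(i <- s) F i) <= \sum_(i <- s) mu (F i).
Proof.
elim: s => [|i s IH]; first by rewrite !big_nil outer_measure0.
rewrite !big_cons; apply: le_trans (outer_measureU2 mu _ _) _.
by rewrite leeD2l.
Qed.

(** A set of diameter d lies in a box of side 2d, of Lebesgue measure (2d)^m. Hence the m-th powers
    of the diameters of a cover of the unit cube add up to at least 2^-m. *)
Lemma hausdorff_ucube_gt0 : 0 < H (@ucube R m).
Proof.
apply: (@lt_le_trans _ _ (2 ^- m)%:E); first by rewrite lte_fin invr_gt0 exprn_gt0.
apply: le_trans (hausdorff_content_sup m _ ltr01).
apply: le_ereal_inf_tmp => _ [U [AU Us] <-].
rewrite eseries_mkcond.
have Ufin k : U k !=set0 -> exists2 d : R, (0 <= d)%R & diameter (U k) = d%:E.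
  move=> U0; have := Us k; have := diameter_ge0 U0.
  by case: (diameter (U k)) => [d|//|//]; rewrite lee_fin => d0 _; exists d.
have box k : exists B : set 'cV[R]_m, [/\ measurable B, U k `<=` B &
    LC m B <= (2 ^+ m)%:E * (if U k != set0 then diameter (U k) ^+ m else 0)].
  have [->|/set0P U0] := eqVneq (U k) set0.
    by exists set0; split => //; rewrite measure0 mule_ge0// lee_fin exprn_ge0.
  have [d d0 dE] := Ufin k U0.
  have [p Up] := U0.
  exists ((fun x => x + (- p))%R @^-1` [set x : 'cV[R]_m | forall i, (- d <= x i 0 <= d)%R]).
  split.
  - apply: preimage_measurable; first exact: measurable_cV_shift.
    exact: measurable_box.
  - move=> x Ux i /=; rewrite -ler_norml; apply: le_trans (coord_le_enorm _ _) _.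
    by rewrite -lee_fin -dE; exact: diameter_ub.
  - rewrite lebesgue_cV_shift; last exact: measurable_box.
    rewrite lebesgue_box; last by lra.
    rewrite dE -EFin_expe -EFinM lee_fin -exprMn; apply: lerXn2r; rewrite ?nnegrE; lra.
have [B /all_and3[mB UB LB]] := choice box.
have : LC m (@ucube R m) <= \sum_(k <oo) LC m (B k).
  apply: measure_sigma_subadditive => //; first exact: measurable_ucube.
  by move=> x /AU [k _ Ukx]; exists k => //; exact: UB.
rewrite lebesgue_ucube => h.
have : 1 <= (2 ^+ m)%:E * \sum_(k <oo) (if U k != set0 then diameter (U k) ^+ m else 0).
  apply: le_trans h _; rewrite -nneseriesZl; last by move=> k _; exact: diam_pow_ge0.
  by apply: lee_nneseries.
move=> h2; have : (2 ^- m)%:E * 1 <= (2 ^- m)%:E * ((2 ^+ m)%:E *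
   \sum_(k <oo) (if U k != set0 then diameter (U k) ^+ m else 0)).
  by rewrite lee_pmul2l// ?lte_fin ?invr_gt0 ?exprn_gt0.
by rewrite mule1 muleA -EFinM mulVf ?mul1e// expf_neq0.
Qed.

Lemma hausdorff_content_single (delta : R) (A : set 'cV[R]_m) :
  A !=set0 -> diameter A <= delta%:E ->
  hausdorff_content m delta A <= diameter A ^+ m.
Proof.
move=> A0 dA.
rewrite hausdorff_contentE.
apply: (@le_trans _ _ (\sum_(k <oo) diam_pow_small m delta (bigcup2 A set0 k))).
  apply: ereal_inf_lbound; exists (bigcup2 A set0) => //; split => //.
  by move=> x Ax; exists 0%N.
rewrite (nneseries_split _ 1%N)/=; last by move=> k _; exact: diam_pow_small_ge0.
rewrite big_mkord big_ord_recl big_ord0/= eseries0 ?adde0//.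
  by rewrite /diam_pow_small dA orbT /diam_pow; move/set0P : A0 => ->.
by move=> [|[|k]] //= _ _; rewrite diam_pow_small0.
Qed.

(** A grid of (N+1)^m cubes, each of diameter at most (m+1)/(N+1), costs at most (m+1)^m, a bound
    that does not depend on [delta]. *)
Lemma hausdorff_ucube_fin : H (@ucube R m) < +oo.
Proof.
apply: (@le_lt_trans _ _ (m.+1%:R ^+ m)%:E); last by rewrite ltry.
apply: ge_ereal_sup => _ [delta /= d0 <-].
have [N NP] : exists N : nat, (m.+1%:R / N.+1%:R <= delta :> R)%R.
  exists (Num.bound (m.+1%:R / delta)); rewrite ler_pdivrMr//.
  rewrite mulrC -ler_pdivrMr//; apply: ltW; apply: lt_le_trans (archi_boundP _) _.
    by rewrite divr_ge0// ltW.
  by rewrite ler_nat.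
pose n1 : R := N.+1%:R.
have n10 : (0 < n1)%R by [].
pose Q (f : {ffun 'I_m -> 'I_N.+1}) : set 'cV[R]_m :=
  [set x | forall i, ((f i)%:R / n1 <= x i 0 <= (f i).+1%:R / n1)%R].
have Q0 f : Q f !=set0.
  exists (\col_i ((f i)%:R / n1)%R) => i; rewrite mxE lexx/=.
  by rewrite ler_pM2r ?invr_gt0// ler_nat.
have Qdiam f : diameter (Q f) <= (m.+1%:R / n1)%:E.
  apply: diameter_le => x y Qx Qy; rewrite lee_fin; apply: le_trans (enorm_le_sum _) _.
  apply: (@le_trans _ _ (\sum_(i < m) n1^-1)%R).
    apply: ler_sum => i _; rewrite !mxE.
    have /andP[x1 x2] := Qx i; have /andP[y1 y2] := Qy i.
    have E : ((f i).+1%:R / n1 = (f i)%:R / n1 + n1^-1 :> R)%R by rewrite -natr1 mulrDl mul1r.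
    rewrite ler_norml; move: x1 x2 y1 y2; rewrite E.
    set a := ((f i)%:R / n1)%R; set b := (n1^-1)%R.
    by move: a b (x i 0%R) (y i 0%R) => a b c d *; apply/andP; split; lra.
  by rewrite sumr_const card_ord -[leLHS]mulr_natl ler_pM2r ?invr_gt0// ler_nat leqnSn.
have cover : @ucube R m `<=` \big[setU/set0]_(f <- index_enum {ffun 'I_m -> 'I_N.+1}) Q f.
  move=> x cx; rewrite -bigcup_seq.
  (* The minimum with [N] matters for the coordinate 1, which belongs to the last closed cell and
     would otherwise get the index N + 1. *)
  pose g i := minn (Num.truncn (n1 * x i 0)%R) N.
  have gN i : (g i < N.+1)%N by rewrite ltnS geq_minr.
  exists [ffun i => Ordinal (gN i)]; first exact: mem_index_enum.
  move=> i; rewrite ffunE/=; have /andP[x0 x1] := cx i.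
  have nx0 : (0 <= n1 * x i 0)%R by rewrite mulr_ge0// ltW.
  have /andP[t1 t2] := truncn_itv nx0.
  rewrite ler_pdivrMr// ler_pdivlMr// [(x i 0 * n1)%R]mulrC; apply/andP; split.
    by apply: le_trans t1; rewrite ler_nat geq_minl.
  rewrite /g /minn; case: ifP => _; first exact: ltW.
  by rewrite -[leRHS]mulr1 ler_pM2l.
have sub : hausdorff_content m delta (@ucube R m) <=
    \sum_(f <- index_enum {ffun 'I_m -> 'I_N.+1}) hausdorff_content m delta (Q f).
  apply: le_trans (@le_hausdorff_content R m m delta _ _ cover) _.
  exact: (outer_measure_bigsetU
    [the {outer_measure set 'cV[R]_m -> \bar R} of @hausdorff_content R m m delta]).
apply: le_trans sub _.
apply: (@le_trans _ _ (\sum_(f : {ffun 'I_m -> 'I_N.+1}) ((m.+1%:R / n1) ^+ m)%:E)).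
  apply: lee_sum => f _.
  apply: le_trans (hausdorff_content_single (Q0 f) _) _.
    by apply: le_trans (Qdiam f) _; rewrite lee_fin.
  rewrite EFin_expe; apply: lee_expe2 (Qdiam f); exact: diameter_ge0.
rewrite sumEFin lee_fin sumr_const card_ffun !card_ord -[leLHS]mulr_natl natrX -exprMn.
by rewrite mulrCA divff ?gt_eqF// mulr1.
Qed.

(** The denominator in [hausdorff]. It also appears in the measure of the sphere and cancels
    there. *)
Definition kappa : R := fine (H (@ucube R m)).

Lemma kappaE : H (@ucube R m) = kappa%:E.
Proof. by rewrite /kappa fineK// ge0_fin_numE ?hausdorff_ucube_fin// hausdorff_unnormalized_ge0. Qed.

Lemma kappa_gt0 : (0 < kappa)%R.
Proof. by rewrite -lte_fin -kappaE hausdorff_ucube_gt0. Qed.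

Lemma hausdorff_shift (w : 'cV[R]_m) (A : set 'cV[R]_m) :
  H ((fun x => x + w)%R @^-1` A) = H A.
Proof.
have -> : (fun x => x + w)%R @^-1` A = (fun x => x - w)%R @` A.
  apply/seteqP; split=> x /=; first by move=> h; exists (x + w)%R => //; rewrite addrK.
  by move=> [y Ay <-]; rewrite subrK.
apply: (@hausdorff_isometry R m m m (fun x => x - w)%R (fun x => x + w)%R).
  by move=> x y; rewrite opprB addrA subrK.
by move=> x; rewrite subrK.
Qed.

(** Translation invariance and finiteness on boxes make H^m a multiple of Lebesgue measure; the unit
    cube gives the factor. *)
Lemma hausdorff_lebesgue (A : set 'cV[R]_m) : measurable A -> H A = kappa%:E * LC m A.
Proof.
move=> mA.
have sf : sigma_finite setT (hausdorff_measure R m m).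
  exists (fun k => [set x : 'cV[R]_m | forall i, (- k%:R <= x i 0 <= k%:R)%R]).
    apply/seteqP; split=> x // _.
    exists (Num.bound (enorm x)) => //= i; rewrite -ler_norml.
    apply: le_trans (coord_le_enorm _ _) _; apply/ltW/archi_boundP; exact: enorm_ge0.
  move=> k; split; first exact: measurable_box.
  rewrite hausdorff_measureE.
  (* A dilation of the unit cube that covers the box of half-side k; the half-side k + 1 of its
     image is positive even for k = 0. *)
  pose f (x : 'cV[R]_m) := ((2 * k.+1%:R) *: x + const_mx (- k.+1%:R))%R.
  apply: (@le_lt_trans _ _ (H (f @` (@ucube R m)))).
    apply: le_hausdorff_unnormalized => x xk.
    have k0 : (0 < k.+1%:R :> R)%R by [].
    have kk : (k%:R <= k.+1%:R :> R)%R by rewrite ler_nat.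
    exists ((2 * k.+1%:R)^-1 *: (x + const_mx k.+1%:R))%R.
      move=> i; rewrite !mxE; have /andP[x1 x2] := xk i.
      move: (k.+1%:R : R) (k%:R : R) k0 kk x1 x2 => K K' k0 kk x1 x2.
      rewrite [(_^-1 * _)%R]mulrC; apply/andP; split.
        by apply: divr_ge0; lra.
      by rewrite ler_pdivrMr; lra.
    apply/matrixP => i j; rewrite !mxE.
    by rewrite mulrA divff ?mul1r ?addrK// mulf_neq0.
  have k2 : (0 < 2 * k.+1%:R :> R)%R by rewrite mulr_gt0.
  apply: le_lt_trans (hausdorff_lipschitz m k2 _) _.
    move=> x y _ _; rewrite /f opprD addrACA subrr addr0 -scalerBr enormZ.
    by rewrite ger0_norm// ltW.
  by rewrite kappaE -EFinM ltry.
have [mu muE _] := sf_measureP sf.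
have := @translation_invariant_uniq R m mu A (@ucube R m) _ mA (@measurable_ucube R m).
rewrite !muE !hausdorff_measureE lebesgue_ucube mule1 kappaE lebesgue_cV_opp//; apply.
by move=> w B mB; rewrite !muE !hausdorff_measureE hausdorff_shift.
Qed.

End hausdorff_lebesgue.

(** * The area of the sphere *)

Section sphere_area.
Context (R : realType) (m : nat).
Local Open Scope ereal_scope.
Local Notation LC n := (lebesgue_cV R n).
Local Notation n := m.+1.
Local Notation H := (@hausdorff_unnormalized R n m).

Definition cap (e : 'cV[R]_n) (t : R) : set 'cV[R]_n :=
  [set x | enorm x = 1%R /\ (t <= dot x e)%R].

Definition e0 : 'cV[R]_n := cV_cons (1%R, 0%R).

Lemma enorm_cons (t : R) (v : 'cV[R]_m) : enorm (cV_cons (t, v)) = Num.sqrt (t ^+ 2 + sqnorm v).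
Proof. by rewrite enormE sqnorm_cons. Qed.

Lemma enorm_e0 : enorm e0 = 1%R.
Proof. by rewrite enorm_cons sqnorm0 addr0 expr1n sqrtr1. Qed.

Lemma dot_e0 (t : R) (v : 'cV[R]_m) : dot (cV_cons (t, v)) e0 = t.
Proof.
rewrite dotE big_ord_recl !mxE !unlift_none/= mulr1 big1 ?addr0// => i _.
by rewrite !mxE liftK /= mxE mulr0.
Qed.

Definition disc (r : R) : set 'cV[R]_m := [set v | (sqnorm v <= r ^+ 2)%R].

Lemma measurable_le_set d (T : measurableType d) (f g : T -> R) :
  measurable_fun setT f -> measurable_fun setT g ->
  measurable [set x | (f x <= g x)%R].
Proof.
move=> mf mg; have := measurable_fun_ler mf mg measurableT (Y := [set true]) I.
by rewrite setTI.
Qed.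

Lemma measurable_lt_set d (T : measurableType d) (f g : T -> R) :
  measurable_fun setT f -> measurable_fun setT g ->
  measurable [set x | (f x < g x)%R].
Proof.
move=> mf mg; have := measurable_fun_ltr mf mg measurableT (Y := [set true]) I.
by rewrite setTI.
Qed.

Lemma measurable_disc r : measurable (disc r).
Proof. by apply: measurable_le_set => //; exact: measurable_sqnorm. Qed.

(** The volume of the unit ball of R^m, a common factor of the estimates for caps and for cones. *)
Definition beta := LC m (disc 1).

Lemma beta_fin : beta < +oo.
Proof.
apply: (@lebesgue_bounded_fin R m _ 1%R) => //; first exact: measurable_disc.
move=> x i; rewrite /disc/= expr1n -sqr_enorm => h.
apply: le_trans (coord_le_enorm _ _) _.
by rewrite -(@ler_pXn2r _ 2)// ?nnegrE ?enorm_ge0// expr1n.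
Qed.

Lemma beta_gt0 : 0 < beta.
Proof.
pose b : R := (m.+1%:R^-1)%R.
have b0 : (0 < b)%R by rewrite invr_gt0.
have : LC m [set x : 'cV[R]_m | forall i, (- b <= x i 0 <= b)%R] <= beta.
  apply: le_measure; rewrite ?inE; [exact: measurable_box|exact: measurable_disc|].
  move=> x xb; rewrite /disc/= expr1n -sqr_enorm -(expr1n _ 2).
  rewrite ler_pXn2r ?nnegrE ?enorm_ge0//; apply: le_trans (enorm_le_sum _) _.
  apply: (@le_trans _ _ (\sum_(i < m) b)%R).
    by apply: ler_sum => i _; rewrite ler_norml xb.
  by rewrite sumr_const card_ord -[leLHS]mulr_natl ler_pdivrMr// mul1r ler_nat.
apply: lt_le_trans; rewrite lebesgue_box; last by lra.
by rewrite lte_fin exprn_gt0//; lra.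
Qed.

Lemma lebesgue_disc r : (0 < r)%R -> LC m (disc r) = (r ^+ m)%:E * beta.
Proof.
move=> r0.
have -> : disc r = (fun x => r^-1 *: x)%R @^-1` (disc 1).
  apply/seteqP; split => v; rewrite /disc/= sqnormZ expr1n exprVn mulrC ler_pdivrMr ?exprn_gt0// mul1r//.
rewrite lebesgue_cV_scale ?invr_eq0 ?gt_eqF//; last exact: measurable_disc.
by rewrite normfV gtr0_norm// exprVn invrK.
Qed.

(** The orthogonal projection on the tangent hyperplane does not increase distances, and the image
    of the cap contains this disc. *)
Lemma cap_lower (t : R) : (0 < t < 1)%R ->
  (kappa R m)%:E * LC m (disc (Num.sqrt (1 - t ^+ 2))) <= H (cap e0 t).
Proof.
move=> /andP[t0 t1].
have t2 : (t ^+ 2 <= 1)%R by rewrite expr_le1// ltW.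
rewrite -hausdorff_lebesgue; last exact: measurable_disc.
pose pr (x : 'cV[R]_n) : 'cV[R]_m := \col_j x (lift ord0 j) 0%R.
have prc s v : pr (cV_cons (s, v)) = v.
  by apply/matrixP => i j; rewrite !mxE liftK (ord1 j).
apply: (@le_trans _ _ (@hausdorff_unnormalized R m m (pr @` cap e0 t))).
  apply: le_hausdorff_unnormalized => v; rewrite /disc/= sqr_sqrtr ?subr_ge0// => vd.
  have s0 : (0 <= 1 - sqnorm v)%R by have := sqr_ge0 t; lra.
  exists (cV_cons (Num.sqrt (1 - sqnorm v), v))%R; last exact: prc.
  split; first by rewrite enorm_cons sqr_sqrtr// subrK sqrtr1.
  by rewrite dot_e0 -[leLHS](gtr0_norm t0) -sqrtr_sqr ler_wsqrtr//; lra.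
have := @hausdorff_lipschitz R n m m pr (cap e0 t) 1%R ltr01.
rewrite expr1n mul1e; apply=> x y _ _; rewrite mul1r.
have -> : (pr x - pr y = pr (x - y))%R by apply/matrixP => i j; rewrite !mxE.
rewrite [in leRHS](cV_consE (x - y)%R) enorm_cons enormE; apply: ler_wsqrtr.
by rewrite lerDr sqr_ge0.
Qed.

(** The cap is the graph of v -> sqrt(1 - |v|^2) over the disc, and the graph map is Lipschitz with
    constant 1/t there. *)
Lemma cap_upper (t : R) : (0 < t < 1)%R ->
  H (cap e0 t) <= (t ^- m)%:E * ((kappa R m)%:E * LC m (disc (Num.sqrt (1 - t ^+ 2)))).
Proof.
move=> /andP[t0 t1].
have t2 : (t ^+ 2 <= 1)%R by rewrite expr_le1// ltW.
rewrite -hausdorff_lebesgue; last exact: measurable_disc.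
pose f (v : 'cV[R]_m) : 'cV[R]_n := cV_cons (Num.sqrt (1 - sqnorm v), v)%R.
apply: (@le_trans _ _ (H (f @` disc (Num.sqrt (1 - t ^+ 2))))).
  apply: le_hausdorff_unnormalized => x; rewrite (cV_consE x) => -[].
  set s := x _ _; set v := \col_j _.
  rewrite enorm_cons dot_e0 => /(congr1 (fun z => z ^+ 2)%R).
  rewrite sqr_sqrtr ?expr1n; last by rewrite addr_ge0 ?sqr_ge0 ?sqnorm_ge0.
  move=> sv ts; have ts2 : (t ^+ 2 <= s ^+ 2)%R by rewrite lerXn2r ?nnegrE//; lra.
  exists v; first by rewrite /disc/= sqr_sqrtr ?subr_ge0//; lra.
  rewrite /f; congr (cV_cons (_, _)).
  have -> : (1 - sqnorm v = s ^+ 2)%R by lra.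
  by rewrite sqrtr_sqr ger0_norm//; lra.
rewrite -exprVn; apply: hausdorff_lipschitz; first by rewrite invr_gt0.
move=> v w; rewrite /disc/= sqr_sqrtr ?subr_ge0// => vd wd.
have t20 : (0 < t ^+ 2)%R by rewrite exprn_gt0.
have fB : (f v - f w = cV_cons (Num.sqrt (1 - sqnorm v) - Num.sqrt (1 - sqnorm w), v - w))%R.
  apply/matrixP => i j; rewrite !mxE; case: unliftP => [k _|_] //=.
  by rewrite !mxE.
rewrite fB mulrC ler_pdivlMr// -(@ler_pXn2r _ 2)// ?nnegrE ?mulr_ge0 ?enorm_ge0 ?(ltW t0)//.
rewrite exprMn !sqr_enorm sqnorm_cons.
set a := Num.sqrt (1 - sqnorm v)%R; set b := Num.sqrt (1 - sqnorm w)%R.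
have a2 : (a ^+ 2 = 1 - sqnorm v)%R by rewrite sqr_sqrtr//; lra.
have b2 : (b ^+ 2 = 1 - sqnorm w)%R by rewrite sqr_sqrtr//; lra.
have at0 : (t <= a)%R by rewrite -(@ler_pXn2r _ 2)// ?nnegrE ?sqrtr_ge0 ?(ltW t0)// a2; lra.
have bt0 : (t <= b)%R by rewrite -(@ler_pXn2r _ 2)// ?nnegrE ?sqrtr_ge0 ?(ltW t0)// b2; lra.
(* Difference of squares on the sphere. With a + b >= 2t and |v + w|^2 <= 4 (1 - t^2),
   Cauchy-Schwarz gives (a - b)^2 <= |v - w|^2 (1 - t^2) / t^2; adding |v - w|^2 makes the factor 1
   / t^2. *)
have ab : ((a - b) * (a + b) = dot (w - v) (w + v))%R.
  rewrite !(dotDl, dotDr, dotNl, dotNr) !dotxx (dotC v w) -subr_sqr a2 b2; ring.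
have CS : ((dot (w - v) (w + v)) ^+ 2 <= sqnorm (v - w) * sqnorm (w + v))%R.
  rewrite -(sqnormN (v - w)) opprB -!sqr_enorm -exprMn -ler_sqrt ?exprn_ge0 ?mulr_ge0 ?enorm_ge0//.
  rewrite !sqrtr_sqr [leRHS]ger0_norm ?mulr_ge0 ?enorm_ge0// ler_norml cauchy_schwarz andbT.
  rewrite lerNl -dotNl; apply: le_trans (cauchy_schwarz _ _) _.
  by rewrite enormN.
have sum4 : (sqnorm (w + v) <= 4 * (1 - t ^+ 2))%R.
  have := sqnorm_ge0 (w - v); rewrite sqnormB sqnormD; lra.
have X0 := sqnorm_ge0 (v - w).
set X := sqnorm (v - w) in CS X0 *.
have h1 : ((a - b) ^+ 2 * (a + b) ^+ 2 <= X * (4 * (1 - t ^+ 2)))%R.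
  rewrite -exprMn ab; apply: le_trans CS _; exact: ler_wpM2l.
have h2 : ((a - b) ^+ 2 * (4 * t ^+ 2) <= (a - b) ^+ 2 * (a + b) ^+ 2)%R.
  apply: ler_wpM2l; first exact: sqr_ge0.
  have -> : (4 * t ^+ 2 = (2 * t) ^+ 2)%R by ring.
  by rewrite lerXn2r ?nnegrE; lra.
lra.
Qed.

Lemma cap_rotate (e : 'cV[R]_n) (t : R) : enorm e = 1%R -> H (cap e t) = H (cap e0 t).
Proof.
move=> e1; have [B OTO Oe] := householder enorm_e0 e1.
have Ou : B \in unitmx by have [] := mulmx1_unit OTO.
have OOT : B *m B^T = 1%:M by apply: mulmx1C.
rewrite -(@hausdorff_isometry R n n m (fun x => B *m x) (fun x => B^T *m x) (cap e0 t)).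
- congr (H _); apply/seteqP; split => [x [x1 xt]|_ [x [x1 xt] <-]].
    exists (B^T *m x); last by rewrite mulmxA OOT mul1mx.
    split; first by rewrite -(enorm_orthogonal _ OTO) mulmxA OOT mul1mx.
    by rewrite -dotMr Oe.
  by split; rewrite ?(enorm_orthogonal _ OTO)// -Oe dot_orthogonal.
- by move=> x y; rewrite -mulmxBr enorm_orthogonal.
- by move=> x; rewrite mulmxA OTO mul1mx.
Qed.

Local Notation S := (@unit_sphere R n).

Lemma measurable_dot d (T : measurableType d) k (f g : T -> 'cV[R]_k) :
  measurable_fun setT f -> measurable_fun setT g ->
  measurable_fun setT (fun x => dot (f x) (g x)).
Proof.
move=> /measurable_fun_coordP mf /measurable_fun_coordP mg.
under eq_fun do rewrite dotE.
by apply: measurable_sum => i; apply: measurable_funM; [exact: mf|exact: mg].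
Qed.

Lemma measurable_sphere : measurable S.
Proof.
rewrite (_ : S = [set x | (enorm x <= 1)%R] `&` [set x | (1 <= enorm x)%R]).
  by apply: measurableI; apply: measurable_le_set => //; exact: measurable_enorm.
apply/seteqP; split => [x /= ->//|x [/= x1 x2]].
by apply/eqP; rewrite eq_le x1 x2.
Qed.

Lemma measurable_cap e t : measurable (cap e t).
Proof.
apply: measurableI; first exact: measurable_sphere.
by apply: measurable_le_set => //; exact: measurable_dot.
Qed.

Lemma hausdorff_cap_fin e t : (0 < t < 1)%R -> enorm e = 1%R -> H (cap e t) < +oo.
Proof.
move=> t01 e1; rewrite cap_rotate//; apply: le_lt_trans (cap_upper t01) _.
have /andP[t0 t1] := t01.
rewrite lebesgue_disc; last by rewrite sqrtr_gt0 subr_gt0 expr_lt1// ltW.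
have := beta_fin; have := ltW beta_gt0; case: beta => [b _ _|//|//].
by rewrite -!EFinM ltry.
Qed.

Lemma hausdorff_cap_gt0 t : (0 < t < 1)%R -> 0 < H (cap e0 t).
Proof.
move=> t01; apply: lt_le_trans (cap_lower t01).
have /andP[t0 t1] := t01.
have r0 : (0 < Num.sqrt (1 - t ^+ 2))%R by rewrite sqrtr_gt0 subr_gt0 expr_lt1// ltW.
rewrite lebesgue_disc//; apply: mule_gt0; first by rewrite lte_fin kappa_gt0.
by apply: mule_gt0; [rewrite lte_fin exprn_gt0|exact: beta_gt0].
Qed.

(** The sphere is covered by the finitely many caps around plus and minus the basis vectors. *)
Lemma hausdorff_sphere_fin : H S < +oo.
Proof.
(* If every coordinate were below 1/(n+1) in absolute value, the norm would be at most n/(n+1) < 1.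
   This choice also satisfies t < 1 for n = 1. *)
pose t : R := (n.+1%:R^-1)%R.
have t01 : (0 < t < 1)%R by rewrite invr_gt0 ltr0n invf_lt1 ?ltr1n// ltr0n.
pose e (i : 'I_n * bool) : 'cV[R]_n := ((-1) ^+ i.2 *: delta_mx i.1 0)%R.
have e1 i : enorm (e i) = 1%R.
  rewrite /e enormZ normrX normrN1 expr1n mul1r enormE /sqnorm (bigD1 i.1)//= big1.
    by rewrite mxE !eqxx expr1n addr0 sqrtr1.
  by move=> j ji; rewrite mxE (negbTE ji) expr0n.
have cover : S `<=` \big[setU/set0]_(i <- index_enum ('I_n * bool)%type) cap (e i) t.
  move=> x x1; rewrite -bigcup_seq.
  have [i xi] : exists i : 'I_n, (t <= `|x i 0%R|)%R.
    apply/not_existsP => h.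
    have : (enorm x <= \sum_(i < n) t)%R.
      apply: le_trans (enorm_le_sum _) _; apply: ler_sum => i _.
      by have /negP := h i; rewrite -ltNge => /ltW.
    rewrite (x1 : enorm x = 1%R) sumr_const card_ord -[leRHS]mulr_natl.
    by rewrite ler_pdivlMr// mul1r ler_nat ltnn.
  exists (i, x i 0%R < 0)%R; first by rewrite /= mem_index_enum.
  split => //; rewrite /e/= dotZr.
  have -> : dot x (delta_mx i 0%R) = x i 0%R by rewrite dotC /dot trmx_delta -rowE mxE.
  move: xi; case: ltP => h; first by rewrite ltr0_norm// expr1 mulN1r.
  by rewrite ger0_norm// expr0 mul1r.
apply: le_lt_trans (le_hausdorff_unnormalized _ cover) _.
apply: le_lt_trans (outer_measure_bigsetU
  [the {outer_measure set 'cV[R]_n -> \bar R} of H] _ _) _.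
by apply: lte_sum_pinfty => i _; exact: hausdorff_cap_fin.
Qed.

(** The strict inequality removes the apex, which satisfies the other condition for every [e]. *)
Definition cone e t : set 'cV[R]_n := [set y | (t * enorm y <= dot e y)%R /\ (0 < dot e y)%R].

Lemma measurable_cone e t : measurable (cone e t).
Proof.
apply: measurableI; last by apply: measurable_lt_set => //; exact: measurable_dot.
apply: measurable_le_set; last exact: measurable_dot.
by apply: measurable_funM => //; exact: measurable_enorm.
Qed.

Lemma cV_set0_box : [set 0%R] = [set x : 'cV[R]_n | forall i, (0 <= x i 0 <= 0)%R].
Proof.
apply/seteqP; split => [x -> i|x h]; first by rewrite mxE lexx.
by apply/matrixP => i j; rewrite (ord1 j) mxE; apply/eqP; rewrite eq_le andbC h.
Qed.

Lemma lebesgue_cV_set0 : LC n [set 0%R] = 0.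
Proof. by rewrite cV_set0_box lebesgue_box// subrr expr0n. Qed.

(** The origin is a null set because n >= 1. This disposes of the values that powers and cones take
    at 0 by convention. *)
Lemma ge0_eq_integral_neq0 (f g : 'cV[R]_n -> \bar R) :
  measurable_fun setT f -> measurable_fun setT g ->
  (forall y, 0 <= f y) -> (forall y, 0 <= g y) ->
  (forall y, y != 0%R -> f y = g y) -> \int[LC n]_y f y = \int[LC n]_y g y.
Proof.
move=> mf mg f0 g0 fg; apply: ge0_ae_eq_integral => //.
exists [set 0%R]; split.
- by rewrite cV_set0_box; exact: measurable_box.
- exact: lebesgue_cV_set0.
- by move=> y/= h; apply: contrapT => /eqP y0; apply: h => _; exact: fg.
Qed.

Definition gcone e t : \bar R := \int[LC n]_y ((gam y)%:E * (\1_(cone e t) y : R)%:E).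

Lemma gcone_rotate e t : enorm e = 1%R -> gcone e t = gcone e0 t.
Proof.
move=> e1; have [B BTB Be] := householder enorm_e0 e1.
rewrite /gcone -(ge0_integral_orthogonal BTB).
- apply: eq_integral => x _; rewrite gam_orthogonal//; congr (_ * _%:E); rewrite /indic; congr ((_ : bool)%:R).
  by apply/idP/idP => /set_mem h; apply/mem_set; move: h; rewrite /cone/= enorm_orthogonal// -Be dot_orthogonal.
- apply: emeasurable_funM => //; apply/measurable_EFinP; first exact: measurable_gam.
  by apply/measurable_indic; exact: measurable_cone.
- by move=> x; rewrite mule_ge0// lee_fin ?gam_ge0.
Qed.

(* Tonelli for the kernel 1 (t |y| <= <x, y>): as a function of y it cuts a
   cone of Gaussian measure independent of x, as a function of x a cap of
   Hausdorff measure independent of y. *)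
Lemma sphere_cone_cap t : (0 < t < 1)%R ->
  H S * gcone e0 t = H (cap e0 t) * (Num.sqrt pi ^+ n)%:E.
Proof.
move=> t01.
have mS := measurable_sphere.
(* Tonelli needs sigma-finite measures, and H^m is not sigma-finite on R^(m+1); its restriction to
   the sphere is finite. *)
pose mu0 : {measure set 'cV[R]_n -> \bar R} :=
  [the {measure set 'cV[R]_n -> \bar R} of mrestr (hausdorff_measure R n m) mS].
have mu0E A : mu0 A = H (A `&` S) by [].
have sf : sigma_finite setT mu0.
  exists (fun=> setT); first by rewrite bigcup_const//; exists 0%N.
  by move=> _; split => //; rewrite mu0E setTI hausdorff_sphere_fin.
have [mu muE _] := sf_measureP sf.
have muI (C : set 'cV[R]_n) : measurable C -> \int[mu]_x (\1_C x : R)%:E = H (C `&` S).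
  by move=> mC; rewrite integral_indic// setIT; exact: muE.
pose k (p : 'cV[R]_n * 'cV[R]_n) : \bar R :=
  (\1_S p.1 : R)%:E * ((gam p.2)%:E * (\1_[set q : 'cV[R]_n * 'cV[R]_n | (t * enorm q.2 <= dot q.1 q.2)%R /\ (0 < dot q.1 q.2)%R] p : R)%:E).
have mker : measurable [set q : 'cV[R]_n * 'cV[R]_n | (t * enorm q.2 <= dot q.1 q.2)%R /\ (0 < dot q.1 q.2)%R].
  apply: measurableI; last by apply: measurable_lt_set => //; exact: measurable_dot.
  apply: measurable_le_set; last exact: measurable_dot.
  by apply: measurable_funM => //; exact: measurable_enorm.
have mk : measurable_fun setT k.
  apply: emeasurable_funM.
    apply/measurable_EFinP.
    exact: (measurableT_comp (measurable_indic mS) measurable_fst).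
  apply: emeasurable_funM; last exact/measurable_EFinP/measurable_indic.
  by apply/measurable_EFinP; apply: measurable_gam.
have k0 p : 0 <= k p by rewrite !mule_ge0// lee_fin gam_ge0.
have F := @fubini_tonelli _ _ _ _ R mu (LC n) k mk k0.
have gcone_ge0 : 0 <= gcone e0 t.
  by apply: integral_ge0 => y _; rewrite mule_ge0// lee_fin gam_ge0.
have L : \int[mu]_x \int[LC n]_y k (x, y) = H S * gcone e0 t.
  transitivity (\int[mu]_x ((\1_S x : R)%:E * gcone e0 t)).
    apply: eq_integral => x _; rewrite /k/= indicE.
    have [xS|xS] := boolP (x \in S); last first.
      by rewrite mul0e integral0_eq// => y _; rewrite mul0e.
    rewrite mul1e -(gcone_rotate t (set_mem xS)); apply: eq_integral => y _.
    by rewrite mul1e.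
  rewrite ge0_integralZr//; last first.
    by apply/measurable_EFinP/measurable_indic.
  by rewrite muI// setIid.
rewrite -L F.
have HS := hausdorff_sphere_fin.
transitivity (\int[LC n]_y ((gam y)%:E * H (cap e0 t))); last first.
  rewrite ge0_integralZr//; first by rewrite integral_gam muleC.
  - by apply/measurable_EFinP; apply: measurable_gam.
  - by move=> y _; rewrite lee_fin gam_ge0.
  - exact: hausdorff_unnormalized_ge0.
have mG := @measurable_fun_fubini_tonelli_G _ _ _ _ R mu k mk k0.
apply: ge0_eq_integral_neq0 => //.
- apply: emeasurable_funM => //.
  by apply/measurable_EFinP; apply: measurable_gam.
- by move=> y; apply: integral_ge0 => x _; exact: k0.
- by move=> y; rewrite mule_ge0 ?lee_fin ?gam_ge0//; exact: hausdorff_unnormalized_ge0.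
move=> y y0.
have yp : (0 < enorm y)%R by rewrite enorm_gt0.
(* For x on the sphere, t |y| <= x.y says that x lies in the cap around y / |y|. *)
pose e := ((enorm y)^-1 *: y)%R.
have ey : enorm e = 1%R.
  by rewrite enormZ ger0_norm ?invr_ge0 ?enorm_ge0// mulVf// gt_eqF.
have capS : cap e t `&` S = cap e t by apply/setIidPl => x [].
rewrite -(cap_rotate t ey) -capS -muI; last exact: measurable_cap.
rewrite -ge0_integralZl//; last 2 first.
- by apply/measurable_EFinP/measurable_indic; exact: measurable_cap.
- by rewrite lee_fin gam_ge0.
apply: eq_integral => x _; rewrite /k/= muleCA; congr (_ * _); rewrite -EFinM; congr EFin.
rewrite !indicE -natrM mulnb; congr ((_ : bool)%:R).
apply/andP/idP => [[/set_mem xS /set_mem [h _]]|/set_mem [x1 h]].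
  by apply/mem_set; split => //; rewrite /e dotZr mulrC ler_pdivlMr.
move: h; rewrite /e dotZr mulrC ler_pdivlMr// => h.
split; apply/mem_set => //; split => //; apply: lt_le_trans h.
by rewrite mulr_gt0//; case/andP: t01.
Qed.

End sphere_area.

Section integral_lower_bound.
Local Open Scope ereal_scope.

Lemma integral_gt0 (R : realType) (f : R -> R) (c : R) :
  measurable_fun setT f -> (forall t : R, (0 <= f t)%R) -> (0 < c)%R ->
  (forall t : R, (1 <= t <= 2)%R -> (c <= f t)%R) -> (0 < \int[lebesgue_measure]_t (f t)%:E)%E.
Proof.
move=> mf f0 c0 cf.
apply: (@lt_le_trans _ _ (\int[lebesgue_measure]_(t in `[1%R, 2%R]) c%:E)).
  have E := @lebesgue_measure_itv R `[1%R, 2%R].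
  rewrite integral_cst// [X in _ * X]E/= lte_fin ltr1n -EFinD -EFinM lte_fin.
  by rewrite mulr_gt0//; lra.
have mF : measurable_fun setT (fun t => (f t)%:E) by exact/measurable_EFinP.
apply: (@le_trans _ _ (\int[lebesgue_measure]_(t in `[1%R, 2%R]) (f t)%:E)).
  apply: ge0_le_integral => //.
  - by move=> t _; rewrite lee_fin ltW.
  - exact: measurable_funTS.
by apply: ge0_subset_integral => // t _; rewrite lee_fin.
Qed.

End integral_lower_bound.

(** * The Gaussian measure of thin cones *)

Section cone_estimate.
Context (R : realType) (m : nat).
Local Open Scope ereal_scope.
Local Notation LC n := (lebesgue_cV R n).
Local Notation n := m.+1.
Local Notation H := (@hausdorff_unnormalized R n m).

Definition mom_fun (s : R) : R := if (0 < s)%R then (s ^+ m * expR (- s ^+ 2))%R else 0%R.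

(** The radial factor of the Gaussian integral: the integral of s^(n-1) exp(-s^2) over s > 0, where
    n = m + 1. *)
Definition gmoment : \bar R := \int[lebesgue_measure]_s (mom_fun s)%:E.

Lemma mom_fun_ge0 s : (0 <= mom_fun s)%R.
Proof.
by rewrite /mom_fun; case: ifPn => // s0; rewrite mulr_ge0 ?expR_ge0// exprn_ge0// ltW.
Qed.

Lemma measurable_mom_fun : measurable_fun setT mom_fun.
Proof.
apply: measurable_fun_ifT => //.
- exact: measurable_fun_ltr.
- apply: measurable_funM; first exact: measurable_funX.
  by apply: measurable_expR_comp; apply: measurable_funN; exact: measurable_funX.
Qed.

Lemma gmoment_ge0 : 0 <= gmoment.
Proof. by apply: integral_ge0 => s _; rewrite lee_fin mom_fun_ge0. Qed.

Lemma gmoment_gt0 : 0 < gmoment.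
Proof.
apply: (@integral_gt0 _ _ (expR (- 4))); [exact: measurable_mom_fun|exact: mom_fun_ge0| |].
  exact: expR_gt0.
move=> t t12; rewrite /mom_fun ifT; last by lra.
rewrite -[leLHS]mul1r; apply: ler_pM; rewrite ?expR_ge0//.
  by apply: exprn_ege1; case/andP: t12.
by rewrite ler_expR; nra.
Qed.

Variable t : R.
Hypothesis t01 : (0 < t < 1)%R.
Local Notation T := (Num.sqrt (1 - t ^+ 2) / t)%R.

Let t0 : (0 < t)%R. Proof. by case/andP: t01. Qed.

Let t21 : (t ^+ 2 < 1)%R. Proof. by case/andP: t01 => ? ?; rewrite expr_lt1// ltW. Qed.

Let T0 : (0 < T)%R. Proof. by rewrite divr_gt0// sqrtr_gt0 subr_gt0. Qed.

Let T2 : (1 + T ^+ 2 = t ^- 2)%R.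
Proof.
rewrite expr_div_n sqr_sqrtr ?subr_ge0 ?ltW//.
by field; rewrite gt_eqF.
Qed.

(** The cosine of the half-angle of the cone is [t], so T = sqrt(1 - t^2) / t is its tangent and the
    slice at height s is a disc of radius T s. *)
Lemma cone_e0E (s : R) (v : 'cV[R]_m) :
  cone (e0 R m) t (cV_cons (s, v)) <-> (0 < s)%R /\ disc (T * s)%R v.
Proof.
rewrite /cone/= dotC dot_e0 enorm_cons /disc/=.
have sv0 : (0 <= s ^+ 2 + sqnorm v)%R by rewrite addr_ge0 ?sqr_ge0 ?sqnorm_ge0.
have key : (sqnorm v <= (T * s) ^+ 2)%R = (t ^+ 2 * (s ^+ 2 + sqnorm v) <= s ^+ 2)%R.
  have -> : ((T * s) ^+ 2 = (t ^- 2 - 1) * s ^+ 2)%R by rewrite exprMn -T2; ring.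
  rewrite -(ler_pM2l (exprn_gt0 2 t0)).
  have -> : (t ^+ 2 * ((t ^- 2 - 1) * s ^+ 2) = s ^+ 2 - t ^+ 2 * s ^+ 2)%R.
    by field; rewrite gt_eqF.
  by rewrite lerBrDl mulrDr.
rewrite key; split.
  move=> [h s0]; split => //; rewrite -[X in (_ * X <= _)%R]sqr_sqrtr// -exprMn.
  by rewrite lerXn2r// nnegrE ?mulr_ge0 ?sqrtr_ge0// ltW.
move=> [s0 h]; split => //.
rewrite -(@ler_pXn2r _ 2)// ?nnegrE ?mulr_ge0 ?sqrtr_ge0 ?(ltW t0) ?(ltW s0)//.
by rewrite exprMn sqr_sqrtr.
Qed.

Let mdisc r := @measurable_disc R m r.

Let mgam_disc r : measurable_fun setT
  (fun v : 'cV[R]_m => (gam v)%:E * (\1_(disc r) v : R)%:E).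
Proof.
apply: emeasurable_funM; first by apply/measurable_EFinP; apply: measurable_gam.
by apply/measurable_EFinP/measurable_indic.
Qed.

Let gam_disc_ge0 r (v : 'cV[R]_m) : 0 <= (gam v)%:E * (\1_(disc r) v : R)%:E.
Proof. by rewrite mule_ge0// lee_fin gam_ge0. Qed.

Let slice s : \bar R := if (0 < s)%R then (expR (- s ^+ 2))%:E *
     \int[LC m]_v ((gam v)%:E * (\1_(disc (T * s)) v : R)%:E) else 0.

Let kernelE s (v : 'cV[R]_m) : (0 < s)%R ->
  (gam (cV_cons (s, v)))%:E * (\1_(cone (e0 R m) t) (cV_cons (s, v)) : R)%:E =
  (expR (- s ^+ 2))%:E * ((gam v)%:E * (\1_(disc (T * s)) v : R)%:E).
Proof.
move=> s0.
rewrite muleA -[in RHS]EFinM /gam sqnorm_cons opprD expRD; congr (_ * _%:E).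
rewrite !indicE; congr ((_ : bool)%:R).
apply/idP/idP => /set_mem h; apply/mem_set; first by case/cone_e0E: h.
exact/cone_e0E.
Qed.

Let gconeE : gcone (e0 R m) t = \int[lebesgue_measure]_s slice s.
Proof.
rewrite /gcone ge0_integral_cVS; last 2 first.
- apply: emeasurable_funM; first by apply/measurable_EFinP; apply: measurable_gam.
  by apply/measurable_EFinP/measurable_indic; exact: measurable_cone.
- by move=> x; rewrite mule_ge0// lee_fin gam_ge0.
apply: eq_integral => s _; rewrite /slice; case: ifPn => s0; last first.
  rewrite integral0_eq// => v _; rewrite indicE memNset ?mule0//.
  by move=> /cone_e0E[]; rewrite (negbTE s0).
rewrite -ge0_integralZl//; try by rewrite lee_fin expR_ge0.
by apply: eq_integral => v _; exact: kernelE.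
Qed.

Let disc_int (s : R) : (0 < s)%R ->
  \int[LC m]_v (\1_(disc (T * s)) v : R)%:E = ((T * s) ^+ m)%:E * beta R m.
Proof. by move=> s0; rewrite integral_indic// setIT; apply: lebesgue_disc; exact: mulr_gt0. Qed.

Let slice_ge0 s : 0 <= slice s.
Proof.
rewrite /slice; case: ifP => // _; rewrite mule_ge0 ?lee_fin ?expR_ge0//.
exact: integral_ge0.
Qed.

Let mslice : measurable_fun setT slice.
Proof.
have mc := @measurable_cV_cons R m.
pose f (p : measurableTypeR R * 'cV[R]_m) : \bar R :=
  (gam (cV_cons p))%:E * (\1_(cone (e0 R m) t) (cV_cons p) : R)%:E.
have mf : measurable_fun setT f.
  apply: emeasurable_funM; first by apply/measurable_EFinP; exact: measurable_gam.
  apply/measurable_EFinP; apply: measurableT_comp mc.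
  by apply: measurable_indic; exact: measurable_cone.
have f0 p : 0 <= f p by rewrite mule_ge0// lee_fin gam_ge0.
rewrite (_ : slice = fubini_F (LC m) f); first exact: measurable_fun_fubini_tonelli_F.
apply/funext => s; rewrite /slice /fubini_F; case: ifPn => s0; last first.
  rewrite integral0_eq// => v _; rewrite /f indicE memNset ?mule0//.
  by move=> /cone_e0E[]; rewrite (negbTE s0).
rewrite -ge0_integralZl//; try by rewrite lee_fin expR_ge0.
by apply: eq_integral => v _; rewrite -kernelE.
Qed.

Let beta0 : 0 <= beta R m := ltW (beta_gt0 R m).

Let beta_real : exists b : R, beta R m = b%:E.
Proof. by have := beta_fin R m; move: beta0; case: (beta R m) => // b; exists b. Qed.

Let mmom : measurable_fun setT (fun s : R => (mom_fun s)%:E).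
Proof. by apply/measurable_EFinP; exact: measurable_mom_fun. Qed.

Let mom0 (s : R) : 0 <= (mom_fun s)%:E. Proof. by rewrite lee_fin mom_fun_ge0. Qed.

(** On each slice the Gaussian in the transversal variable is bounded by 1. *)
Lemma gcone_upper : gcone (e0 R m) t <= (T ^+ m)%:E * beta R m * gmoment.
Proof.
rewrite gconeE /gmoment -ge0_integralZl//; last first.
  by rewrite mule_ge0// lee_fin exprn_ge0// ltW.
apply: ge0_le_integralT; [exact: mslice|exact: measurable_funeM|exact: slice_ge0|].
move=> s; rewrite /slice /mom_fun; case: ifPn => s0; last by rewrite mule0.
apply: (@le_trans _ _ ((expR (- s ^+ 2))%:E * (((T * s) ^+ m)%:E * beta R m))).
  rewrite lee_pmul2l ?lte_fin ?expR_gt0// -disc_int//; apply: ge0_le_integralT => //.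
    by apply/measurable_EFinP/measurable_indic.
  move=> v; rewrite -[leRHS]mul1e; apply: lee_pmul => //.
    by rewrite lee_fin gam_ge0.
  by rewrite lee_fin -expR0 ler_expR oppr_le0 sqnorm_ge0.
have [b ->] := beta_real.
rewrite -!EFinM lee_fin exprMn le_eqVlt; apply/orP; left; apply/eqP; ring.
Qed.

(** On each slice the transversal Gaussian is at least its value exp(-(T s)^2) on the rim. As 1 +
    T^2 = t^-2, this leaves exp(-(s/t)^2), and rescaling s by [t] produces the factor t^(m+1). *)
Lemma gcone_lower : (T ^+ m * t ^+ n)%:E * beta R m * gmoment <= gcone (e0 R m) t.
Proof.
have tn0 : (t^-1 != 0)%R by rewrite invr_eq0 gt_eqF.
have mmt : measurable_fun setT (fun s : R => (mom_fun (t^-1 * s))%:E).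
  by apply: (measurableT_comp mmom); exact: measurable_funM.
have -> : (T ^+ m * t ^+ n)%:E * beta R m * gmoment =
    \int[lebesgue_measure]_s (((T * t) ^+ m)%:E * beta R m * (mom_fun (t^-1 * s))%:E).
  transitivity (((T * t) ^+ m)%:E * beta R m * \int[lebesgue_measure]_s (mom_fun (t^-1 * s))%:E).
    rewrite (ge0_integral_scale tn0 mmom mom0) normfV invrK gtr0_norm//.
    rewrite muleA; congr (_ * _); rewrite muleAC; congr (_ * _).
    by rewrite -EFinM [((T * t) ^+ m)%R]exprMn [(t ^+ n)%R]exprSr mulrA.
  apply/esym; apply: ge0_integralZlT => //.
  by rewrite mule_ge0// lee_fin exprn_ge0// mulr_ge0// ltW.
rewrite gconeE; apply: ge0_le_integralT.
- exact: measurable_funeM.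
- exact: mslice.
- move=> s; rewrite mule_ge0// mule_ge0// lee_fin exprn_ge0// mulr_ge0// ltW//.
move=> s; rewrite /slice /mom_fun pmulr_rgt0 ?invr_gt0//.
case: ifPn => s0; last by rewrite mule0.
apply: (@le_trans _ _ ((expR (- s ^+ 2))%:E *
   ((expR (- (T * s) ^+ 2))%:E * (((T * s) ^+ m)%:E * beta R m)))); last first.
  rewrite lee_pmul2l ?lte_fin ?expR_gt0// -disc_int//.
  have mi : measurable_fun setT (fun v : 'cV[R]_m => (\1_(disc (T * s)) v : R)%:E).
    by apply/measurable_EFinP/measurable_indic.
  rewrite -(ge0_integralZlT _ mi); try by [rewrite lee_fin expR_ge0|move=> v; rewrite lee_fin].
  apply: ge0_le_integralT => //.
  - exact: measurable_funeM.
  - move=> v; rewrite indicE; have [|_] := boolP (v \in _); last by rewrite !mule0.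
    by rewrite !mule1 lee_fin ler_expR lerN2 => /set_mem.
have [b ->] := beta_real.
rewrite -!EFinM lee_fin le_eqVlt; apply/orP; left; apply/eqP.
move: T T2 => u u2.
have -> : (expR (- (t^-1 * s) ^+ 2) = expR (- s ^+ 2) * expR (- (u * s) ^+ 2))%R.
  rewrite -expRD; congr expR.
  by rewrite [((t^-1 * s) ^+ 2)%R]exprMn exprVn -u2 exprMn; ring.
have E : ((u * t) ^+ m * (t^-1 * s) ^+ m = (u * s) ^+ m)%R.
  by rewrite -exprMn; congr (_ ^+ m)%R; field; rewrite gt_eqF.
by rewrite -E; ring.
Qed.

End cone_estimate.

Section sphere_area_value.
Context (R : realType) (m : nat).
Local Open Scope ereal_scope.
Local Notation n := m.+1.
Local Notation H := (@hausdorff_unnormalized R n m).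
Local Notation S := (@unit_sphere R n).
Local Notation kap := (kappa R m).
Local Notation M := (@gmoment R m).

(** The limit t -> 1, made quantitative by Bernoulli's inequality. *)
Lemma le_of_near1 (a b : R) k : (0 <= a)%R ->
  (forall t, 0 < t < 1 -> t ^+ k * a <= b)%R -> (a <= b)%R.
Proof.
move=> a0 h; apply/ler_addgt0Pr => e e0.
have bern (x : R) j : (0 <= x <= 1)%R -> (1 - j%:R * x <= (1 - x) ^+ j)%R.
  move=> /andP[x0 x1]; elim: j => [|j IH]; first by rewrite expr0 mul0r subr0.
  rewrite exprS; apply: le_trans (ler_wpM2l _ IH); last by lra.
  have j0 : (0 <= j%:R :> R)%R by [].
  by rewrite -natr1; nra.
pose c : R := (k%:R * a + 1)%R.
have c0 : (0 < c)%R by rewrite ltr_wpDl// mulr_ge0.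
pose x := (Num.min (1 / 2) (e / c))%R.
have x0 : (0 < x)%R by rewrite lt_min divr_gt0// divr_gt0.
have x12 : (x <= 1 / 2)%R by rewrite ge_min lexx.
have xe : (x * c <= e)%R.
  by rewrite -ler_pdivlMr// ge_min lexx orbT.
have := h (1 - x)%R; have -> : (0 < 1 - x < 1)%R by apply/andP; split; lra.
move=> /(_ isT) h1.
have x01 : (0 <= x <= 1)%R by apply/andP; split; lra.
have := ler_wpM2r a0 (bern x k x01).
rewrite mulrBl mul1r => h2.
have : (k%:R * x * a <= e)%R.
  have e1 : (x * c = k%:R * x * a + x)%R by rewrite /c; ring.
  lra.
lra.
Qed.

(** The Gaussian integral in polar coordinates. In [sphere_cone_cap] both the cap and the cone
    contribute T^m times [beta], up to powers of [t]; these factors cancel and t -> 1 leaves the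
    identity. *)
Lemma gmoment_sphere : M \is a fin_num /\ H S * M = (kap * Num.sqrt pi ^+ n)%:E.
Proof.
have b0 := beta_gt0 R m.
have [b bE] : exists b, beta R m = b%:E.
  by have := beta_fin R m; move: b0; case: (beta R m) => // b; exists b.
have {}b0 : (0 < b)%R by rewrite -lte_fin -bE.
have [a aE] : exists a, H S = a%:E.
  have := hausdorff_sphere_fin R m.
  by have := hausdorff_unnormalized_ge0 m S; case: (H S) => // a; exists a.
have P0 : (0 < Num.sqrt pi ^+ n :> R)%R by rewrite exprn_gt0// sqrtr_gt0 pi_gt0.
set P := (Num.sqrt pi ^+ n)%R in P0 *.
have kap0 := kappa_gt0 R m.
have bounds (t : R) : (0 < t < 1)%R -> exists T g h : R,
  [/\ [/\ (0 < T)%R, (0 < h)%R & gcone (e0 R m) t = g%:E],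
     (a * g = h * P)%R,
     (kap * ((T * t) ^+ m * b) <= h)%R, (h <= t ^- m * (kap * ((T * t) ^+ m * b)))%R &
     (T ^+ m * t ^+ n)%:E * b%:E * M <= g%:E /\ g%:E <= (T ^+ m)%:E * b%:E * M].
  move=> t01; have /andP[t0 t1] := t01.
  have r0 : (0 < Num.sqrt (1 - t ^+ 2))%R by rewrite sqrtr_gt0 subr_gt0 expr_lt1// ltW.
  pose T := (Num.sqrt (1 - t ^+ 2) / t)%R.
  have TE : (Num.sqrt (1 - t ^+ 2) = T * t)%R by rewrite /T divfK// gt_eqF.
  have h0 := hausdorff_cap_gt0 m t01.
  have [h hE] : exists h, H (cap (e0 R m) t) = h%:E.
    have := hausdorff_cap_fin t01 (enorm_e0 R m); move: h0.
    by case: (H _) => // h; exists h.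
  have SC := sphere_cone_cap m t01.
  have g0 : 0 <= gcone (e0 R m) t.
    by apply: integral_ge0 => y _; rewrite mule_ge0// lee_fin gam_ge0.
  have {}h0 : (0 < h)%R by rewrite -lte_fin -hE.
  have a0 : (0 <= a)%R by rewrite -lee_fin -aE; exact: hausdorff_unnormalized_ge0.
  have an0 : (a != 0)%R.
    apply/eqP => aa; move: SC; rewrite aE aa mul0e hE -EFinM => -[] /esym/eqP.
    by rewrite mulf_eq0 !gt_eqF.
  have {}a0 : (0 < a)%R by rewrite lt0r an0.
  have [g gE] : exists g, gcone (e0 R m) t = g%:E.
    move: SC g0; rewrite aE hE; case: (gcone _ _) => [g _ _|+ _|//]; first by exists g.
    by rewrite mulry gtr0_sg// mul1e.
  exists T, g, h; split.
  - by split => //; rewrite divr_gt0.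
  - by move: SC; rewrite aE hE gE -!EFinM => -[].
  - have := cap_lower m t01; rewrite lebesgue_disc// bE hE TE -!EFinM lee_fin.
    by [].
  - have := cap_upper m t01; rewrite lebesgue_disc// bE hE TE -!EFinM lee_fin.
    by [].
  - by rewrite -gE -bE; split; [exact: gcone_lower|exact: gcone_upper].
have M0 := gmoment_gt0 R m.
have [mu muE] : exists mu, M = mu%:E.
  have h12 : (0 < (1 / 2 : R) < 1)%R by apply/andP; split; lra.
  have [T [g [h [[T0 h0 gE] _ _ _ [+ _]]]]] := bounds _ h12.
  move: M0; case: M => [mu|//|//] _; first by exists mu.
  rewrite -EFinM mulry gtr0_sg ?mul1e//.
  by rewrite !mulr_gt0// exprn_gt0//; lra.
rewrite muE; split => //; rewrite aE -EFinM; congr EFin.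
have mu0 : (0 < mu)%R by rewrite -lte_fin -muE.
apply/eqP; rewrite eq_le; apply/andP; split.
- apply: (@le_of_near1 _ _ n).
    by rewrite mulr_ge0 ?(ltW mu0)// -lee_fin -aE hausdorff_unnormalized_ge0.
  move=> t t01; have /andP[t0 t1] := t01.
  have [T [g [h [[T0 h0 gE] agh _ hu [gl _]]]]] := bounds t t01.
  move: gl; rewrite muE -!EFinM lee_fin => gl.
  have a0 : (0 <= a)%R by rewrite -lee_fin -aE; exact: hausdorff_unnormalized_ge0.
  have Tb : (0 < T ^+ m * b)%R by rewrite mulr_gt0// exprn_gt0.
  rewrite -(ler_pM2l Tb).
  have := ler_wpM2l a0 gl; rewrite agh => h1.
  have := ler_wpM2r (ltW P0) hu => h2.
  have E : (t ^- m * (kap * ((T * t) ^+ m * b)) * P = T ^+ m * b * (kap * P))%R.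
    have tm : (t ^+ m != 0)%R by rewrite expf_neq0// gt_eqF.
    by rewrite exprMn; field; rewrite ?tm ?gt_eqF.
  rewrite -E; apply: le_trans h2; apply: le_trans h1.
  by rewrite le_eqVlt; apply/orP; left; apply/eqP; ring.
- apply: (@le_of_near1 _ _ m); first by rewrite mulr_ge0 ?(ltW P0) ?(ltW kap0).
  move=> t t01; have /andP[t0 t1] := t01.
  have [T [g [h [[T0 h0 gE] agh hl _ [_ gu]]]]] := bounds t t01.
  move: gu; rewrite muE -!EFinM lee_fin => gu.
  have a0 : (0 <= a)%R by rewrite -lee_fin -aE; exact: hausdorff_unnormalized_ge0.
  have Tb : (0 < T ^+ m * b)%R by rewrite mulr_gt0// exprn_gt0.
  rewrite -(ler_pM2l Tb).
  have := ler_wpM2l a0 gu; rewrite agh => h1.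
  have := ler_wpM2r (ltW P0) hl => h2.
  have E : (kap * ((T * t) ^+ m * b) * P = T ^+ m * b * (t ^+ m * (kap * P)))%R.
    by rewrite exprMn; ring.
  rewrite -E; apply: le_trans h2 _; apply: le_trans h1 _.
  by rewrite le_eqVlt; apply/orP; left; apply/eqP; ring.
Qed.

Lemma sphere_areaE : (sphere_area R n * fine M = Num.sqrt pi ^+ n)%R.
Proof.
have [Mfin E] := gmoment_sphere.
have kap0 := kappa_gt0 R m.
have [a aE] : exists a, H S = a%:E.
  have := hausdorff_sphere_fin R m.
  by have := hausdorff_unnormalized_ge0 m S; case: (H S) => // a; exists a.
have hE : sphere_area R n = (a / kap)%R.
  rewrite /sphere_area /hausdorff/= aE.
  rewrite -[X in _ / hausdorff_unnormalized _ X]/(@ucube R m) kappaE.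
  by rewrite inver gt_eqF.
move: E; rewrite -(fineK Mfin) aE -EFinM => -[] E.
rewrite hE mulrAC E; field; exact/lt0r_neq0.
Qed.

End sphere_area_value.

(** * The Gamma function and the limit of the constant *)

Section power_integrals.
Context (R : realType).
Local Notation mu := (@lebesgue_measure R).
Local Open Scope ereal_scope.

(** Integrals over the half-line become integrals over R, as the lemmas on scaling and on Tonelli
    expect. *)
Definition pos_pow (b s : R) : R := if (0 < s)%R then (s `^ b)%R else 0%R.

Lemma pos_pow_ge0 b s : (0 <= pos_pow b s)%R.
Proof. by rewrite /pos_pow; case: ifP; rewrite ?powR_ge0. Qed.

Lemma measurable_pos_pow b : measurable_fun setT (pos_pow b).
Proof.
apply: measurable_fun_ifT => //; first by apply: measurable_fun_ltr.

Qed.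

Lemma integral_powR_itv (a e t : R) : (0 < a)%R -> (0 < e < t)%R ->
  \int[mu]_(r in `[e, t]) (a * r `^ (a - 1))%:E = (t `^ a - e `^ a)%:E.
Proof.
move=> a0 /andP[e0 et].
have cF b x : (0 < x)%R -> {for x, continuous (fun r : R => r `^ b)%R}.
  move=> x0; apply/differentiable_continuous/derivable1_diffP.
  by apply: derivable_powR; rewrite in_itv/= andbT.
rewrite (@continuous_FTC2 _ (fun r => a * r `^ (a - 1))%R (fun r : R => r `^ a)%R e t)//.
- apply: continuous_in_subspaceT => x; rewrite inE/= in_itv/= => /andP[ex _].
  apply: (@continuousM R R (cst a) (fun r : R => r `^ (a - 1))%R); first exact: cst_continuous.
  by apply: cF; exact: lt_le_trans ex.
- split.
  + move=> x; rewrite in_itv/= => /andP[ex _].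
    by apply: derivable_powR; rewrite in_itv/= andbT (lt_trans e0).
  + by apply: cvg_at_right_filter; exact: cF.
  + by apply: cvg_at_left_filter; apply: cF; exact: lt_trans et.
- move=> x; rewrite in_itv/= => /andP[ex _].
  by rewrite powR_derive1// in_itv/= andbT (lt_trans e0).
Qed.

(** The exponent a - 1 may be negative, so the fundamental theorem is used on [t/(k+2), t] and
    monotone convergence yields the integral up to 0. The k + 2 keeps the left end strictly below
    [t]. *)
Lemma integral_powR (a t : R) : (0 < a)%R -> (0 < t)%R ->
  \int[mu]_r (if (0 < r <= t)%R then a * r `^ (a - 1) else 0)%R%:E = (t `^ a)%:E.
Proof.
move=> a0 t0.
pose F (k : nat) : set R := [set` `[(t / k.+2%:R)%R, t]].
pose f r := (a * r `^ (a - 1))%R%:E.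
have tk k : (0 < t / k.+2%:R < t)%R.
  by rewrite divr_gt0//= ltr_pdivrMr// ltr_pMr// ltr1n.
have UF : \bigcup_k F k = [set` `]0%R, t]].
  apply/seteqP; split => x/=.
    move=> [k _]; rewrite /F/= !in_itv/= => /andP[kx ->]; rewrite andbT.
    by apply: lt_le_trans kx; case/andP: (tk k).
  rewrite in_itv/= => /andP[x0 xt].
  have [k kx] : exists k : nat, (t / x <= k%:R)%R.
    by exists (Num.truncn (t / x)).+1; rewrite ltW// truncnS_gt.
  exists k => //; rewrite /F/= in_itv/= xt andbT ler_pdivrMr// mulrC -ler_pdivrMr//.
  by apply: le_trans kx _; rewrite ler_nat; apply: leq_trans (leqnSn _) (leqnSn _).
have mf : measurable_fun setT f.
  by apply/measurable_EFinP; apply: measurable_funM => //; exact: measurable_powR.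
have f0 x : 0 <= f x by rewrite lee_fin mulr_ge0 ?powR_ge0 ?(ltW a0).
transitivity (\int[mu]_(r in \bigcup_k F k) f r).
  rewrite UF [RHS]integral_mkcond; apply: eq_integral => x _.
  by rewrite patchE mem_setE in_itv/=; case: ifP.
have C : \int[mu]_(x in F i) f x @[i --> \oo] --> \int[mu]_(x in \bigcup_i F i) f x.
  apply: ge0_nondecreasing_set_cvg_integral => //.
  - apply/nondecreasing_seqP => k; rewrite subsetEset => x/=.
    rewrite /F/= !in_itv/= => /andP[kx ->]; rewrite andbT; apply: le_trans kx.
    by rewrite ler_pM2l// lef_pV2 ?posrE// ler_nat.
  - by move=> k; exact: measurable_itv.
  - by move=> k; exact: measurable_funTS.
apply/esym; apply: (cvg_unique _ _ C) => //.
rewrite (_ : (fun i => _) = fun k => (t `^ a - (t / k.+2%:R) `^ a)%:E); last first.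
  by apply/funext => k; exact: integral_powR_itv.
apply: cvg_EFin; first by near=> k.
rewrite -[X in _ --> X](subr0 (t `^ a)%R) /comp/=.
apply: (@cvgB _ R^o _ _ _ (fun=> (t `^ a)%R) (fun k => ((t / k.+2%:R) `^ a)%R)).
  exact: cvg_cst.
have /cvg_at_rightP := powR_cvg0 a0; apply; split=> [k|]; first by case/andP: (tk k).
rewrite -(mulr0 t); apply: cvgM; first exact: cvg_cst.
by have := @cvg_harmonic R; rewrite -cvg_shiftS.
Unshelve. all: by end_near. Qed.

Lemma measurable_powR_trunc (a t : R) :
  measurable_fun setT (fun r : R => (if (0 < r <= t)%R then a * r `^ (a - 1) else 0)%R%:E).
Proof.
apply/measurable_EFinP; apply: measurable_fun_ifT => //.
  by apply: measurable_and; [apply: measurable_fun_ltr|apply: measurable_fun_ler].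
by apply: measurable_funM => //; exact: measurable_powR.
Qed.

Lemma measurable_expR_tail (r : R) :
  measurable_fun setT (fun t : R => (if (r <= t)%R then expR (- t) else 0)%R%:E).
Proof.
apply/measurable_EFinP; apply: measurable_fun_ifT => //; first by apply: measurable_fun_ler.
by apply: measurable_expR_comp; exact: measurable_funN.
Qed.

Lemma integral_expR_itv (r : R) :
  \int[mu]_(t in `[r, +oo[) (expR (- t))%:E = (expR (- r))%:E.
Proof.
have cE : continuous (fun x : R => expR (- x)).
  by move=> x; apply: continuous_comp; [exact: opp_continuous|exact: continuous_expR].
rewrite (@ge0_continuous_FTC2y _ _ (fun t => - expR (- t))%R r 0%R).
- by rewrite -EFinB sub0r opprK.
- by move=> x _; exact: expR_ge0.
- exact: continuous_subspaceT.
- rewrite -[X in _ --> X]oppr0; apply: cvgN; exact: cvgr_expR.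
- by move=> x _; exact: ex_derive.
- by apply: cvg_at_right_filter; apply: cvgN; exact: cE.
- move=> x _; rewrite derive1E deriveN; last exact: ex_derive.
  have [_ ->] : is_derive x 1%R (fun t : R => expR (- t)) (expR (- x) *: -1%R)%R.
    exact: (is_derive1_comp (f := expR) (g := -%R)).
  by rewrite /GRing.scale/= mulrN1 opprK.
Qed.

Lemma integral_expR_tail (r : R) :
  \int[mu]_t (if (r <= t)%R then expR (- t) else 0)%R%:E = (expR (- r))%:E.
Proof.
rewrite -integral_expR_itv [RHS]integral_mkcond; apply: eq_integral => x _.
by rewrite patchE mem_setE in_itv/= andbT; case: ifP.
Qed.

(** Write exp(-s^q) as the integral of exp(-t) over t >= s^q and integrate in s first. One exchange
    replaces an integration by parts (q = 1, the functional equation of Gamma) and the substitution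
    t = s^2 (q = 2, the radial moments). *)
Lemma layer_cake_expR (b q : R) : (0 < b)%R -> (0 < q)%R ->
  b%:E * \int[mu]_s (pos_pow (b - 1) s * expR (- (s `^ q)))%:E =
  \int[mu]_t (pos_pow (b / q) t * expR (- t))%:E.
Proof.
move=> b0 q0.
pose F (p : measurableTypeR R * measurableTypeR R) : R :=
  (if (0 < p.1) && (p.1 `^ q <= p.2) then b * p.1 `^ (b - 1) * expR (- p.2) else 0)%R.
have mF : measurable_fun setT (EFin \o F).
  apply/measurable_EFinP; apply: measurable_fun_ifT => //.
  - apply: measurable_and; first by apply: measurable_fun_ltr.
    apply: measurable_fun_ler => //.
    exact: (measurableT_comp (measurable_powR q) measurable_fst).
  - apply: measurable_funM; last by apply: measurable_expR_comp; exact: measurable_funN.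
    apply: measurable_funM => //.
    exact: (measurableT_comp (measurable_powR (b - 1)) measurable_fst).
have F0 p : 0 <= (EFin \o F) p.
  rewrite /F/= lee_fin; case: ifP => // _.
  by rewrite mulr_ge0 ?expR_ge0// mulr_ge0 ?powR_ge0// ltW.
have := @fubini_tonelli _ _ _ _ R mu mu _ mF F0; rewrite /F/= => FT {mF F0}.
rewrite -ge0_integralZlT; first last.
- by rewrite lee_fin ltW.
- by move=> s; rewrite lee_fin mulr_ge0 ?expR_ge0 ?pos_pow_ge0.
- apply/measurable_EFinP; apply: measurable_funM; first exact: measurable_pos_pow.
  by apply: measurable_expR_comp; apply: measurable_funN; exact: measurable_powR.
transitivity (\int[mu]_s \int[mu]_t (EFin \o F) (s, t)).
  apply: eq_integral => s _ {FT}; rewrite /pos_pow /F/=; case: ifPn => s0 /=; last first.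
    by rewrite mul0r mule0 integral0.
  rewrite -EFinM mulrA EFinM -integral_expR_tail -ge0_integralZlT.
  - by apply: eq_integral => t _; case: ifP; rewrite ?mule0 -?EFinM.
  - exact: measurable_expR_tail.
  - by move=> t; rewrite lee_fin; case: ifP => // _; rewrite expR_ge0.
  - by rewrite lee_fin mulr_ge0 ?powR_ge0// ltW.
rewrite FT {FT F}; apply: eq_integral => t _; rewrite /pos_pow.
case: ifPn => t0; last first.
  rewrite mul0r integral0_eq// => s _; case: ifPn => // /andP[s0 st].
  by exfalso; move: t0; rewrite (lt_le_trans _ st)// powR_gt0.
rewrite (_ : t `^ (b / q) = (t `^ q^-1) `^ b)%R; last by rewrite -powRrM mulrC.
rewrite mulrC EFinM -integral_powR ?powR_gt0// -ge0_integralZlT.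
- apply: eq_integral => s _.
  have -> : ((0 < s) && (s `^ q <= t) = (0 < s <= t `^ q^-1))%R.
    case: (ltP 0%R s) => //= s0.
    have E (y z : R) : (0 <= y)%R -> (z != 0)%R -> ((y `^ z) `^ z^-1 = y)%R.
      by move=> y0 z0; rewrite -powRrM mulfV ?powRr1.
    apply/idP/idP => st.
      rewrite -[leLHS](E _ q) ?(ltW s0) ?gt_eqF//.
      by apply: ge0_ler_powR; rewrite ?nnegrE ?powR_ge0 ?invr_ge0 ?(ltW q0) ?(ltW t0).
    rewrite -[leRHS](E _ q^-1)%R ?(ltW t0) ?invr_eq0 ?gt_eqF// invrK.
    by apply: ge0_ler_powR; rewrite ?nnegrE ?powR_ge0 ?(ltW s0) ?(ltW q0).
  by case: ifP; rewrite ?mule0 -?EFinM// mulrC.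
- exact: measurable_powR_trunc.
- by move=> s; rewrite lee_fin; case: ifP => // _; rewrite mulr_ge0 ?powR_ge0 ?(ltW b0).
- by rewrite lee_fin expR_ge0.
Qed.

(** Gamma before [fine], so that identities can be proved before finiteness is known. *)
Definition gamma (a : R) : \bar R :=
  \int[mu]_t (pos_pow (a - 1) t * expR (- t))%:E.

Lemma GammaE a : Gamma a = fine (gamma a).
Proof.
rewrite /Gamma /Rintegral integral_mkcond; congr fine.
apply: eq_integral => t _; rewrite patchE mem_setE in_itv/= andbT /pos_pow.
by case: ifP => //; rewrite mul0r.
Qed.

Lemma measurable_gamma_integrand a :
  measurable_fun setT (fun t => (pos_pow (a - 1) t * expR (- t))%:E).
Proof.
apply/measurable_EFinP; apply: measurable_funM; first exact: measurable_pos_pow.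
by apply: measurable_expR_comp; exact: measurable_funN.
Qed.

Lemma gamma_integrand_ge0 a (t : R) : 0 <= (pos_pow (a - 1) t * expR (- t))%:E.
Proof. by rewrite lee_fin mulr_ge0 ?expR_ge0 ?pos_pow_ge0. Qed.

Lemma gamma_ge0 a : 0 <= gamma a.
Proof. by apply: integral_ge0 => t _; exact: gamma_integrand_ge0. Qed.

Lemma gammaS a : (0 < a)%R -> gamma (a + 1) = a%:E * gamma a.
Proof.
move=> a0; have := layer_cake_expR a0 ltr01; rewrite divr1 /gamma addrK => <-.
congr (_ * _); apply: eq_integral => t _; rewrite /pos_pow; case: ifPn => t0.
  by rewrite powRr1// ltW.
by rewrite !mul0r.
Qed.

Lemma gmomentE m : (m.+1%:R)%:E * gmoment R m = gamma (m.+1%:R / 2 + 1).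
Proof.
have := @layer_cake_expR m.+1%:R 2 (ltr0Sn _ _) (ltr0Sn _ _).
rewrite /gamma addrK => <-; congr (_ * _); apply: eq_integral => t _.
rewrite /mom_fun /pos_pow; case: ifPn => t0; last by rewrite mul0r.
by rewrite -natr1 addrK !powR_mulrn// ltW.
Qed.

Lemma gamma1 : gamma 1 = 1.
Proof.
have := integral_expR_itv 0; rewrite oppr0 expR0 => <-.
have mE : measurable_fun setT (fun t : R => (expR (- t))%:E).
  by apply/measurable_EFinP; apply: measurable_expR_comp; exact: measurable_funN.
rewrite -integral_itv_obnd_cbnd; last exact: measurable_funTS.
rewrite [RHS]integral_mkcond; apply: eq_integral => t _.
rewrite patchE mem_setE in_itv/= andbT /pos_pow subrr powRr0.
by case: ifP; rewrite ?mul1r ?mul0r.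
Qed.

Lemma gamma_gt0 a : 0 < gamma a.
Proof.
apply: (@integral_gt0 _ _ (expR (- `|a - 1|) * expR (- 2))%R).
- by have /measurable_EFinP := measurable_gamma_integrand a; apply.
- by move=> t; rewrite -lee_fin gamma_integrand_ge0.
- by rewrite mulr_gt0 ?expR_gt0.
move=> t /andP[t1 t2]; rewrite /pos_pow ifT; last by lra.
apply: ler_pM; rewrite ?expR_ge0//; last by rewrite ler_expR lerN2.
rewrite /powR gt_eqF; last by lra.
have ln1 : (ln t <= 1)%R.
  have h := @le_ln1Dx R (t - 1)%R; rewrite (_ : 1 + (t - 1) = t)%R in h; last by ring.
  by apply: le_trans (h _) _; lra.
rewrite ler_expR lerNl; apply: le_trans (ler_norm _) _.
by rewrite normrN normrM ler_piMr// ger0_norm// ln_ge0.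
Qed.

(** Finiteness at the points (m+1)/2 + 1 comes from the radial moments, hence from the finite
    Gaussian integral. An exponent between two such points is dominated by their sum, and small [a]
    are reached from a + 2 by the functional equation. *)
Lemma gamma_fin a : (0 < a)%R -> gamma a \is a fin_num.
Proof.
move=> a0.
have half m : gamma (m.+1%:R / 2 + 1) \is a fin_num.
  rewrite -gmomentE fin_numM//; exact: (gmoment_sphere R m).1.
have big b : (3 / 2 <= b)%R -> gamma b \is a fin_num.
  move=> b32; have [m mb] : exists m : nat, (b - 1 <= m.+1%:R / 2)%R.
    by exists (Num.truncn (2 * b)); have := truncnS_gt (2 * b)%R; lra.
  have h0 := half 0%N; rewrite mul1r in h0.
  rewrite ge0_fin_numE ?gamma_ge0//.
  apply: (@le_lt_trans _ _ (gamma (2^-1 + 1) + gamma (m.+1%:R / 2 + 1))); last first.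
    by rewrite -ge0_fin_numE; [rewrite fin_numD h0 half|rewrite adde_ge0 ?gamma_ge0].
  rewrite /gamma -ge0_integralD//; first last.
  - exact: measurable_gamma_integrand.
  - by move=> t _; exact: gamma_integrand_ge0.
  - exact: measurable_gamma_integrand.
  - by move=> t _; exact: gamma_integrand_ge0.
  apply: ge0_le_integralT.
  - exact: measurable_gamma_integrand.
  - by apply: emeasurable_funD; exact: measurable_gamma_integrand.
  - by move=> t; exact: gamma_integrand_ge0.
  - move=> t; rewrite -EFinD lee_fin -mulrDl ler_wpM2r ?expR_ge0// !addrK /pos_pow.
    case: ifPn => t0; last by rewrite addr0.
    have [t1|t1] := leP t 1%R.
      rewrite -[leLHS]addr0 lerD ?powR_ge0//.
      by apply: ger_powR; rewrite ?t0//; lra.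
    rewrite -[leLHS]add0r lerD ?powR_ge0//.
    by apply: ler_powR; rewrite ?(ltW t1).
have := big (a + 1 + 1)%R; rewrite !gammaS//; last by rewrite addr_gt0.
have a10 : (a + 1 != 0)%R by rewrite gt_eqF// addr_gt0.
have := gamma_ge0 a; case: (gamma a) => // _ /(_ ltac:(lra)).
by rewrite !gt0_muley// lte_fin// addr_gt0.
Qed.

End power_integrals.

Section gamma_limit.
Context (R : realType).
Local Notation mu := (@lebesgue_measure R).

Lemma Gamma_gt0 (a : R) : 0 < a -> 0 < Gamma a.
Proof.
move=> a0; rewrite GammaE fine_gt0// gamma_gt0/= -ge0_fin_numE ?gamma_ge0//.
exact: gamma_fin.
Qed.

Lemma GammaS (a : R) : 0 < a -> Gamma (a + 1) = a * Gamma a.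
Proof. by move=> a0; rewrite !GammaE gammaS// fineM//; exact: gamma_fin. Qed.

Lemma Gamma1 : Gamma (1 : R) = 1.
Proof. by rewrite GammaE gamma1. Qed.

Lemma integrable_gamma_integrand (a : R) : 0 < a ->
  mu.-integrable setT (EFin \o (fun t => pos_pow (a - 1) t * expR (- t))).
Proof.
move=> a0; apply/integrableP; split; first exact: measurable_gamma_integrand.
under eq_integral => t _ do rewrite /= ger0_norm ?mulr_ge0 ?expR_ge0 ?pos_pow_ge0//.
by rewrite -/(gamma a) -ge0_fin_numE ?gamma_ge0// gamma_fin.
Qed.

(** Dominated convergence on ]a/2, a+1[: the power with the smaller exponent dominates for t <= 1,
    the other one for t > 1, and [g] is their sum. *)
Lemma continuous_Gamma (a : R) : 0 < a -> {for a, continuous (@Gamma R)}.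
Proof.
move=> a0.
have aI : a \in (`]a / 2, a + 1[%classic : set R) by rewrite mem_setE in_itv/=; lra.
pose f (x t : R) := pos_pow (x - 1) t * expR (- t).
pose g (t : R) := pos_pow (a / 2 - 1) t * expR (- t) + pos_pow (a + 1 - 1) t * expR (- t).
have -> : @Gamma R = (fun x => \int[mu]_(t in setT) f x t).
  by apply/funext => x; rewrite GammaE.
apply: (@continuity_under_integral R _ _ mu f setT measurableT (a / 2) (a + 1) _ _ g) => //.
- move=> x/=; rewrite in_itv/= => /andP[x0 _].
  by apply: integrable_gamma_integrand; lra.
- apply: aeW => t _ x _; rewrite /f /pos_pow; have [t0|t0] := boolP (0 < t); last first.
    by under eq_fun do rewrite mul0r; exact: cst_continuous.
  apply: (@continuousM R R (fun x => t `^ (x - 1)) (cst (expR (- t)))).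
    rewrite /powR gt_eqF//; apply: continuous_comp; last exact: continuous_expR.
    apply: (@continuousM R R (fun x => x - 1) (cst (ln t))); last exact: cst_continuous.
    by apply: (@continuousB R R^o R id (cst 1)); [exact: cvg_id|exact: cst_continuous].
  exact: cst_continuous.
- have := @integrableD _ _ _ mu setT measurableT _ _
    (integrable_gamma_integrand (divr_gt0 a0 (ltr0Sn _ 1)))
    (integrable_gamma_integrand (addr_gt0 a0 ltr01)).
  exact.
- move=> x/=; rewrite in_itv/= => /andP[x1 x2]; apply: aeW => t _.
  rewrite /f /g ger0_norm ?mulr_ge0 ?expR_ge0 ?pos_pow_ge0//.
  rewrite -mulrDl ler_wpM2r ?expR_ge0// /pos_pow.
  case: ifPn => t0; last by rewrite addr0.
  have [t1|t1] := leP t 1.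
    rewrite -[leLHS]addr0 lerD ?powR_ge0//.
    by apply: ger_powR; rewrite ?t0//; lra.
  rewrite -[leLHS]add0r lerD ?powR_ge0//.
  by apply: ler_powR; rewrite ?(ltW t1)//; lra.
Qed.

Variable n : nat.

Lemma frac_const_gt0 (s : R) : 0 < s < 1 -> 0 < @frac_const R n s.
Proof.
move=> /andP[s0 s1]; rewrite /frac_const divr_gt0//.
  rewrite !mulr_gt0 ?powR_gt0//; apply: Gamma_gt0.
  by rewrite divr_gt0// ltr_wpDl// mulr_gt0.
by rewrite mulr_gt0 ?powR_gt0 ?pi_gt0//; apply: Gamma_gt0; rewrite subr_gt0.
Qed.

(** Eliminates the radial moment between the polar form of the Gaussian integral and [gmomentE]. *)
Lemma sphere_areaE_Gamma : (0 < n)%N ->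
  sphere_area R n * Gamma (n%:R / 2 + 1) = n%:R * pi `^ (n%:R / 2).
Proof.
case: n => // m _.
have <- : Num.sqrt pi ^+ m.+1 = (pi : R) `^ (m.+1%:R / 2).
  by rewrite mulrC powRrM powR12_sqrt ?pi_ge0// powR_mulrn// sqrtr_ge0.
have [Mfin _] := gmoment_sphere R m.
rewrite GammaE -gmomentE fineM// -sphere_areaE/=; ring.
Qed.

Lemma cKs_cvg (K : R) : (0 < n)%N -> cKs n K s @[s --> (1 : R)^'-] --> K.
Proof.
move=> n0.
have n0R : 0 < n%:R :> R by rewrite ltr0n.
(* Here (1 - s) Gamma(1 - s) has become Gamma(2 - s): [F] agrees with [cKs] for s < 1 and is
   continuous at 1. *)
pose F (s : R) : R := K * (sphere_area R n / (4 * n%:R `^ s)) *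
  (4 `^ s * s * Gamma (n%:R / 2 + s) / (pi `^ (n%:R / 2) * Gamma (2 - s))).
have F1 : F 1 = K.
  rewrite /F !powRr1// (_ : 2 - 1 = 1 :> R); last by lra.
  rewrite Gamma1 !mulr1.
  have P0 : (pi : R) `^ (n%:R / 2) != 0 by rewrite gt_eqF// powR_gt0// pi_gt0.
  have := sphere_areaE_Gamma n0 => E.
  have -> : K * (sphere_area R n / (4 * n%:R)) *
    (4 * Gamma (n%:R / 2 + 1) / pi `^ (n%:R / 2)) =
    K * (sphere_area R n * Gamma (n%:R / 2 + 1)) / (n%:R * pi `^ (n%:R / 2)).
    by field; rewrite P0 gt_eqF.
  by rewrite E -mulrA divff ?mulr1// mulf_neq0// gt_eqF.
rewrite -[X in _ --> X]F1.
have cF : {for 1, continuous F}.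
  have cM (f g : R -> R) : {for 1, continuous f} -> {for 1, continuous g} ->
    {for 1, continuous (fun x => f x * g x)} by exact: continuousM.
  have cV (f : R -> R) : f 1 != 0 -> {for 1, continuous f} ->
    {for 1, continuous (fun x => (f x)^-1)} by exact: continuousV.
  have cc (c : R) : {for 1, continuous (fun _ : R => c)} by exact: cst_continuous.
  have cp (c : R) : 0 < c -> {for 1, continuous (fun s : R => c `^ s)}.
    move=> c0; rewrite /powR gt_eqF//.
    apply: continuous_comp; last exact: continuous_expR.
    exact: mulrr_continuous.
  have cG1 : {for 1, continuous (fun s : R => Gamma (n%:R / 2 + s))}.
    apply: continuous_comp; last by apply: continuous_Gamma; rewrite addr_gt0// divr_gt0.
    by apply: (@continuousD R R^o R (cst (n%:R / 2)) id); [exact: cst_continuous|exact: cvg_id].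
  have cG2 : {for 1, continuous (fun s : R => Gamma (2 - s))}.
    apply: continuous_comp; last by apply: continuous_Gamma; lra.
    by apply: (@continuousB R R^o R (cst 2) id); [exact: cst_continuous|exact: cvg_id].
  rewrite /F; apply: (cM); first apply: (cM); first exact: cc.
    apply: (cM); first exact: cc.
    apply: (cV); first by rewrite mulf_neq0// gt_eqF// powR_gt0.
    by apply: (cM); [exact: cc|exact: cp].
  apply: (cM).
    apply: (cM); last exact: cG1.
    by apply: (cM); [exact: cp|exact: cvg_id].
  apply: (cV); last by apply: (cM); [exact: cc|exact: cG2].
  rewrite mulf_neq0// gt_eqF ?powR_gt0 ?pi_gt0//.
  by apply: Gamma_gt0; lra.
apply: cvg_trans (cvg_at_left_filter cF).
apply: near_eq_cvg; near=> s.
have s1 : s < 1 by near: s; exact: nbhs_left_lt.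
rewrite /F /cKs /frac_const; congr (_ * _).
rewrite (_ : (n%:R + 2 * s) / 2 = n%:R / 2 + s); last by field.
rewrite (_ : 2 - s = 1 - s + 1); last by ring.
rewrite GammaS ?subr_gt0//.
have G0 : Gamma (1 - s) != 0 by rewrite gt_eqF// Gamma_gt0// subr_gt0.
have P0 : (pi : R) `^ (n%:R / 2) != 0 by rewrite gt_eqF// powR_gt0// pi_gt0.
by field; rewrite P0 G0/= subr_eq0 gt_eqF.
Unshelve. all: by end_near. Qed.

End gamma_limit.

(** * Gaussian averages over lines *)

Section line_averages.
Context (R : realType).
Local Notation LC n := (lebesgue_cV R n).
Local Notation mu := (@lebesgue_measure R).
Local Open Scope ereal_scope.

Lemma measurable_powR_norm d (T : measurableType d) (f : T -> R) (b : R) :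
  measurable_fun setT f -> measurable_fun setT (fun t => `|f t| `^ b)%R.
Proof.
move=> mf; apply: (measurableT_comp (measurable_powR b)).
have := measurableT_comp (@normr_measurable R setT) mf; exact.
Qed.

Lemma measurable_powR_enorm d (T : measurableType d) n (f : T -> 'cV[R]_n) (b : R) :
  measurable_fun setT f -> measurable_fun setT (fun t => enorm (f t) `^ b)%R.
Proof.
by move=> mf; apply: (measurableT_comp (measurable_powR b)); exact: measurable_enorm.
Qed.

Lemma integral_even (f : R -> R) :
  measurable_fun setT f -> (forall t, (0 <= f t)%R) -> (forall t, f (- t)%R = f t) ->
  \int[mu]_t (f t)%:E = 2%:E * \int[mu]_t (if (0 < t)%R then f t else 0%R)%:E.
Proof.
move=> mf f0 fN; set g := (fun t : R => (if (0 < t)%R then f t else 0%R)%:E).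
have mg : measurable_fun setT g.
  apply/measurable_EFinP; apply: measurable_fun_ifT => //.
  by apply: measurable_fun_ltr.
have g0 t : 0 <= g t by rewrite lee_fin; case: ifP.
have mgN : measurable_fun setT (fun t : R => g (-1 * t)%R).
  by apply: (measurableT_comp mg); apply: measurable_funM.
transitivity (\int[mu]_t (g t + g (-1 * t)%R)); last first.
  rewrite ge0_integralD// (@ge0_integral_scale R (-1) g)//.
  by rewrite normrN normr1 invr1 mul1e -mule2n mule_natl.
apply: ge0_ae_eq_integral => //.
- exact/measurable_EFinP.
- exact: emeasurable_funD.
- by move=> t _; rewrite lee_fin.
- by move=> t _; rewrite adde_ge0.
- exists [set 0%R]; split; [exact: measurable_set1|exact: lebesgue_measure_set1|].
  move=> t/= h; apply: contrapT => /eqP t0; apply: h => _.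
  rewrite /g mulN1r fN oppr_gt0; case: ltgtP t0 => //= _ _; by rewrite ?adde0 ?add0e.
Qed.

Lemma integral_powRN_tail (a : R) : (0 < a)%R ->
  \int[mu]_(r in `[1%R, +oo[) (r `^ (- (1 + a)))%:E = (a^-1)%:E.
Proof.
move=> a0.
have dF (x : R) : (0 < x)%R -> is_derive x 1%R (fun r : R => - a^-1 * r `^ (- a))%R (x `^ (- (1 + a)))%R.
  move=> x0; have := is_derive1_powR (- a) x0.
  move=> h; have := @is_deriveZ _ _ _ _ (- a^-1)%R _ _ _ h.
  rewrite (_ : x `^ (- (1 + a)) = - a^-1 *: (- a * x `^ (- a - 1)))%R//.
  by rewrite /GRing.scale/= mulrA mulrNN mulVf ?gt_eqF// mul1r opprD addrC.
have cF b x : (0 < x)%R -> {for x, continuous (fun r : R => r `^ b)%R}.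
  move=> x0; apply/differentiable_continuous/derivable1_diffP.
  by apply: derivable_powR; rewrite in_itv/= andbT.
rewrite (@ge0_continuous_FTC2y _ _ (fun r => - a^-1 * r `^ (- a))%R 1%R 0%R).
- by rewrite powR1 mulr1 -EFinB sub0r opprK.
- by move=> x _; exact: powR_ge0.
- apply: continuous_in_subspaceT => x; rewrite inE/= in_itv/= andbT => x1.
  by apply: cF; exact: lt_le_trans x1.
- rewrite -(mulr0 (- a^-1)%R); apply: cvgM; first exact: cvg_cst.
  apply/cvgrPdist_lt => e e0; near=> x.
  have x0 : (0 < x)%R by near: x; exact: nbhs_pinfty_gt.
  have ex : (e^-1 `^ a^-1 < x)%R by near: x; apply: nbhs_pinfty_gt; exact: num_real.
  rewrite sub0r normrN ger0_norm ?powR_ge0// powRN -[ltRHS]invrK.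
  rewrite ltf_pV2 ?posrE ?invr_gt0 ?powR_gt0//.
  rewrite -(powRr1 (_ : 0 <= e^-1)%R) ?invr_ge0 ?(ltW e0)// -(mulVf (lt0r_neq0 a0)) powRrM.
  by apply: gt0_ltr_powR; rewrite ?nnegrE ?powR_ge0 ?(ltW x0).
- by move=> x x1; apply: ex_derive; apply: dF; exact: lt_trans x1.
- apply: cvg_at_right_filter; apply: cvgM; first exact: cvg_cst.
  exact: cF.
- move=> x; rewrite in_itv/= andbT => x1; rewrite derive1E.
  by have [_ ->] := dF _ (lt_trans ltr01 x1).
Unshelve. all: by end_near. Qed.

Variables (m : nat) (s : R).
Hypothesis s01 : (0 < s < 1)%R.
Local Notation n := m.+1.
Local Notation p := (n%:R + 2 * s)%R.

Let s0 : (0 < s)%R. Proof. by case/andP: s01. Qed.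
Let s1 : (s < 1)%R. Proof. by case/andP: s01. Qed.

Definition line_weight (r : R) : R := (`|r| `^ (- (1 + 2 * s)))%R.
Local Notation w := line_weight.

Lemma line_weight0 : w 0 = 0%R.
Proof. by rewrite /w normr0 powR0// oppr_eq0 gt_eqF// addr_gt0// mulr_gt0. Qed.

Lemma measurable_line_weight d (T : measurableType d) (f : T -> R) :
  measurable_fun setT f -> measurable_fun setT (fun t => w (f t)).
Proof. exact: measurable_powR_norm. Qed.

(** The factor between the Gaussian average over lines and the integral over space, namely what
    remains of the r-integral after the substitution r = |y| t. *)
Definition gauss_line : \bar R :=
  \int[mu]_t (`|t| `^ (- n%:R) * w t * expR (- `|t| `^ (- 2)))%:E.
Local Notation gc := gauss_line.

(** The joint weight of y and r once y has been replaced by y / r: the Jacobian |r|^-n, the line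
    weight, and the Gaussian at y / r. *)
Let kern (y : 'cV[R]_n) (r : R) : R :=
  (`|r| `^ (- n%:R) * w r * expR (- (sqnorm y * `|r| `^ (- 2))))%R.

Let kern_ge0 y r : (0 <= kern y r)%R.
Proof. by rewrite /kern !mulr_ge0 ?powR_ge0 ?expR_ge0. Qed.

Let measurable_kern d (T : measurableType d) (f : T -> 'cV[R]_n) (g : T -> R) :
  measurable_fun setT f -> measurable_fun setT g ->
  measurable_fun setT (fun t => kern (f t) (g t)).
Proof.
move=> mf mg; apply: measurable_funM.
  by apply: measurable_funM; [exact: measurable_powR_norm|exact: measurable_line_weight].
apply: measurable_expR_comp; apply: measurable_funN; apply: measurable_funM.
  exact: measurable_sqnorm.
exact: measurable_powR_norm.
Qed.

Lemma gauss_line_ge0 : 0 <= gc.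
Proof. by apply: integral_ge0 => t _; rewrite lee_fin !mulr_ge0 ?powR_ge0 ?expR_ge0. Qed.

Let int_kern y : y != 0%R -> \int[mu]_r (kern y r)%:E = (enorm y `^ (- p))%:E * gc.
Proof.
move=> y0; set a := enorm y; have a0 : (0 < a)%R by rewrite enorm_gt0.
have mk z : measurable_fun setT (fun r : R => (kern z r)%:E).
  by apply/measurable_EFinP; apply: measurable_kern.
have := @ge0_integral_scale R a (fun r => (kern y r)%:E) (lt0r_neq0 a0) (mk y).
move=> /(_ (fun r => kern_ge0 y r)); rewrite gtr0_norm// => E.
have -> : \int[mu]_r (kern y r)%:E = a%:E * \int[mu]_r (kern y (a * r))%:E.
  by rewrite E muleA -EFinM divff ?gt_eqF// mul1e.
have K t : (kern y (a * t))%:E = (a `^ (- n%:R) * a `^ (- (1 + 2 * s)))%R%:E *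
    (`|t| `^ (- n%:R) * w t * expR (- `|t| `^ (- 2)))%R%:E.
  rewrite -EFinM; congr EFin; rewrite /kern /w normrM (gtr0_norm a0).
  have -> : sqnorm y = (a `^ 2)%R by rewrite powR_mulrn ?(ltW a0)// sqr_enorm.
  rewrite !powRM ?(ltW a0)//.
  rewrite (mulrA (a `^ 2)%R) -powRD ?subrr ?powRr0 ?mul1r; last by rewrite (gt_eqF a0) implybT.
  ring.
under eq_integral do rewrite K.
rewrite ge0_integralZlT.
- rewrite muleA -EFinM; congr (_%:E * _).
  rewrite -{1}(powRr1 (ltW a0)) -!powRD ?(gt_eqF a0) ?implybT//.
  by congr (_ `^ _)%R; ring.
- apply/measurable_EFinP; apply: measurable_funM.
    by apply: measurable_funM; [exact: measurable_powR_norm|exact: measurable_line_weight].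
  by apply: measurable_expR_comp; apply: measurable_funN; exact: measurable_powR_norm.
- by move=> t; rewrite lee_fin !mulr_ge0 ?powR_ge0 ?expR_ge0.
- by rewrite lee_fin mulr_ge0 ?powR_ge0.
Qed.

(** After Tonelli and y -> y / r, the remaining integral of the kernel in r is homogeneous in y of
    degree -(n + 2s), hence a constant times |y|^-(n+2s). *)
Lemma gauss_line_average (h : 'cV[R]_n -> R) :
  measurable_fun setT h -> (forall y, (0 <= h y)%R) ->
  \int[LC n]_y ((\int[mu]_r (h (r *: y)%R * w r)%:E) * (gam y)%:E) =
  gc * \int[LC n]_y (h y * enorm y `^ (- p))%:E.
Proof.
move=> mh h0.
have mhy : measurable_fun setT (fun q : 'cV[R]_n * measurableTypeR R =>
    (h (q.2 *: q.1)%R * w q.2 * gam q.1)%:E).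
  apply/measurable_EFinP; apply: measurable_funM; last exact: measurable_gam.
  apply: measurable_funM; last exact: measurable_line_weight.
  by apply: (measurableT_comp mh); apply: measurable_mx_scale.
have h0y (q : 'cV[R]_n * measurableTypeR R) : 0 <= (h (q.2 *: q.1)%R * w q.2 * gam q.1)%:E.
  by rewrite lee_fin !mulr_ge0 ?gam_ge0 ?powR_ge0.
have mhk : measurable_fun setT (fun q : measurableTypeR R * 'cV[R]_n =>
    (h q.2 * kern q.2 q.1)%:E).
  apply/measurable_EFinP; apply: measurable_funM; last exact: measurable_kern.
  exact: (measurableT_comp mh measurable_snd).
have h0k (q : measurableTypeR R * 'cV[R]_n) : 0 <= (h q.2 * kern q.2 q.1)%:E.
  by rewrite lee_fin mulr_ge0.
transitivity (\int[LC n]_y \int[mu]_r (h (r *: y)%R * w r * gam y)%:E).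
  apply: eq_integral => y _; rewrite muleC -ge0_integralZlT.
  - by apply: eq_integral => r _; rewrite -EFinM mulrC.
  - apply/measurable_EFinP; apply: measurable_funM; last exact: measurable_line_weight.
    by apply: (measurableT_comp mh); apply: measurable_mx_scale.
  - by move=> r; rewrite lee_fin mulr_ge0 ?powR_ge0.
  - by rewrite lee_fin gam_ge0.
rewrite (@fubini_tonelli _ _ _ _ R (LC n) mu _ mhy h0y).
transitivity (\int[mu]_r \int[LC n]_y (h y * kern y r)%:E).
  apply: eq_integral => r _; have [->|r0] := eqVneq r 0%R.
    by rewrite !integral0_eq// => y _; rewrite /kern line_weight0 !(mulr0, mul0r).
  pose f (y : 'cV[R]_n) := (h y * w r * gam (r^-1 *: y)%R)%:E.
  have mf : measurable_fun setT f.
    apply/measurable_EFinP; apply: measurable_funM; first exact: measurable_funM.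
    by apply: measurable_gam; apply: measurable_mx_scale.
  have f0 y : 0 <= f y by rewrite lee_fin !mulr_ge0 ?gam_ge0 ?powR_ge0.
  transitivity (\int[LC n]_y f (r *: y)%R).
    by apply: eq_integral => y _; rewrite /f scalerA mulVf// scale1r.
  rewrite (ge0_integral_cV_scale r0 mf f0) -(ge0_integralZlT _ mf f0).
    apply: eq_integral => y _; rewrite /f -EFinM; congr EFin.
    rewrite /kern /gam sqnormZ powRN powR_mulrn// [(`|r| `^ (- 2))%R]powRN powR_mulrn//.
    by rewrite real_normK ?num_real// exprVn (mulrC (sqnorm y)); ring.
  by rewrite lee_fin invr_ge0 exprn_ge0.
rewrite (@fubini_tonelli _ _ _ _ R mu (LC n) _ mhk h0k).
rewrite -ge0_integralZlT; first last.
- exact: gauss_line_ge0.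
- by move=> y; rewrite lee_fin mulr_ge0 ?powR_ge0.
- by apply/measurable_EFinP; apply: measurable_funM => //; exact: measurable_powR_enorm.
have mk (y : 'cV[R]_n) : measurable_fun setT (fun r : R => (kern y r)%:E).
  by apply/measurable_EFinP; apply: measurable_kern.
apply: ge0_eq_integral_neq0.
- exact: (@measurable_fun_fubini_tonelli_G _ _ _ _ R mu _ mhk h0k).
- apply: measurable_funeM; apply/measurable_EFinP; apply: measurable_funM => //.
  exact: measurable_powR_enorm.
- by move=> y; apply: integral_ge0 => r _; rewrite lee_fin mulr_ge0.
- by move=> y; rewrite mule_ge0 ?gauss_line_ge0// lee_fin mulr_ge0 ?powR_ge0.
- move=> y y0; rewrite /fubini_G/=; under eq_integral do rewrite EFinM.
  transitivity ((h y)%:E * \int[mu]_r (kern y r)%:E).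
    by apply: (ge0_integralZlT mu (mk y)) => [r|]; rewrite lee_fin ?kern_ge0.
  by rewrite int_kern// EFinM muleA muleC.
Qed.

(** Near 0 the integrand is r^(1-2s), integrable since s < 1; beyond 1 it is r^-(1+2s), integrable
    since s > 0. *)
Lemma integral_sqr_cutoff :
  \int[mu]_r (Num.min (r ^+ 2) 1 * w r)%:E < +oo.
Proof.
have mmin : measurable_fun setT (fun r : R => Num.min (r ^+ 2) 1)%R.
  by apply: measurable_minr => //; exact: measurable_funX.
have min0 r : (0 <= Num.min (r ^+ 2) 1 :> R)%R by rewrite le_min sqr_ge0 ler01.
rewrite integral_even; first last.
- by move=> t; rewrite sqrrN /w normrN.
- by move=> t; rewrite mulr_ge0 ?powR_ge0.
- by apply: measurable_funM => //; exact: measurable_line_weight.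
pose f1 (r : R) := (if (0 < r <= 1)%R then (2 - 2 * s) * r `^ (2 - 2 * s - 1) else 0)%R%:E.
pose f2 : R -> \bar R := (fun r : R => (r `^ (- (1 + 2 * s)))%R%:E) \_ `[1%R, +oo[.
have m1 : measurable_fun setT f1 by exact: measurable_powR_trunc.
have m2 : measurable_fun setT f2.
  apply: (measurable_restrictT _ (measurable_itv _)).1; apply: measurable_funTS.
  by apply/measurable_EFinP; exact: measurable_powR.
have s2 : (0 < 2 - 2 * s)%R by move: s1; lra.
have p1 r : 0 <= f1 r by rewrite lee_fin; case: ifP => // _; rewrite mulr_ge0 ?powR_ge0 ?(ltW s2).
have p2 r : 0 <= f2 r by apply: erestrict_ge0 => x _; rewrite lee_fin powR_ge0.
have s2V : 0 <= ((2 - 2 * s)^-1)%:E :> \bar R by rewrite lee_fin invr_ge0 ltW.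
apply: (@le_lt_trans _ _ (2%:E * \int[mu]_r (((2 - 2 * s)^-1)%:E * f1 r + f2 r))).
  rewrite lee_pmul2l//; apply: ge0_le_integralT.
  - apply/measurable_EFinP; apply: measurable_fun_ifT => //; first by apply: measurable_fun_ltr.
    by apply: measurable_funM => //; exact: measurable_line_weight.
  - by apply: emeasurable_funD => //; exact: measurable_funeM.
  - by move=> r; rewrite lee_fin; case: ifP => // _; rewrite mulr_ge0 ?powR_ge0.
  - move=> r; case: ifPn => r0; last by rewrite adde_ge0// mule_ge0.
    rewrite /w gtr0_norm//; have [r1|r1] := leP r 1%R.
      apply: (@le_trans _ _ (((2 - 2 * s)^-1)%:E * f1 r)); last by rewrite leeDl.
      rewrite /f1 r0 r1/= -EFinM mulKf ?gt_eqF// lee_fin.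
      have -> : (2 - 2 * s - 1 = 2 - (1 + 2 * s))%R by ring.
      rewrite powRD ?(gt_eqF r0) ?implybT// powR_mulrn ?(ltW r0)//.
      by rewrite ler_wpM2r ?powR_ge0// ge_min lexx.
    apply: (@le_trans _ _ (f2 r)); last by rewrite leeDr// mule_ge0.
    rewrite /f2 patchE mem_setE in_itv/= andbT (ltW r1) lee_fin.
    by rewrite -[leRHS]mul1r ler_wpM2r ?powR_ge0// ge_min lexx orbT.
rewrite ge0_integralD//; first last.
- exact: measurable_funeM.
- by move=> r _; rewrite mule_ge0.
rewrite ge0_integralZlT// integral_powR// powR1 mule1.
by rewrite /f2 -integral_mkcond integral_powRN_tail ?mulr_gt0// -EFinD -EFinM ltry.
Qed.

Lemma gauss_line_gt0 : 0 < gc.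
Proof.
apply: (@integral_gt0 _ _ (2 `^ (- n%:R) * 2 `^ (- (1 + 2 * s)) * expR (- 1))%R).
- apply: measurable_funM.
    by apply: measurable_funM; [exact: measurable_powR_norm|exact: measurable_line_weight].
  by apply: measurable_expR_comp; apply: measurable_funN; exact: measurable_powR_norm.
- by move=> t; rewrite !mulr_ge0 ?powR_ge0 ?expR_ge0.
- by rewrite !mulr_gt0 ?powR_gt0 ?expR_gt0.
- move=> t /andP[t1 t2]; have t0 : (0 < t)%R by lra.
  have P b : (0 <= b)%R -> (2 `^ (- b) <= t `^ (- b))%R.
    move=> b0; rewrite !powRN lef_pV2 ?posrE ?powR_gt0//.
    by apply: ge0_ler_powR; rewrite ?nnegrE// ltW.
  rewrite /w gtr0_norm//; apply: ler_pM; rewrite ?mulr_ge0 ?powR_ge0 ?expR_ge0//.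
    by apply: ler_pM; rewrite ?powR_ge0// P// addr_ge0// mulr_ge0// ltW.
  rewrite ler_expR lerN2 powRN powR_mulrn ?(ltW t0)// invf_le1 ?exprn_gt0//.
  exact: exprn_ege1.
Qed.

Lemma integral_quadratic_gam : \int[LC n]_y ((1 + sqnorm y) * gam y)%:E < +oo.
Proof.
pose c : R := Num.sqrt 2^-1.
have c0 : (0 < c)%R by rewrite sqrtr_gt0 invr_gt0.
have c2 : (c ^+ 2 = 2^-1)%R by rewrite sqr_sqrtr// invr_ge0.
have mg : measurable_fun setT (fun y : 'cV[R]_n => (gam y)%:E).
  by apply/measurable_EFinP; exact: measurable_gam.
have g0 (y : 'cV[R]_n) : 0 <= (gam y)%:E by rewrite lee_fin gam_ge0.
have mgc : measurable_fun setT (fun y : 'cV[R]_n => (gam (c *: y)%R)%:E).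
  by apply/measurable_EFinP; apply: measurable_gam; apply: measurable_mx_scale.
apply: (@le_lt_trans _ _ (\int[LC n]_y (2%:E * (gam (c *: y)%R)%:E))).
  apply: ge0_le_integralT.
  - apply/measurable_EFinP; apply: measurable_funM; last exact: measurable_gam.
    by apply: measurable_funD => //; exact: measurable_sqnorm.
  - exact: measurable_funeM.
  - by move=> y; rewrite lee_fin mulr_ge0 ?gam_ge0// addr_ge0// sqnorm_ge0.
  - move=> y; rewrite -EFinM lee_fin /gam sqnormZ c2.
    have := sqnorm_ge0 y; set q := sqnorm y => q0.
    (* Half of the decay absorbs the polynomial: 1 + q <= 2 (1 + q/2) <= 2 exp(q/2). The constant
       [c] with c^2 = 1/2 turns the other half into a rescaled Gaussian. *)
    have -> : expR (- q) = (expR (- (2^-1 * q)) * expR (- (2^-1 * q)))%R.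
      by rewrite -expRD; congr expR; field.
    rewrite mulrA ler_wpM2r ?expR_ge0// expRN ler_pdivrMr ?expR_gt0//.
    by have := expR_ge1Dx (2^-1 * q); lra.
rewrite (ge0_integralZlT _ mgc)//.
rewrite (ge0_integral_cV_scale (lt0r_neq0 c0) mg g0) integral_gam -!EFinM.
exact: ltry.
Qed.

Lemma gauss_moment_fin : \int[LC n]_y (enorm y `^ (2 * s) * gam y)%:E < +oo.
Proof.
apply: le_lt_trans integral_quadratic_gam; apply: ge0_le_integralT.
- apply/measurable_EFinP; apply: measurable_funM; last exact: measurable_gam.
  exact: measurable_powR_enorm.
- apply/measurable_EFinP; apply: measurable_funM; last exact: measurable_gam.
  by apply: measurable_funD => //; exact: measurable_sqnorm.
- by move=> y; rewrite lee_fin mulr_ge0 ?gam_ge0 ?powR_ge0.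
- move=> y; rewrite lee_fin ler_wpM2r ?gam_ge0// -sqr_enorm.
  have [y1|y1] := leP (enorm y) 1%R.
    rewrite -[leLHS]addr0 lerD ?sqr_ge0// -[leRHS](congr1 (@^~ (2 * s)%R) (@powR1 R)).
    by apply: ge0_ler_powR; rewrite ?nnegrE ?enorm_ge0// mulr_ge0// ltW.
  rewrite -[leLHS]add0r lerD// -powR_mulrn ?enorm_ge0//.
  by apply: ler_powR; [exact: ltW|by move: s1; lra].
Qed.

(** Reduced to one dimension by [gauss_line_average]: as min(r^2 q, 1) <= (1 + q) min(r^2, 1), the
    integral along the line through y is at most a constant times 1 + |y|^2, which the Gaussian
    integrates. Positivity of [gauss_line] then gives the claim. *)
Lemma cutoff_kernel_fin :
  \int[LC n]_y (Num.min (sqnorm y) 1 * enorm y `^ (- p))%:E < +oo.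
Proof.
pose h (y : 'cV[R]_n) : R := Num.min (sqnorm y) 1%R.
have mh : measurable_fun setT h by apply: measurable_minr => //; exact: measurable_sqnorm.
have h0 y : (0 <= h y)%R by rewrite le_min sqnorm_ge0 ler01.
set D := \int[mu]_r (Num.min (r ^+ 2) 1 * w r)%:E.
have mD : measurable_fun setT (fun r : R => (Num.min (r ^+ 2) 1 * w r)%:E).
  apply/measurable_EFinP; apply: measurable_funM; last exact: measurable_line_weight.
  by apply: measurable_minr => //; exact: measurable_funX.
have i0 r : (0 <= Num.min (r ^+ 2) 1 * w r)%R.
  by rewrite mulr_ge0 ?powR_ge0// le_min sqr_ge0 ler01.
have D0 : 0 <= D by apply: integral_ge0 => r _; rewrite lee_fin.
have mq : measurable_fun setT (fun y : 'cV[R]_n => ((1 + sqnorm y) * gam y)%:E).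
  apply/measurable_EFinP; apply: measurable_funM; last exact: measurable_gam.
  by apply: measurable_funD => //; exact: measurable_sqnorm.
have q0 (y : 'cV[R]_n) : 0 <= ((1 + sqnorm y) * gam y)%:E.
  by rewrite lee_fin mulr_ge0 ?gam_ge0// addr_ge0// sqnorm_ge0.
have mhy : measurable_fun setT (fun q : 'cV[R]_n * measurableTypeR R =>
    (h (q.2 *: q.1)%R * w q.2)%:E).
  apply/measurable_EFinP; apply: measurable_funM; last exact: measurable_line_weight.
  by apply: (measurableT_comp mh); apply: measurable_mx_scale.
have h0y (q : 'cV[R]_n * measurableTypeR R) : 0 <= (h (q.2 *: q.1)%R * w q.2)%:E.
  by rewrite lee_fin !mulr_ge0 ?powR_ge0.
have : gc * \int[LC n]_y (h y * enorm y `^ (- p))%:E < +oo.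
  rewrite -gauss_line_average//.
  apply: (@le_lt_trans _ _ (\int[LC n]_y (D * ((1 + sqnorm y) * gam y)%:E))); last first.
    rewrite ge0_integralZlT// lte_mul_pinfty//; last exact: integral_quadratic_gam.
    by rewrite ge0_fin_numE// integral_sqr_cutoff.
  apply: ge0_le_integralT.
  - apply: emeasurable_funM; last by apply/measurable_EFinP; exact: measurable_gam.
    exact: (@measurable_fun_fubini_tonelli_F _ _ _ _ R mu _ mhy h0y).
  - exact: measurable_funeM.
  - move=> y; rewrite mule_ge0 ?lee_fin ?gam_ge0//.
    by apply: integral_ge0 => r _; rewrite lee_fin mulr_ge0 ?powR_ge0.
  - move=> y; rewrite EFinM muleA lee_wpmul2r ?lee_fin ?gam_ge0// muleC -ge0_integralZlT//.
    + apply: ge0_le_integralT.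
      * by have := measurableT_comp mhy (pair1_measurable y); exact.
      * exact: measurable_funeM.
      * by move=> r; rewrite lee_fin mulr_ge0 ?powR_ge0.
      * move=> r; rewrite -EFinM lee_fin mulrA ler_wpM2r ?powR_ge0// /h sqnormZ.
        have := sqnorm_ge0 y; have := sqr_ge0 r.
        set a := (r ^+ 2)%R; set b := sqnorm y => a0 b0.
        by rewrite /Num.min; do 2!case: ifP => ?; nra.
    + by rewrite lee_fin addr_ge0// sqnorm_ge0.
rewrite -/(h _); have := gauss_line_gt0; set X := \int[_]_y _.
have X0 : 0 <= X by apply: integral_ge0 => y _; rewrite lee_fin mulr_ge0 ?powR_ge0.
by case: X X0 => [x| |] // _ g0; rewrite ?ltry// gt0_muley.
Qed.

(** The averaging identity for |y|^(n+2s) exp(-|y|^2): the kernel cancels the power on the right,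
    and on the left the integral along the line through y is |y|^(2s) times twice the radial
    moment. *)
Lemma gauss_moment_line : (0 < m)%N ->
  (\int[LC n]_y (enorm y `^ (2 * s) * gam y)%:E) * (2%:E * gmoment R m) =
  gc * (Num.sqrt pi ^+ n)%:E.
Proof.
move=> m0.
pose h (y : 'cV[R]_n) : R := (enorm y `^ p * gam y)%R.
have mh : measurable_fun setT h.
  by apply: measurable_funM; [exact: measurable_powR_enorm|exact: measurable_gam].
have h0 y : (0 <= h y)%R by rewrite mulr_ge0 ?powR_ge0 ?gam_ge0.
have mg : measurable_fun setT (fun y : 'cV[R]_n => (enorm y `^ (2 * s) * gam y)%:E).
  apply/measurable_EFinP; apply: measurable_funM; last exact: measurable_gam.
  exact: measurable_powR_enorm.
have p0 : (0 < p)%R by rewrite addr_gt0// mulr_gt0.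
have := gauss_line_average mh h0.
have -> : \int[LC n]_y (h y * enorm y `^ (- p))%:E = (Num.sqrt pi ^+ n)%:E.
  rewrite -integral_gam; apply: ge0_eq_integral_neq0.
  - by apply/measurable_EFinP; apply: measurable_funM => //; exact: measurable_powR_enorm.
  - by apply/measurable_EFinP; exact: measurable_gam.
  - by move=> y; rewrite lee_fin mulr_ge0 ?powR_ge0.
  - by move=> y; rewrite lee_fin gam_ge0.
  - move=> y y0; rewrite /h mulrAC -powRD ?subrr ?powRr0 ?mul1r//.
    by rewrite (gt_eqF (_ : 0 < enorm y)%R) ?implybT ?enorm_gt0.
move=> <-; rewrite muleC -ge0_integralZlT//; first last.
- by rewrite mule_ge0// gmoment_ge0.
- by move=> y; rewrite lee_fin mulr_ge0 ?powR_ge0 ?gam_ge0.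
apply: eq_integral => y _; rewrite EFinM muleA; congr (_ * _).
have [->|y0] := eqVneq y 0%R.
  rewrite enorm0 powR0 ?mulf_neq0 ?gt_eqF// mule0 integral0_eq// => r _.
  by rewrite scaler0 /h enorm0 powR0 ?gt_eqF// !mul0r.
set a := enorm y; have a0 : (0 < a)%R by rewrite enorm_gt0.
pose f (t : R) := (`|t| `^ m%:R * expR (- t ^+ 2))%R.
have mf : measurable_fun setT (fun t => (f t)%:E).
  apply/measurable_EFinP; apply: measurable_funM; first exact: measurable_powR_norm.
  by apply: measurable_expR_comp; apply: measurable_funN; exact: measurable_funX.
have f0 t : 0 <= (f t)%:E by rewrite lee_fin mulr_ge0 ?powR_ge0 ?expR_ge0.
have -> : 2%:E * gmoment R m = \int[mu]_t (f t)%:E.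
  rewrite integral_even; last 3 first.
  - exact/measurable_EFinP.
  - by move=> t; rewrite -lee_fin.
  - by move=> t; rewrite /f normrN sqrrN.
  congr (_ * _); apply: eq_integral => t _; rewrite /mom_fun /f; case: ifPn => // t0.
  by rewrite gtr0_norm// powR_mulrn// ltW.
have -> : \int[mu]_t (f t)%:E = a%:E * \int[mu]_t (f (a * t))%:E.
  have := @ge0_integral_scale R a (fun r => (f r)%:E) (lt0r_neq0 a0) mf f0.
  rewrite gtr0_norm// => E.
  by rewrite E muleA -EFinM divff ?gt_eqF// mul1e.
rewrite muleAC -EFinM -ge0_integralZlT; first last.
- by rewrite lee_fin mulr_ge0 ?powR_ge0 ?ltW.
- by move=> t; exact: f0.
- by apply: (measurableT_comp mf); apply: measurable_funM.
apply: eq_integral => r _; rewrite -EFinM /h /f /w /gam; congr EFin.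
rewrite enormZ sqnormZ -/a -sqr_enorm -/a normrM (gtr0_norm a0).
rewrite !powRM ?(ltW a0)// exprMn.
(* At r = 0 both sides vanish because [m] is positive. *)
have -> : (`|r| `^ m%:R = `|r| `^ p * `|r| `^ (- (1 + 2 * s)))%R.
  rewrite -powRD; first by congr (_ `^ _)%R; rewrite -natr1; ring.
  have -> : (p - (1 + 2 * s) = m%:R)%R by rewrite -natr1; ring.
  by rewrite pnatr_eq0 (gtn_eqF m0).
have -> : (a `^ p = a * a `^ (2 * s) * a `^ m%:R)%R.
  rewrite -{2}(powRr1 (ltW a0)) -!powRD ?(gt_eqF a0) ?implybT//.
  by congr (_ `^ _)%R; rewrite -natr1; ring.
by rewrite (mulrC (r ^+ 2)%R); ring.
Qed.

Lemma gauss_line_fin : (0 < m)%N -> gc \is a fin_num.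
Proof.
move=> m0; have := gauss_moment_line m0.
have [Mfin _] := gmoment_sphere R m.
have msf : \int[LC n]_y (enorm y `^ (2 * s) * gam y)%:E \is a fin_num.
  rewrite ge0_fin_numE ?gauss_moment_fin//.
  by apply: integral_ge0 => y _; rewrite lee_fin mulr_ge0 ?powR_ge0 ?gam_ge0.
have P0 : (0 < Num.sqrt (pi : R) ^+ n)%R by rewrite exprn_gt0// sqrtr_gt0 pi_gt0.
have := gauss_line_ge0; case: gc => // _.
rewrite gt0_mulye ?lte_fin// => E.
by have := fin_numM msf (fin_numM (isT : 2%:E \is a fin_num) Mfin); rewrite E.
Qed.

(** The radial moment is eliminated by [sphere_areaE]. Being a multiple of [gauss_line], the moment
    on the error side will lose this factor together with the averaged operators. *)
Lemma gauss_momentE : (0 < m)%N ->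
  fine (\int[LC n]_y (enorm y `^ (2 * s) * gam y)%:E) =
  (fine gc * (sphere_area R n / 2))%R.
Proof.
move=> m0; have := gauss_moment_line m0.
have [Mfin _] := gmoment_sphere R m.
have msf : \int[LC n]_y (enorm y `^ (2 * s) * gam y)%:E \is a fin_num.
  rewrite ge0_fin_numE ?gauss_moment_fin//.
  by apply: integral_ge0 => y _; rewrite lee_fin mulr_ge0 ?powR_ge0 ?gam_ge0.
have M0 : (0 < fine (gmoment R m))%R.
  by rewrite fine_gt0// gmoment_gt0/= -ge0_fin_numE ?gmoment_ge0.
move: msf Mfin M0 (gauss_line_fin m0); rewrite -sphere_areaE.
case: (\int[_]_y _) => // a _; case: (gmoment R m) => // b _ b0; case: gc => // c _ /=.
rewrite -!EFinM => -[] E; apply: (mulIf (lt0r_neq0 b0)).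
by move: E; rewrite /=; lra.
Qed.

End line_averages.

(** * Second differences at a touching point *)

Section second_differences.
Context (R : realType) (n : nat).
Implicit Types (g u psi : 'cV[R]_n -> R) (x y z p : 'cV[R]_n).
Local Notation e i := (delta_mx i 0 : 'cV[R]_n).

Lemma is_derive_line g p (i : 'I_n) (t : R) : derivable g (p + t *: e i) (e i) ->
  is_derive t 1 (fun t => g (p + t *: e i)) ('D_(e i) g (p + t *: e i)).
Proof.
move=> dg.
have E : (fun h : R => h^-1 *: (((fun t => g (p + t *: e i)) \o shift t) (h *: (1 : R)) -
    g (p + t *: e i))) =
  (fun h : R => h^-1 *: ((g \o shift (p + t *: e i)) (h *: e i) - g (p + t *: e i))).
  apply/funext => h; rewrite /shift/=; congr (_ *: (g _ - _)).
  by rewrite (_ : h%:A = h) ?scalerDl 1?addrCA//; exact: mulr1.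
by split; rewrite /derivable /derive E.
Qed.

Lemma partial_mean_value g p (i : 'I_n) (c : R) :
  (forall t, `|t| <= `|c| -> derivable g (p + t *: e i) (e i)) ->
  exists2 t, `|t| <= `|c| & g (p + c *: e i) - g p = 'D_(e i) g (p + t *: e i) * c.
Proof.
move=> dg; pose h t := g (p + t *: e i).
have dh (t : R) : `|t| <= `|c| -> is_derive t 1 h ('D_(e i) g (p + t *: e i)).
  by move=> tc; apply: is_derive_line; exact: dg.
have ch (t : R) : `|t| <= `|c| -> {for t, continuous h}.
  by move=> tc; apply/differentiable_continuous/derivable1_diffP; case: (dh t tc).
have h0 : h 0 = g p by rewrite /h scale0r addr0.
have [c0|c0] := leP 0 c.
  have [||t tc] := @MVT_segment _ h (fun t => 'D_(e i) g (p + t *: e i)) 0 c c0.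
  - by move=> t; rewrite in_itv/= => /andP[t0 tc]; apply: dh; rewrite !ger0_norm// ltW.
  - apply: continuous_in_subspaceT => t; rewrite inE/= in_itv/= => /andP[t0 tc].
    by apply: ch; rewrite !ger0_norm.
  - rewrite subr0 h0 => E; exists t => //.
    by move: tc; rewrite in_itv/= => /andP[t0 tc]; rewrite !ger0_norm.
have [||t tc] := @MVT_segment _ h (fun t => 'D_(e i) g (p + t *: e i)) c 0 (ltW c0).
- move=> t; rewrite in_itv/= => /andP[tc t0]; apply: dh.
  by rewrite !ltr0_norm// lerN2 ltW.
- apply: continuous_in_subspaceT => t; rewrite inE/= in_itv/= => /andP[tc t0].
  by apply: ch; rewrite ler0_norm// ltr0_norm// lerN2.
- rewrite h0 sub0r mulrN => E; exists t; last by rewrite -/(h c) -opprB E opprK.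
  by move: tc; rewrite in_itv/= => /andP[tc t0]; rewrite ler0_norm// ltr0_norm// lerN2.
Qed.

Let trunc y (k : nat) : 'cV[R]_n := \col_i (if (i < k)%N then y i 0 else 0).

Lemma mean_value_sum g x y (d : R) :
  (forall i z, (forall j, `|z j 0| <= d) -> derivable g (x + z) (e i)) ->
  (forall j, `|y j 0| <= d) ->
  exists2 xi : 'I_n -> 'cV[R]_n, (forall i j, `|xi i j 0| <= d) &
    g (x + y) - g x = \sum_i 'D_(e i) g (x + xi i) * y i 0.
Proof.
move=> dg yd.
have d0 (i : 'I_n) : 0 <= d by apply: le_trans (yd i).
have step (i : 'I_n) : exists z : 'cV[R]_n, (forall j, `|z j 0| <= d) /\
    g (x + trunc y i.+1) - g (x + trunc y i) = 'D_(e i) g (x + z) * y i 0.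
  have bz t : `|t| <= `|y i 0| -> forall j, `|(trunc y i + t *: e i) j 0| <= d.
    move=> ty j; rewrite !mxE eqxx andbT; have [->|ji] := eqVneq j i.
      by rewrite ltnn mulr1 add0r (le_trans ty).
    by rewrite mulr0 addr0; case: ifP => _; rewrite ?normr0 ?(d0 i).
  have [t ty E] := @partial_mean_value g (x + trunc y i) i (y i 0)
    (fun t ty => eq_ind _ (fun v => derivable g v (e i)) (dg i _ (bz t ty)) _ (addrA _ _ _)).
  exists (trunc y i + t *: e i); split; first exact: bz.
  rewrite addrA -E; congr (g _ - _).
  rewrite -addrA; congr (_ + _); apply/matrixP => j k; rewrite !mxE (ord1 k) eqxx andbT.
  have [->|ji] := eqVneq j i; first by rewrite ltnn leqnn mulr1 add0r.
  by rewrite mulr0 addr0 ltnS leq_eqVlt (negbTE (_ : val j != val i)).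
have [xi xiP] := choice step.
exists xi => [i j|]; first by have [+ _] := xiP i; apply.
under eq_bigr => i _ do rewrite -(xiP i).2.
rewrite -(big_mkord xpredT (fun i => g (x + trunc y i.+1) - g (x + trunc y i))).
rewrite telescope_sumr//; congr (g _ - g _).
  by congr (_ + _); apply/matrixP => j k; rewrite mxE (ord1 k) ltn_ord.
by rewrite -[LHS]addr0; congr (_ + _); apply/matrixP => j k; rewrite !mxE.
Qed.

Lemma nbhs_box x (P : set 'cV[R]_n) : nbhs x P ->
  exists2 d : R, 0 < d & forall z, (forall j, `|z j 0| < d) -> P (x + z).
Proof.
move=> /nbhs_ballP[d d0 dP]; exists d => // z zd; apply: dP; split => // i j.
by rewrite -ball_normE/= mxE (ord1 j) opprD addNKr normrN.
Qed.

(** The mean value formula is used twice: for [psi] at y and at -y, and then for its partial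
    derivatives at the two intermediate points. Each of these differs from the derivative at x by at
    most n B |y|, whence the constant 2 n^2 B. *)
Lemma second_diff_C2 (N : set 'cV[R]_n) psi x : open N -> N x -> Cclass 2 N psi ->
  exists d C : R, [/\ 0 < d, 0 <= C & forall y, enorm y < d ->
    [/\ N (x + y), N (x - y) & second_diff psi x y <= C * sqnorm y]].
Proof.
move=> oN Nx [_ C2].
have dpsi i y : N y -> derivable psi y (e i) by move=> Ny; have [+ _] := C2 i; apply.
have d2psi i j y : N y -> derivable ('D_(e i) psi) y (e j).
  by move=> Ny; have [_ [_ /(_ j)[+ _]]] := C2 i; apply.
have c2psi i j : {for x, continuous ('D_(e j) ('D_(e i) psi))}.
  by have [_ [_ /(_ j)[_ [+ _]]]] := C2 i; apply.
(* By continuity each second derivative stays near x within 1 of its value at x; the sum bounds them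
   all at once. *)
pose B := \sum_(ij : 'I_n * 'I_n) (`|'D_(e ij.2) ('D_(e ij.1) psi) x| + 1).
have B0 : 0 <= B by apply: sumr_ge0 => ij _; rewrite addr_ge0.
have tri (a b : R) : `|a - b| <= 1 -> `|b| <= `|a| + 1.
  by move=> h; have := ler_distD a b 0; rewrite !subr0 (distrC b); lra.
have nB : \forall z \near x, N z /\
    forall ij : 'I_n * 'I_n, `|'D_(e ij.2) ('D_(e ij.1) psi) z| <= B.
  apply: filterI; first exact: open_nbhs_nbhs.
  apply: (@filter_forall _ ('I_n * 'I_n)%type (fun ij z =>
    `|'D_(e ij.2) ('D_(e ij.1) psi) z| <= B) (nbhs x) _) => -[i j].
  have := c2psi i j; move/cvgrPdist_lt => /(_ 1 ltr01); apply: filterS => z/= h.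
  apply: le_trans (_ : `|'D_(e j) ('D_(e i) psi) x| + 1 <= _).
    by apply: tri; exact: ltW.
  rewrite /B (bigD1 (i, j))//= lerDl.
  by apply: sumr_ge0 => ij _; rewrite addr_ge0.
have [d d0 dP] := nbhs_box nB.
exists d, (2 * n%:R * n%:R * B); split => //; first by rewrite !mulr_ge0.
move=> y yd.
have yj j : `|y j 0| <= enorm y by exact: coord_le_enorm.
have inN z : (forall j, `|z j 0| <= enorm y) -> N (x + z) /\
    forall ij : 'I_n * 'I_n, `|'D_(e ij.2) ('D_(e ij.1) psi) (x + z)| <= B.
  by move=> zy; apply: dP => j; exact: le_lt_trans (zy j) yd.
have yNj j : `|(- y) j 0| <= enorm y by rewrite mxE normrN.
split; [exact: (inN _ yj).1|exact: (inN _ yNj).1|].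
have [xi xiy Exi] := mean_value_sum (fun i z zy => dpsi i _ (inN z zy).1) yj.
have [eta etay Eeta] := mean_value_sum (fun i z zy => dpsi i _ (inN z zy).1) yNj.
have D1 i z : (forall j, `|z j 0| <= enorm y) ->
    `|'D_(e i) psi (x + z) - 'D_(e i) psi x| <= n%:R * B * enorm y.
  move=> zy.
  have [zeta zetay ->] := mean_value_sum (fun j w wy => d2psi i j _ (inN w wy).1) zy.
  apply: le_trans (ler_norm_sum _ _ _) _.
  have -> : n%:R * B * enorm y = \sum_(j < n) B * enorm y.
    by rewrite sumr_const card_ord -mulrA mulr_natl.
  apply: ler_sum => j _; rewrite normrM ler_pM//.
  by have [_ /(_ (i, j))] := inN _ (zetay j).
have -> : second_diff psi x y = (psi (x + y) - psi x) + (psi (x - y) - psi x).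
  by rewrite /second_diff; ring.
rewrite Exi Eeta -big_split/=.
have -> : 2 * n%:R * n%:R * B * sqnorm y = \sum_(i < n) (2 * n%:R * B * enorm y) * enorm y.
  by rewrite sumr_const card_ord -mulr_natl -sqr_enorm; ring.
apply: ler_sum => i _; apply: le_trans (ler_norm _) _.
rewrite mxE mulrN -mulrBl normrM ler_pM//.
have h1 := D1 i _ (xiy i); have h2 := D1 i _ (etay i).
apply: le_trans (ler_distD ('D_(e i) psi x) _ _) _.
rewrite [X in _ + X]distrC; apply: le_trans (lerD h1 h2) _.
by rewrite le_eqVlt; apply/orP; left; apply/eqP; ring.
Qed.

(** Replacing [u] by [psi] increases the values at x + y and x - y and keeps the one at x, so the
    bound is one-sided: only the positive part is controlled. *)
Lemma second_diff_touching u x : C2_touches_from_above u x ->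
  exists d C : R, [/\ 0 < d, 0 <= C & forall y, enorm y < d ->
    second_diff u x y <= C * sqnorm y].
Proof.
move=> [N [psi [oN Nx C2 psix upsi]]].
have [d [C [d0 C0 dP]]] := second_diff_C2 oN Nx C2.
exists d, C; split => // y yd; have [N1 N2 h] := dP _ yd.
apply: le_trans h; rewrite /second_diff psix.
have le z : N z -> u z <= psi z.
  by move=> Nz; have [->|zx] := eqVneq z x; [rewrite psix|apply: ltW; exact: upsi].
by rewrite lerD2r; apply: lerD; exact: le.
Qed.

End second_differences.

Section finite_integrals.
Context d (T : measurableType d) (R : realType) (mu : {measure set T -> \bar R}).
Local Open Scope ereal_scope.
Implicit Types f g : T -> R.

Lemma ge0_dominated_fin f g (C : R) :
  measurable_fun setT f -> measurable_fun setT g ->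
  (forall x, (0 <= f x)%R) -> (forall x, (0 <= g x)%R) -> (0 <= C)%R ->
  (forall x, (f x <= C * g x)%R) ->
  \int[mu]_x (g x)%:E < +oo -> \int[mu]_x (f x)%:E < +oo.
Proof.
move=> /measurable_EFinP mf /measurable_EFinP mg f0 g0 C0 fg goo.
apply: (@le_lt_trans _ _ (\int[mu]_x (C%:E * (g x)%:E))).
  by apply: ge0_le_integralT => //; exact: measurable_funeM.
rewrite (ge0_integralZlT mu mg) => [|x|]; rewrite ?lee_fin//.
by apply: lte_mul_pinfty; rewrite ?lee_fin.
Qed.

Lemma ge0_add_fin f g :
  measurable_fun setT f -> measurable_fun setT g ->
  (forall x, (0 <= f x)%R) -> (forall x, (0 <= g x)%R) ->
  \int[mu]_x (f x)%:E < +oo -> \int[mu]_x (g x)%:E < +oo ->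
  \int[mu]_x (f x + g x)%:E < +oo.
Proof.
move=> /measurable_EFinP mf /measurable_EFinP mg f0 g0 foo goo.
under eq_integral do rewrite EFinD.
rewrite ge0_integralD//; first exact: lte_add_pinfty.
- by move=> x _; rewrite lee_fin.
- by move=> x _; rewrite lee_fin.
Qed.

End finite_integrals.

(** * Integrability against the kernel *)

Section finiteness.
Context (R : realType) (m : nat) (s : R).
Hypothesis s01 : (0 < s < 1)%R.
Local Notation LC n := (lebesgue_cV R n).
Local Notation n := m.+1.
Local Notation p := (n%:R + 2 * s)%R.
Local Open Scope ereal_scope.
Implicit Types (u : 'cV[R]_n -> R) (x y z : 'cV[R]_n).

Let p0 : (0 < p)%R.
Proof. by case/andP: s01 => s0 _; rewrite addr_gt0// mulr_gt0. Qed.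

Lemma measurable_second_diff d (T : measurableType d) u x (f : T -> 'cV[R]_n) :
  measurable_fun setT u -> measurable_fun setT f ->
  measurable_fun setT (fun t => second_diff u x (f t)).
Proof.
move=> mu mf; rewrite /second_diff; apply: measurable_funB => //.
apply: measurable_funD; apply: (measurableT_comp mu).
  exact: measurable_mx_add.
exact: measurable_mx_sub.
Qed.

(** The two points are written as y + x and -1 *: y + x so that the integral rules for shifts and
    dilations apply to them as they stand. *)
Lemma second_diff_max_le u x y :
  (Num.max (second_diff u x y) 0 <=
   2 * `|u x| + (`|u (y + x)| + `|u (-1 *: y + x)|))%R.
Proof.
rewrite scaleN1r (addrC y x) (addrC (- y)%R x) ge_max !addr_ge0 ?mulr_ge0// andbT.
rewrite /second_diff; have := ler_norm (u (x + y)%R); have := ler_norm (u (x - y)%R).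
by have := ler_norm (- u x)%R; rewrite normrN; lra.
Qed.

(** Within distance [d] the touching function gives C |y|^2; beyond it the terms in x + y and x - y
    are controlled by the growth condition and the constant term by the cut-off kernel. *)
Lemma pos_part_kernel_fin u x : L1_omega s u -> C2_touches_from_above u x ->
  \int[LC n]_y (Num.max (second_diff u x y) 0 * enorm y `^ (- p))%:E < +oo.
Proof.
move=> [mu L1] /second_diff_touching[d0 [C [d00 C0 dP]]].
pose d := Num.min d0 1%R.
have d_gt0 : (0 < d)%R by rewrite lt_min d00 ltr01.
have d1 : (d <= 1)%R by rewrite ge_min lexx orbT.
pose g z := (`|u z| / (1 + enorm z `^ p))%R.
have mg : measurable_fun setT g.
  have -> : g = (fun z => `|u z| * (1 + enorm z `^ p) `^ (-1))%R.
    by apply/funext => z; rewrite powR_inv1// addr_ge0 ?powR_ge0.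
  apply: measurable_funM.
    by have := measurableT_comp (@normr_measurable R setT) mu; exact.
  apply: (measurableT_comp (measurable_powR (-1))).
  by apply: measurable_funD => //; exact: measurable_powR_enorm.
have den z : (0 < 1 + enorm z `^ p)%R by rewrite ltr_pwDl// powR_ge0.
have g0 z : (0 <= g z)%R by rewrite divr_ge0// ltW.
(* For |y| >= d and |v| <= |x| + |y| this gives 1 + |v|^p <= C2 |y|^p, since 1 <= |y| / d and |v| <=
   (|x| / d + 1) |y|. *)
pose C2 : R := (d `^ (- p) + (enorm x / d + 1) `^ p)%R.
have C20 : (0 <= C2)%R by rewrite addr_ge0 ?powR_ge0.
(* The first term serves for |y| < d. The second serves beyond: there min(|y|^2, 1) >= d^2, because
   d <= 1. *)
pose C3 : R := (C + 2 * `|u x| / d ^+ 2)%R.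
have ux0 : (0 <= 2 * `|u x| / d ^+ 2)%R.
  by apply: divr_ge0; [exact: mulr_ge0|exact: sqr_ge0].
have C30 : (0 <= C3)%R by rewrite addr_ge0.
pose k y : R := (Num.min (sqnorm y) 1 * enorm y `^ (- p))%R.
have k0 y : (0 <= k y)%R by rewrite mulr_ge0 ?powR_ge0// le_min sqnorm_ge0 ler01.
have mk : measurable_fun setT k.
  apply: measurable_funM; last exact: measurable_powR_enorm.
  by apply: measurable_minr => //; exact: measurable_sqnorm.
have mgp : measurable_fun setT (fun y => g (y + x)%R).
  by apply: (measurableT_comp mg); exact: measurable_cV_shift.
have mgm : measurable_fun setT (fun y => g (-1 *: y + x)%R).
  apply: (measurableT_comp mg); apply: measurable_mx_add => //.
  exact: measurable_mx_scale.
have bound y : (d <= enorm y)%R -> forall v, (enorm v <= enorm x + enorm y)%R ->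
    (`|u v| * enorm y `^ (- p) <= C2 * g v)%R.
  move=> dy v vy; have y0 : (0 < enorm y)%R by exact: lt_le_trans dy.
  rewrite /g mulrCA; apply: ler_wpM2l => //.
  rewrite ler_pdivlMr// powRN mulrC ler_pdivrMr ?powR_gt0// /C2 [leRHS]mulrDl.
  apply: lerD.
    rewrite powRN mulrC ler_pdivlMr ?powR_gt0// mul1r.
    by apply: ge0_ler_powR; rewrite ?nnegrE ?(ltW p0) ?(ltW d_gt0) ?(ltW y0).
  rewrite -powRM ?addr_ge0 ?divr_ge0 ?enorm_ge0 ?(ltW d_gt0)//.
  apply: ge0_ler_powR; rewrite ?nnegrE ?(ltW p0) ?enorm_ge0//.
    by rewrite mulr_ge0 ?addr_ge0 ?divr_ge0 ?enorm_ge0 ?(ltW d_gt0).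
  apply: le_trans vy _; rewrite mulrDl mul1r lerD2r mulrAC.
  by rewrite ler_pdivlMr// ler_wpM2l ?enorm_ge0.
have mF : measurable_fun setT (fun y => Num.max (second_diff u x y) 0 * enorm y `^ (- p))%R.
  apply: measurable_funM; last exact: measurable_powR_enorm.
  by apply: measurable_maxr => //; exact: measurable_second_diff.
have F0 y : (0 <= Num.max (second_diff u x y) 0 * enorm y `^ (- p))%R.
  by rewrite mulr_ge0 ?powR_ge0// le_max lexx orbT.
have FB y : (Num.max (second_diff u x y) 0 * enorm y `^ (- p) <=
    (C3 + C2) * (k y + (g (y + x) + g (-1 *: y + x))))%R.
  have gp := g0 (y + x)%R; have gm := g0 (-1 *: y + x)%R; have ky := k0 y.
  apply: (@le_trans _ _ (C3 * k y + C2 * (g (y + x) + g (-1 *: y + x)))%R); last first.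
    rewrite [leRHS]mulrDl; apply: lerD; apply: ler_wpM2l => //.
      by rewrite lerDl addr_ge0.
    by rewrite lerDr.
    have [yd|yd] := ltP (enorm y) d.
      have yd0 : (enorm y < d0)%R by apply: lt_le_trans yd _; rewrite ge_min lexx.
      have y1 : (sqnorm y <= 1)%R.
        by rewrite -sqr_enorm expr_le1 ?enorm_ge0// (le_trans (ltW yd)).
      apply: (@le_trans _ _ (C3 * k y)%R); last first.
        by rewrite lerDl mulr_ge0// addr_ge0.
      rewrite /k mulrA ler_wpM2r ?powR_ge0// min_l// ge_max.
      rewrite mulr_ge0 ?sqnorm_ge0// andbT; apply: le_trans (dP _ yd0) _.
      by apply: ler_wpM2r; rewrite ?sqnorm_ge0// lerDl.
    have kd : (2 * `|u x| * enorm y `^ (- p) <= C3 * k y)%R.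
      rewrite /k mulrA ler_wpM2r ?powR_ge0//.
      apply: (@le_trans _ _ (2 * `|u x| / d ^+ 2 * d ^+ 2)%R).
        by rewrite divfK// gt_eqF// exprn_gt0.
      apply: ler_pM => //; [exact: sqr_ge0|by rewrite lerDr|].
      rewrite le_min -sqr_enorm lerXn2r ?nnegrE ?enorm_ge0 ?(ltW d_gt0)//=.
      by rewrite expr_le1 ?(ltW d_gt0).
    have bp := bound _ yd (y + x)%R; have bm := bound _ yd (-1 *: y + x)%R.
    have {}bp := bp ltac:(by rewrite addrC; exact: ler_enormD).
    have {}bm := bm ltac:(by rewrite addrC scaleN1r -(enormN y); exact: ler_enormD).
    apply: (@le_trans _ _ (2 * `|u x| * enorm y `^ (- p) +
       (`|u (y + x)| * enorm y `^ (- p) + `|u (-1 *: y + x)| * enorm y `^ (- p)))%R).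
      by rewrite -!mulrDl; apply: ler_wpM2r; [exact: powR_ge0|exact: second_diff_max_le].
    apply: lerD; first exact: kd.
    by rewrite mulrDr; apply: lerD; [exact: bp|exact: bm].
have mgpm : measurable_fun setT (fun y => (g (y + x) + g (-1 *: y + x))%R).
  by apply: measurable_funD; [exact: mgp|exact: mgm].
have gpm0 y : (0 <= g (y + x) + g (-1 *: y + x))%R by apply: addr_ge0; exact: g0.
have mkg : measurable_fun setT (fun y => (k y + (g (y + x) + g (-1 *: y + x)))%R).
  by apply: measurable_funD; [exact: mk|exact: mgpm].
have kg0 y : (0 <= k y + (g (y + x) + g (-1 *: y + x)))%R.
  by apply: addr_ge0; [exact: k0|exact: gpm0].
have gE0 z : 0 <= (g z)%:E by rewrite lee_fin.
have /measurable_EFinP mgE := mg.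
have goo : \int[LC n]_y (g (y + x)%R)%:E < +oo.
  by rewrite (ge0_integral_cV_shift x mgE gE0); exact: L1.
apply: (ge0_dominated_fin mF mkg F0 kg0 (addr_ge0 C30 C20) FB).
apply: (ge0_add_fin mk mgpm k0 gpm0); first exact: cutoff_kernel_fin.
apply: (ge0_add_fin mgp mgm (fun=> g0 _) (fun=> g0 _) goo).
have /measurable_EFinP mgs := mgp.
have n1 : (-1 != 0 :> R)%R by rewrite oppr_eq0 oner_eq0.
rewrite (ge0_integral_cV_scale n1 mgs (fun=> gE0 _)) normrN normr1 expr1n invr1 mul1e.
exact: goo.
Qed.

(** After the change of variables the kernel is |Q^-1 z|^-p, and |z| <= C |Q^-1 z| bounds it by C^p
    |z|^-p. *)
Lemma ge0_kernel_linear_fin (h : 'cV[R]_n -> R) (Q : 'M[R]_n) : Q \in unitmx ->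
  measurable_fun setT h -> (forall y, (0 <= h y)%R) ->
  \int[LC n]_y (h y * enorm y `^ (- p))%:E < +oo ->
  \int[LC n]_y (h (Q *m y)%R * enorm y `^ (- p))%:E < +oo.
Proof.
move=> Qu mh h0 hoo.
have [c c0 cP] := ge0_integral_linear Qu.
have [C C0 CP] := enorm_mulmx_le Q.
pose F (z : 'cV[R]_n) := (h z * enorm (invmx Q *m z)%R `^ (- p))%:E.
have mF : measurable_fun setT F.
  apply/measurable_EFinP; apply: measurable_funM => //; apply: measurable_powR_enorm.
  exact: measurable_mx_mul.
have F0 z : 0 <= F z by rewrite lee_fin mulr_ge0 ?powR_ge0.
have -> : \int[LC n]_y (h (Q *m y)%R * enorm y `^ (- p))%:E = \int[LC n]_y F (Q *m y)%R.
  by apply: eq_integral => y _; rewrite /F mulKmx.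
have Foo : \int[LC n]_z F z < +oo; last first.
  by rewrite (cP _ mF F0); apply: lte_mul_pinfty; rewrite ?lee_fin ?(ltW c0).
have mh' : measurable_fun setT (fun y => h y * enorm y `^ (- p))%R.
  by apply: measurable_funM => //; exact: measurable_powR_enorm.
have /measurable_EFinP mFr := mF.
apply: (ge0_dominated_fin (C := C `^ p) mFr mh' _ _ _ _ hoo) => [z|z||z].
- by rewrite mulr_ge0 ?powR_ge0.
- by rewrite mulr_ge0 ?powR_ge0.
- exact: powR_ge0.
- rewrite mulrCA; apply: ler_wpM2l => //.
  have [->|z0] := eqVneq z 0%R.
    by rewrite mulmx0 enorm0 powR0 ?oppr_eq0 ?gt_eqF// mulr0.
  have zQ : z = Q *m (invmx Q *m z) by rewrite mulKVmx.
  have w0 : (0 < enorm (invmx Q *m z))%R.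
    by rewrite enorm_gt0; apply: contra_neq z0 => w0; rewrite zQ w0 mulmx0.
  rewrite !powRN ler_pdivlMr ?powR_gt0 ?enorm_gt0// mulrC ler_pdivrMr ?powR_gt0//.
  rewrite -powRM ?enorm_ge0 ?(ltW C0)//; apply: ge0_ler_powR.
  - exact: ltW.
  - by rewrite nnegrE enorm_ge0.
  - by rewrite nnegrE mulr_ge0 ?enorm_ge0 ?(ltW C0).
  - by rewrite {1}zQ; exact: CP.
Qed.

End finiteness.

(** * Gaussian moments *)

Section trace_moments.
Context (R : realType) (m : nat) (s : R).
Hypothesis s01 : (0 < s < 1)%R.
Local Notation LC n := (lebesgue_cV R n).
Local Notation n := m.+1.
Local Open Scope ereal_scope.

Let s0 : (0 < s)%R. Proof. by case/andP: s01. Qed.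
Let s1 : (s < 1)%R. Proof. by case/andP: s01. Qed.

Definition gauss_moment : \bar R := \int[LC n]_z (enorm z `^ (2 * s) * gam z)%:E.
Local Notation ms := gauss_moment.

(** The exponent 2s - 2 makes |L z|^2 w(z), up to the Gaussian, homogeneous of degree 2s like |L
    z|^(2s), so that the tangent line bound leads back to the same moment. *)
Let w (z : 'cV[R]_n) : R := (enorm z `^ (2 * s - 2) * gam z)%R.

Let w_ge0 z : (0 <= w z)%R. Proof. by rewrite mulr_ge0 ?powR_ge0 ?gam_ge0. Qed.

Let measurable_w : measurable_fun setT w.
Proof. by apply: measurable_funM; [exact: measurable_powR_enorm|exact: measurable_gam]. Qed.

Let w_rot (B : 'M[R]_n) z : (B^T *m B = 1%:M)%R -> w (B *m z) = w z.
Proof.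
by move=> BTB; rewrite /w gam_orthogonal// enorm_orthogonal.
Qed.

Let kap : \bar R := \int[LC n]_z (dot (e0 R m) z ^+ 2 * w z)%:E.

Lemma measurable_dot_sqr (v : 'cV[R]_n) :
  measurable_fun setT (fun z => dot v z ^+ 2 * w z)%R.
Proof.
apply: measurable_funM => //; apply: measurable_funX.
rewrite (_ : dot v = fun z => (v^T *m z) 0 0)%R//.
exact: (measurableT_comp (@measurable_coord R 1 0%R) (measurable_cV_mul _)).
Qed.

(** A rotation takes v / |v| to the first basis vector, and [w] is rotation invariant. *)
Let directional (v : 'cV[R]_n) :
  \int[LC n]_z (dot v z ^+ 2 * w z)%:E = (sqnorm v)%:E * kap.
Proof.
have mE (u : 'cV[R]_n) : measurable_fun setT (fun z => (dot u z ^+ 2 * w z)%:E).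
  by apply/measurable_EFinP; exact: measurable_dot_sqr.
have E0 (u z : 'cV[R]_n) : 0 <= (dot u z ^+ 2 * w z)%:E by rewrite lee_fin mulr_ge0 ?sqr_ge0.
have [->|v0] := eqVneq v 0%R.
  rewrite sqnorm0 mul0e integral0_eq// => z _.
  by rewrite dotE big1 ?expr0n ?mul0r// => i _; rewrite mxE mul0r.
have vn : (0 < enorm v)%R by rewrite enorm_gt0.
pose v1 := ((enorm v)^-1 *: v)%R.
have v1n : enorm v1 = 1%R by rewrite enormZ ger0_norm ?invr_ge0 ?(ltW vn)// mulVf ?gt_eqF.
have [B BTB Be] := householder (@enorm_e0 R m) v1n.
rewrite -(ge0_integral_orthogonal BTB (mE v) (E0 v)) -ge0_integralZlT//; last first.
  by rewrite lee_fin sqnorm_ge0.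
apply: eq_integral => z _; rewrite -EFinM w_rot//; congr EFin.
have -> : dot v (B *m z) = (enorm v * dot (e0 R m) z)%R.
  have -> : v = (enorm v *: v1)%R by rewrite scalerA mulfV ?scale1r ?gt_eqF.
  rewrite -Be dotZl dotMl mulmxA BTB mul1mx enormZ Be.
  by rewrite v1n mulr1 ger0_norm ?ltW.
by rewrite (exprMn _ (enorm v)) (sqr_enorm v) -mulrA.
Qed.

Let quadratic (L : 'M[R]_n) :
  \int[LC n]_z (sqnorm (L *m z) * w z)%:E = (\tr (L *m L^T))%:E * kap.
Proof.
have kap0 : 0 <= kap by apply: integral_ge0 => z _; rewrite lee_fin mulr_ge0 ?sqr_ge0.
have E z : (sqnorm (L *m z) * w z)%:E = \sum_(i < n) (dot (row i L)^T z ^+ 2 * w z)%:E.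
  rewrite sumEFin mulr_suml; congr EFin; apply: eq_bigr => i _.
  rewrite dotE mxE; congr (_ ^+ 2 * _)%R; apply: eq_bigr => j _.
  by rewrite !mxE.
under eq_integral do rewrite E.
rewrite ge0_integral_sum//; first last.
- by move=> i z _; rewrite lee_fin mulr_ge0 ?sqr_ge0.
- by move=> i; apply/measurable_EFinP; exact: measurable_dot_sqr.
under eq_bigr do rewrite directional.
rewrite -ge0_sume_distrl => [|i _]; last by rewrite lee_fin sqnorm_ge0.
rewrite sumEFin /mxtrace; congr (_%:E * _); apply: eq_bigr => i _.
by rewrite mxE; apply: eq_bigr => j _; rewrite !mxE expr2.
Qed.

Lemma gauss_moment_fin_num : ms \is a fin_num.
Proof.
rewrite ge0_fin_numE ?gauss_moment_fin//.
by apply: integral_ge0 => y _; rewrite lee_fin mulr_ge0 ?powR_ge0 ?gam_ge0.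
Qed.

Let kapE : kap = (fine ms / n%:R)%:E.
Proof.
have := quadratic 1%:M.
have -> : \int[LC n]_z (sqnorm (1%:M *m z) * w z)%:E = ms.
  apply: eq_integral => z _; rewrite mul1mx mulrA -sqr_enorm; congr (_ * gam z)%:E.
  rewrite -powR_mulrn ?enorm_ge0// -powRD; last first.
    by rewrite addrC subrK gt_eqF// mulr_gt0.
  by congr (_ `^ _)%R; ring.
rewrite trmx1 mulmx1 mxtrace1 -(fineK gauss_moment_fin_num).
have : 0 <= kap by apply: integral_ge0 => z _; rewrite lee_fin mulr_ge0 ?sqr_ge0.
have n0 : (0 < n%:R :> R)%R by rewrite ltr0n.
case: kap => [k _|_|//]; last by rewrite gt0_muley ?lte_fin.
by rewrite -EFinM => -[->]; rewrite mulrAC mulfV ?gt_eqF// mul1r.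
Qed.

(** Concavity of t^s is used pointwise, as the tangent bound at a |z|^2 with a = tr(L L^T) / n.
    Integration gives (1 - s) a^s + s a^(s-1) a = a^s times the moment, since by rotation invariance
    the average of |L z|^2 w(z) is [a] times that of |z|^2 w(z). *)
Lemma gauss_moment_linear (L : 'M[R]_n) : (0 < \tr (L *m L^T))%R ->
  \int[LC n]_z (enorm (L *m z) `^ (2 * s) * gam z)%:E <=
  ((\tr (L *m L^T) / n%:R) `^ s)%:E * ms.
Proof.
set t := \tr _ => t0; pose a := (t / n%:R)%R.
have a0 : (0 < a)%R by rewrite divr_gt0// ltr0n.
have tangent z : (enorm (L *m z) `^ (2 * s) * gam z <=
    (1 - s) * a `^ s * (enorm z `^ (2 * s) * gam z) +
    s * a `^ (s - 1) * (sqnorm (L *m z) * w z))%R.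
  rewrite /w !mulrA -mulrDl ler_wpM2r ?gam_ge0//.
  have [->|z0] := eqVneq z 0%R.
    rewrite mulmx0 enorm0 powR0 ?mulf_neq0 ?gt_eqF// mulr0 add0r.
    by rewrite !mulr_ge0 ?powR_ge0 ?sqnorm_ge0 ?(ltW s0).
  have zn : (0 < enorm z)%R by rewrite enorm_gt0.
  set X := sqnorm (L *m z); have X0 : (0 <= X)%R by exact: sqnorm_ge0.
  have -> : (enorm (L *m z) `^ (2 * s) = X `^ s)%R.
    by rewrite powRrM powR_mulrn ?enorm_ge0// sqr_enorm.
  pose Y := (a * enorm z ^+ 2)%R; have Y0 : (0 < Y)%R by rewrite mulr_gt0// exprn_gt0.
  have YE : (Y `^ (1 - s) = a `^ (1 - s) * enorm z `^ (2 - 2 * s))%R.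
    rewrite powRM ?(ltW a0) ?sqr_ge0// -powR_mulrn ?(ltW zn)// -powRrM.
    by congr (_ * _ `^ _)%R; ring.
  (* The tangent bound in multiplicative form, from Young's inequality with exponents 1/s and
     1/(1-s). *)
  have young : (X `^ s * Y `^ (1 - s) <= s * X + (1 - s) * Y)%R.
    have s10 : (0 < 1 - s)%R by rewrite subr_gt0.
    have := @conjugate_powR R (X `^ s)%R (Y `^ (1 - s))%R s^-1%R (1 - s)^-1%R.
    rewrite !invrK -!powRrM !mulfV ?gt_eqF// !powRr1 ?(ltW Y0)//.
    rewrite (mulrC s) (mulrC (1 - s)%R); apply; rewrite ?powR_ge0 ?invr_gt0//.
    by rewrite addrC subrK.
  have Yp : (0 < Y `^ (1 - s))%R by rewrite powR_gt0.
  rewrite -(ler_pM2r Yp); apply: le_trans young _.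
  have A1 : (a `^ s * a `^ (1 - s) = a)%R.
    by rewrite -powRD ?(gt_eqF a0) ?implybT// addrC subrK powRr1// ltW.
  have A2 : (a `^ (s - 1) * a `^ (1 - s) = 1)%R.
    by rewrite -powRD ?(gt_eqF a0) ?implybT// -opprB addNr powRr0.
  have Z1 : (enorm z `^ (2 * s) * enorm z `^ (2 - 2 * s) = enorm z ^+ 2)%R.
    by rewrite -powRD ?(gt_eqF zn) ?implybT// addrC subrK powR_mulrn// ltW.
  have Z2 : (enorm z `^ (2 * s - 2) * enorm z `^ (2 - 2 * s) = 1)%R.
    by rewrite -powRD ?(gt_eqF zn) ?implybT// -opprB addNr powRr0.
  rewrite YE le_eqVlt; apply/orP; left; apply/eqP.
  transitivity ((1 - s) * (a `^ s * a `^ (1 - s)) *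
      (enorm z `^ (2 * s) * enorm z `^ (2 - 2 * s)) +
    s * (a `^ (s - 1) * a `^ (1 - s)) * X *
      (enorm z `^ (2 * s - 2) * enorm z `^ (2 - 2 * s)))%R; last by ring.
  by rewrite A1 A2 Z1 Z2 /Y; ring.
have mL : measurable_fun setT (fun z : 'cV[R]_n => L *m z) by exact: measurable_cV_mul.
have mf : measurable_fun setT (fun z => enorm (L *m z) `^ (2 * s) * gam z)%R.
  by apply: measurable_funM; [exact: measurable_powR_enorm|exact: measurable_gam].
have mg : measurable_fun setT (fun z : 'cV[R]_n => (enorm z `^ (2 * s) * gam z)%:E).
  apply/measurable_EFinP.
  by apply: measurable_funM; [exact: measurable_powR_enorm|exact: measurable_gam].
have mh : measurable_fun setT (fun z => (sqnorm (L *m z) * w z)%:E).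
  apply/measurable_EFinP; apply: measurable_funM; last exact: measurable_w.
  exact: measurable_sqnorm.
have c1 : 0 <= ((1 - s) * a `^ s)%:E by rewrite lee_fin mulr_ge0 ?powR_ge0// subr_ge0 ltW.
have c2 : 0 <= (s * a `^ (s - 1))%:E by rewrite lee_fin mulr_ge0 ?powR_ge0 ?ltW.
have g0 (z : 'cV[R]_n) : 0 <= (enorm z `^ (2 * s) * gam z)%:E.
  by rewrite lee_fin mulr_ge0 ?powR_ge0 ?gam_ge0.
have h0 z : 0 <= (sqnorm (L *m z) * w z)%:E by rewrite lee_fin mulr_ge0 ?sqnorm_ge0.
apply: (@le_trans _ _ (\int[LC n]_z
   (((1 - s) * a `^ s)%:E * (enorm z `^ (2 * s) * gam z)%:E +
    (s * a `^ (s - 1))%:E * (sqnorm (L *m z) * w z)%:E))).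
  apply: ge0_le_integralT.
  - exact/measurable_EFinP.
  - by apply: emeasurable_funD; exact: measurable_funeM.
  - by move=> z; rewrite lee_fin mulr_ge0 ?powR_ge0 ?gam_ge0.
  - by move=> z; rewrite -!EFinM -EFinD lee_fin; exact: tangent.
rewrite ge0_integralD//; first last.
- exact: measurable_funeM.
- by move=> z _; apply: mule_ge0.
- exact: measurable_funeM.
- by move=> z _; apply: mule_ge0.
rewrite (ge0_integralZlT _ mg g0 c1) (ge0_integralZlT _ mh h0 c2) quadratic kapE -/ms.
rewrite -(fineK gauss_moment_fin_num) -!EFinM -EFinD lee_fin -/t.
rewrite le_eqVlt; apply/orP; left; apply/eqP.
rewrite /= -/a; have -> : (t * (fine ms / n%:R) = a * fine ms)%R by rewrite /a; ring.
have -> : (a `^ s = a * a `^ (s - 1))%R by rewrite mulr_powRB1 ?(ltW a0).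
by ring.
Qed.

End trace_moments.

(** * The comparison of the two operators *)

Section gaussian_comparison.
Context (R : realType) (n : nat).
Local Notation LC := (lebesgue_cV R n).
Local Notation V := ('cV[R]_n).
Local Open Scope ereal_scope.

(** Invertible matrices pull null sets back to null sets, applied to sections in one variable and
    then to the other variable. *)
Lemma ae_linear_pair (A B : 'M[R]_n) (P : V * V -> Prop) :
  A \in unitmx -> B \in unitmx ->
  {ae (LC \x LC), forall q, P q} ->
  {ae (LC \x LC), forall q, P (A *m q.1, B *m q.2)%R}.
Proof.
move=> Au Bu [N [mN N0 PN]].
have mAB : measurable_fun setT (fun q : V * V => (A *m q.1, B *m q.2)%R).
  apply/measurable_fun_pairP; split; apply: measurable_mx_mul;
    [exact: measurable_fst|exact: measurable_snd].
exists ((fun q : V * V => (A *m q.1, B *m q.2)%R) @^-1` N); split.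
- exact: preimage_measurable.
- have [cB cB0 cBP] := lebesgue_cV_linear Bu.
  have [cA cA0 cAP] := ge0_integral_linear Au.
  have mX : measurable_fun setT (LC \o xsection N) by exact: measurable_fun_xsection.
  transitivity (\int[LC]_y (cB%:E * (LC \o xsection N) (A *m y)%R)).
    apply: eq_integral => y _ /=.
    rewrite -cBP; last exact: measurable_xsection.
    by congr (LC _); apply/seteqP; split=> z/=; rewrite /xsection/= !inE.
  rewrite ge0_integralZlT; first last.
  + by rewrite lee_fin ltW.
  + by move=> y; exact: measure_ge0.
  + by apply: (measurableT_comp mX); exact: measurable_cV_mul.
  rewrite (cAP _ mX (fun=> measure_ge0 _ _)).
  have -> : \int[LC]_y (LC \o xsection N) y = 0 by exact: N0.
  by rewrite !mule0.
- by move=> q/= h; apply: PN => /= h'; apply: h.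
Qed.

Let G (q : V * V) : \bar R := (gam q.1 * gam q.2)%:E.

Let G_ge0 q : 0 <= G q. Proof. by rewrite lee_fin mulr_ge0 ?gam_ge0. Qed.

Let mG : measurable_fun setT G.
Proof.
apply/measurable_EFinP; apply: measurable_funM; apply: measurable_gam;
  [exact: measurable_fst|exact: measurable_snd].
Qed.

Let P : R := (Num.sqrt pi ^+ n)%R.

Let P_gt0 : (0 < P)%R. Proof. by rewrite exprn_gt0// sqrtr_gt0 pi_gt0. Qed.

Let measurable_affine (A L : 'M[R]_n) :
  measurable_fun setT (fun q : V * V => A *m q.1 + L *m q.2)%R.
Proof.
by apply: measurable_mx_add; apply: measurable_mx_mul;
  [exact: measurable_fst|exact: measurable_snd].
Qed.

Let convolution (A1 L A2 : 'M[R]_n) (J : V -> \bar R) :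
  A1 \in unitmx -> A2 \in unitmx -> (A1 *m A1^T + L *m L^T = A2 *m A2^T)%R ->
  measurable_fun setT J -> (forall y, 0 <= J y) ->
  \int[LC \x LC]_q (J (A1 *m q.1 + L *m q.2)%R * G q) =
  P%:E * \int[LC]_y (J (A2 *m y)%R * (gam y)%:E).
Proof.
move=> A1u A2u AE mJ J0.
rewrite (@fubini_tonelli2 _ _ _ _ R LC LC).
- rewrite /fubini_G/= /G/=; exact: gauss_convolution.
- by apply: emeasurable_funM => //; exact: (measurableT_comp mJ).
- by move=> q; apply: mule_ge0.
Qed.

Let marginal (k : V -> \bar R) :
  measurable_fun setT k -> (forall y, 0 <= k y) ->
  \int[LC \x LC]_q (k q.2 * G q) = P%:E * \int[LC]_y (k y * (gam y)%:E).
Proof.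
move=> mk k0.
have mg : measurable_fun setT (fun y : V => (gam y)%:E).
  by apply/measurable_EFinP; exact: measurable_gam.
have g0 (y : V) : 0 <= (gam y)%:E by rewrite lee_fin gam_ge0.
have mkg : measurable_fun setT (fun y : V => k y * (gam y)%:E) by exact: emeasurable_funM.
have kg0 (y : V) : 0 <= k y * (gam y)%:E by exact: mule_ge0.
rewrite (@fubini_tonelli2 _ _ _ _ R LC LC).
- rewrite -(ge0_integralZlT _ mkg kg0) ?lee_fin ?(ltW P_gt0)//.
  apply: eq_integral => z _; rewrite /fubini_G/= /G/= muleC -integral_gam.
  rewrite -(ge0_integralZlT _ mg g0 (kg0 z)); apply: eq_integral => y _.
  by rewrite EFinM muleA muleAC -muleA muleC.
- by apply: emeasurable_funM => //; apply: (measurableT_comp mk).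
- by move=> q; apply: mule_ge0.
Qed.

(** The inequality is multiplied by both Gaussians and integrated term by term in [0, +oo].
    [gauss_convolution] with L and -L turns the shifted terms into averages for [A2], and with 0 it
    leaves the central one as an average for [A1]; the common factor pi^(n/2) cancels. *)
Lemma gauss_comparison (A1 L A2 : 'M[R]_n) (Jp Jm k : V -> \bar R) :
  A1 \in unitmx -> A2 \in unitmx -> (A1 *m A1^T + L *m L^T = A2 *m A2^T)%R ->
  measurable_fun setT Jp -> measurable_fun setT Jm -> measurable_fun setT k ->
  (forall y, 0 <= Jp y) -> (forall y, 0 <= Jm y) -> (forall y, 0 <= k y) ->
  {ae (LC \x LC), forall q : V * V,
     Jp (A1 *m q.1 + L *m q.2)%R + Jp (A1 *m q.1 - L *m q.2)%R + 2%:E * Jm (A1 *m q.1)%R <=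
     Jm (A1 *m q.1 + L *m q.2)%R + Jm (A1 *m q.1 - L *m q.2)%R + 2%:E * Jp (A1 *m q.1)%R
     + k q.2} ->
  2%:E * \int[LC]_y (Jp (A2 *m y)%R * (gam y)%:E) +
  2%:E * \int[LC]_y (Jm (A1 *m y)%R * (gam y)%:E) <=
  2%:E * \int[LC]_y (Jm (A2 *m y)%R * (gam y)%:E) +
  2%:E * \int[LC]_y (Jp (A1 *m y)%R * (gam y)%:E) + \int[LC]_y (k y * (gam y)%:E).
Proof.
move=> A1u A2u AE mJp mJm mk Jp0 Jm0 k0 H.
pose T (J : V -> \bar R) (M : 'M[R]_n) (q : V * V) := J (A1 *m q.1 + M *m q.2)%R * G q.
have mT J M : measurable_fun setT J -> measurable_fun setT (T J M).
  by move=> mJ; apply: emeasurable_funM => //; exact: (measurableT_comp mJ).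
have T0 J M q : (forall y, 0 <= J y) -> 0 <= T J M q by move=> J0; apply: mule_ge0.
have AEN : (A1 *m A1^T + (- L) *m (- L)^T = A2 *m A2^T)%R.
  by rewrite linearN/= mulNmx mulmxN opprK.
have AE0 : (A1 *m A1^T + 0 *m (0 : 'M[R]_n)^T = A1 *m A1^T)%R by rewrite mul0mx addr0.
have sumE (J J' : V -> \bar R) : measurable_fun setT J -> measurable_fun setT J' ->
    (forall y, 0 <= J y) -> (forall y, 0 <= J' y) ->
    \int[LC \x LC]_q (T J L q + T J (- L)%R q + 2%:E * T J' 0%R q) =
    P%:E * (2%:E * \int[LC]_y (J (A2 *m y)%R * (gam y)%:E) +
     2%:E * \int[LC]_y (J' (A1 *m y)%R * (gam y)%:E)).
  move=> mJ mJ' J0 J'0.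
  rewrite ge0_integralD//; first last.
  - by apply: measurable_funeM; exact: mT.
  - by move=> q _; apply: mule_ge0 => //; exact: T0.
  - by apply: emeasurable_funD; exact: mT.
  - by move=> q _; apply: adde_ge0; exact: T0.
  rewrite ge0_integralD//; first last.
  - exact: mT.
  - by move=> q _; exact: T0.
  - exact: mT.
  - by move=> q _; exact: T0.
  rewrite ge0_integralZlT; first last.
  - by rewrite lee_fin.
  - by move=> q; exact: T0.
  - exact: mT.
  rewrite (convolution A1u A2u AE mJ J0) (convolution A1u A2u AEN mJ J0).
  rewrite (convolution A1u A1u AE0 mJ' J'0).
  have I0 : 0 <= \int[LC]_y (J (A2 *m y)%R * (gam y)%:E).
    by apply: integral_ge0 => y _; rewrite mule_ge0 ?lee_fin ?gam_ge0.
  have I'0 : 0 <= \int[LC]_y (J' (A1 *m y)%R * (gam y)%:E).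
    by apply: integral_ge0 => y _; rewrite mule_ge0 ?lee_fin ?gam_ge0.
  move: I0 I'0; move: (\int[_]_y _) (\int[_]_y _) => b a a0 b0.
  rewrite (@ge0_muleDr _ P%:E (2%:E * a) (2%:E * b)); [|exact: mule_ge0|exact: mule_ge0].
  by rewrite (muleCA P%:E 2%:E a) (muleCA P%:E 2%:E b) -mule2n -mule_natl.
have P0 : (0 < P%:E)%E by rewrite lte_fin.
rewrite -(@lee_pmul2l _ P%:E)//.
rewrite -(sumE _ _ mJp mJm Jp0 Jm0) ge0_muleDr; first last.
- by apply: integral_ge0 => y _; rewrite mule_ge0 ?lee_fin ?gam_ge0.
- rewrite adde_ge0// mule_ge0 ?lee_fin//.
    by apply: integral_ge0 => y _; rewrite mule_ge0 ?lee_fin ?gam_ge0.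
  by apply: integral_ge0 => y _; rewrite mule_ge0 ?lee_fin ?gam_ge0.
rewrite -(sumE _ _ mJm mJp Jm0 Jp0) -(marginal mk k0).
have mk2 : measurable_fun setT (fun q : V * V => k q.2 * G q).
  by apply: emeasurable_funM => //; apply: (measurableT_comp mk).
have mS J J' : measurable_fun setT J -> measurable_fun setT J' ->
    measurable_fun setT (fun q => T J L q + T J (- L)%R q + 2%:E * T J' 0%R q).
  move=> mJ mJ'; apply: emeasurable_funD; last by apply: measurable_funeM; exact: mT.
  by apply: emeasurable_funD; exact: mT.
have S0 J J' q : (forall y, 0 <= J y) -> (forall y, 0 <= J' y) ->
    0 <= T J L q + T J (- L)%R q + 2%:E * T J' 0%R q.
  move=> J0 J'0; apply: adde_ge0; first by apply: adde_ge0; exact: T0.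
  by apply: mule_ge0; [rewrite lee_fin|exact: T0].
have kG0 q : 0 <= k q.2 * G q by apply: mule_ge0.
rewrite -ge0_integralD//; first last.
- exact: mS.
- by move=> q _; exact: S0.
apply: ae_ge0_le_integral => //.
- by move=> q _; exact: S0.
- exact: mS.
- by move=> q _; apply: adde_ge0; [exact: S0|exact: kG0].
- by apply: emeasurable_funD; [exact: mS|exact: mk2].
case: H => N [mN N0 HN]; exists N; split => //; apply: subset_trans HN.
apply: subsetC => q/= h _.
have SE J J' : (forall y, 0 <= J y) -> (forall y, 0 <= J' y) ->
    T J L q + T J (- L)%R q + 2%:E * T J' 0%R q =
    (J (A1 *m q.1 + L *m q.2)%R + J (A1 *m q.1 - L *m q.2)%R + 2%:E * J' (A1 *m q.1)%R) * G q.
  move=> J0 J'0; rewrite /T mulNmx mul0mx addr0 muleA -!ge0_muleDl ?adde_ge0//.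
  by rewrite mule_ge0.
rewrite !SE// -ge0_muleDl//; first by rewrite lee_wpmul2r.
by rewrite adde_ge0 ?mule_ge0 ?adde_ge0.
Qed.

End gaussian_comparison.

(* No finiteness is required: the conclusion is trivial if b1, b2 or a3 is
   infinite, and otherwise the hypothesis forces a1, a2 and b3 to be finite. *)
Lemma ereal_second_diff (R : realType) (a1 a2 a3 b1 b2 b3 : \bar R) (k t : R) : (0 < k)%R ->
  (0 <= a1 -> 0 <= a2 -> 0 <= a3 -> 0 <= b1 -> 0 <= b2 -> 0 <= b3 ->
  k%:E * (a1 - b1) + k%:E * (a2 - b2) - 2%:E * (k%:E * (a3 - b3)) <= t%:E ->
  a1 + a2 + 2%:E * b3 <= b1 + b2 + 2%:E * a3 + (t / k)%:E)%E.
Proof.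
move=> k0 a10 a20 a30 b10 b20 b30.
have nN (y : \bar R) : (0 <= y)%E -> y != -oo%E by case: y.
have n2 (y : \bar R) : (0 <= y)%E -> (2%:E * y)%E != -oo%E.
  by move=> y0; apply: nN; apply: mule_ge0 => //; rewrite lee_fin.
case: b1 b10 => [b1 _| _|//]; last by move=> _; rewrite !addye ?n2 ?(nN b2)// leey.
case: b2 b20 => [b2 _| _|//]; last by move=> _; rewrite addey// !addye ?n2// leey.
case: a3 a30 => [a3 _| _|//]; last by move=> _; rewrite gt0_muley ?lte_fin// addey// addye// leey.
have E (a : \bar R) (b : R) : (0 <= a)%E ->
    (exists2 r, a = r%:E & (k%:E * (a - b%:E) = (k * (r - b))%:E)%E) \/
    (a = +oo%E /\ (k%:E * (a - b%:E) = +oo)%E).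
  case: a => [r _|_|//]; first by left; exists r.
  by right; split => //; rewrite addye// gt0_muley ?lte_fin.
have F : (exists2 r, b3 = r%:E & (k%:E * (a3%:E - b3) = (k * (a3 - r))%:E)%E) \/
    (k%:E * (a3%:E - b3) = -oo)%E.
  case: b3 b30 => [r _|_|//]; first by left; exists r.
  by right; rewrite addeNy gt0_muleNy ?lte_fin.
have N2 : (2%:E * -oo = -oo :> \bar R)%E by rewrite gt0_muleNy ?lte_fin.
case: (E a1 b1 a10) => [[r1 -> ->]|[_ ->]]; case: (E a2 b2 a20) => [[r2 -> ->]|[_ ->]];
  case: F => [[r3 -> ->]|->]; rewrite -?EFinM ?N2 ?addye ?addey//.
rewrite -!EFinD !lee_fin => h.
by rewrite -lerBlDl ler_pdivlMr//; move: h; lra.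
Qed.

Lemma posdef_tr_gt0 (R : realType) m (D : 'M[R]_m.+1) : posdef D -> 0 < \tr D.
Proof.
move=> [_ Dp]; have D0 i : 0 < D i i.
  have := Dp (delta_mx i 0); rewrite trmx_delta -rowE -colE !mxE; apply.
  by apply/eqP => /matrixP/(_ i 0)/eqP; rewrite !mxE !eqxx oner_eq0.
rewrite /mxtrace big_ord_recl ltr_pwDl// sumr_ge0// => i _; exact: ltW.
Qed.

(** The arithmetic that produces the constant: [c] is [gauss_line], [om] the area of the sphere, [k]
    = K / (1 - s), [tau] = (tr / n)^s and [t] the moment of |L z|^(2s). The factor [c] drops out. *)
Lemma comparison_rescale (R : realType) (a1 a2 b1 b2 c t tau om k C : R) :
  0 < c -> 0 <= k -> 0 <= C ->
  2 * (c * a2) + 2 * (c * b1) <= 2 * (c * b2) + 2 * (c * a1) + 2 * k * t ->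
  t <= tau * (c * (om / 2)) ->
  C / 2 * (a2 - b2) - C / 2 * (a1 - b1) <= k * (om / 4) * C * tau.
Proof.
move=> c0 k0 C0 main tle.
have kt := ler_wpM2l k0 tle.
have : (a2 - b2) - (a1 - b1) <= k * tau * om / 2.
  rewrite -(ler_pM2l c0); apply: le_trans (_ : k * t <= _).
    by move: main; lra.
  by apply: le_trans kt _; rewrite le_eqVlt; apply/orP; left; apply/eqP; field.
have C20 : 0 <= C / 2 by rewrite divr_ge0.
move/(ler_wpM2l C20) => h; rewrite -mulrBr; apply: le_trans h _.
by rewrite le_eqVlt; apply/orP; left; apply/eqP; field.
Qed.

(** * Positive and negative parts of the two operators *)

Section main_inequality.
Context (R : realType) (m : nat) (s : R) (u : 'cV[R]_m.+1 -> R) (x : 'cV[R]_m.+1).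
Local Notation n := m.+1.
Local Notation LC := (lebesgue_cV R n).
Local Notation V := ('cV[R]_n).
Local Notation mu := (@lebesgue_measure R).
Local Notation p := (n%:R + 2 * s)%R.
Local Notation C := (frac_const n s).
Local Notation w := (line_weight s).
Hypothesis s01 : (0 < s < 1)%R.
Hypothesis mu_u : measurable_fun setT u.
Local Open Scope ereal_scope.

Let s0 : (0 < s)%R. Proof. by case/andP: s01. Qed.
Let s1 : (s < 1)%R. Proof. by case/andP: s01. Qed.

Definition diff_pos (y : V) : R := Num.max (second_diff u x y) 0%R.
Definition diff_neg (y : V) : R := Num.max (- second_diff u x y)%R 0%R.

Let fp0 y : (0 <= diff_pos y)%R. Proof. by rewrite le_max lexx orbT. Qed.
Let fm0 y : (0 <= diff_neg y)%R. Proof. by rewrite le_max lexx orbT. Qed.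

Let mfp : measurable_fun setT diff_pos.
Proof. by apply: measurable_maxr => //; exact: measurable_second_diff. Qed.

Let mfm : measurable_fun setT diff_neg.
Proof.
by apply: measurable_maxr => //; apply: measurable_funN; exact: measurable_second_diff.
Qed.

Definition line_part (h : V -> R) (y : V) : \bar R := \int[mu]_r (h (r *: y)%R * w r)%:E.

Definition space_part (h : V -> R) (Q : 'M[R]_n) : \bar R :=
  \int[LC]_y (h (Q *m y)%R * enorm y `^ (- p))%:E.

Lemma line_part_ge0 h y : (forall z, (0 <= h z)%R) -> 0 <= line_part h y.
Proof. by move=> h0; apply: integral_ge0 => r _; rewrite lee_fin mulr_ge0 ?powR_ge0. Qed.

Lemma space_part_ge0 h Q : (forall z, (0 <= h z)%R) -> 0 <= space_part h Q.
Proof. by move=> h0; apply: integral_ge0 => r _; rewrite lee_fin mulr_ge0 ?powR_ge0. Qed.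

Lemma measurable_line_part (h : V -> R) : measurable_fun setT h -> (forall z, (0 <= h z)%R) ->
  measurable_fun setT (line_part h).
Proof.
move=> mh h0.
have mf : measurable_fun setT (fun q : V * measurableTypeR R => (h (q.2 *: q.1)%R * w q.2)%:E).
  apply/measurable_EFinP; apply: measurable_funM; last exact: measurable_line_weight.
  by apply: (measurableT_comp mh); apply: measurable_mx_scale.
have f0 (q : V * measurableTypeR R) : 0 <= (h (q.2 *: q.1)%R * w q.2)%:E.
  by rewrite lee_fin mulr_ge0 ?powR_ge0.
exact: (@measurable_fun_fubini_tonelli_F _ _ _ _ R mu _ mf f0).
Qed.

Lemma line_part_average (h : V -> R) Q : measurable_fun setT h -> (forall z, (0 <= h z)%R) ->
  \int[LC]_y (line_part h (Q *m y)%R * (gam y)%:E) = gauss_line m s * space_part h Q.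
Proof.
move=> mh h0; rewrite /space_part -(@gauss_line_average _ _ _ s01 (fun y => h (Q *m y)%R)).
- apply: eq_integral => y _; congr (_ * _); apply: eq_integral => r _.
  by rewrite -scalemxAr.
- by apply: (measurableT_comp mh); exact: measurable_cV_mul.
- by move=> y; exact: h0.
Qed.

(** Holds whether or not the parts are finite, because an integral is by definition the difference
    of the integrals of the two parts. *)
Lemma line_opE y : line_op s u x y =
  (1 - s)%:E * (line_part diff_pos y - line_part diff_neg y).
Proof.
rewrite /line_op integralE; congr (_ * (_ - _)); apply: eq_integral => r _.
- rewrite funeposE -EFin_max /diff_pos maxr_pMl ?powR_ge0// mul0r; congr (Num.max _ _)%:E.
  by rewrite /w powRN.
- rewrite funenegE -EFinN -EFin_max /diff_neg maxr_pMl ?powR_ge0// mul0r.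
  by congr (Num.max _ _)%:E; rewrite /w powRN mulNr.
Qed.

Lemma frac_opE Q : frac_op s Q u x =
  (C / 2)%:E * (space_part diff_pos Q - space_part diff_neg Q).
Proof.
rewrite /frac_op integralE; congr (_ * (_ - _)); apply: eq_integral => r _.
- rewrite funeposE -EFin_max /diff_pos maxr_pMl ?powR_ge0// mul0r.
  by congr (Num.max _ _)%:E; rewrite powRN.
- rewrite funenegE -EFinN -EFin_max /diff_neg maxr_pMl ?powR_ge0// mul0r.
  by congr (Num.max _ _)%:E; rewrite powRN mulNr.
Qed.

Hypothesis u_growth : L1_omega s u.
Hypothesis u_touched : C2_touches_from_above u x.

Lemma space_part_pos_fin Q : posdef Q -> space_part diff_pos Q \is a fin_num.
Proof.
move=> Qpos; rewrite ge0_fin_numE ?space_part_ge0//.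
apply: ge0_kernel_linear_fin => //; first exact: posdef_unitmx.
exact: pos_part_kernel_fin.
Qed.

Lemma space_part_neg_fin Q : posdef Q -> -oo < frac_op s Q u x ->
  space_part diff_neg Q \is a fin_num.
Proof.
move=> Qpos; rewrite frac_opE -(fineK (space_part_pos_fin Qpos)).
have := space_part_ge0 Q fm0; case: (space_part diff_neg Q) => // _.
have C0 : (0 < C / 2)%R by rewrite divr_gt0// frac_const_gt0.
by rewrite addeNy gt0_muleNy ?lte_fin.
Qed.

Variables (K : R) (Q1 Q2 : 'M[R]_n).
Hypothesis m0 : (0 < m)%N.
Hypothesis K0 : (0 < K)%R.
Hypothesis H : {ae (LC \x LC), forall q : V * V,
  line_op s u x (q.1 + q.2)%R + line_op s u x (q.1 - q.2)%R - 2%:E * line_op s u x q.1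
  <= (2 * K * enorm q.2 `^ (2 * s))%:E}.
Hypothesis Q1pos : posdef Q1.
Hypothesis Q2pos : posdef Q2.
Hypothesis Dpos : posdef (Q2 *m Q2 - Q1 *m Q1)%R.
Hypothesis Q1oo : -oo < frac_op s Q1 u x.
Hypothesis Q2oo : -oo < frac_op s Q2 u x.

Lemma main_inequality :
  frac_op s Q2 u x - frac_op s Q1 u x <=
  (cKs n K s * (\tr (Q2 *m Q2 - Q1 *m Q1)) `^ s)%:E.
Proof.
set D := (Q2 *m Q2 - Q1 *m Q1)%R.
have [L Lu LD] := posdef_cholesky Dpos.
have Q1u := posdef_unitmx Q1pos; have Q2u := posdef_unitmx Q2pos.
have QE : (Q1 *m Q1^T + L *m L^T = Q2 *m Q2^T)%R.
  by rewrite LD (proj1 Q1pos) (proj1 Q2pos) addrC subrK.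
have D0 := posdef_tr_gt0 Dpos.
have s10 : (0 < 1 - s)%R by rewrite subr_gt0.
(* The right side of the hypothesis at L z, divided by the factor 1 - s of [line_op]. *)
pose k (z : V) : \bar R := (2 * K / (1 - s) * enorm (L *m z) `^ (2 * s))%:E.
have k0 z : 0 <= k z by rewrite lee_fin mulr_ge0 ?powR_ge0// divr_ge0 ?mulr_ge0 ?ltW.
have mk : measurable_fun setT k.
  apply/measurable_EFinP; apply: measurable_funM => //; apply: measurable_powR_enorm.
  exact: measurable_cV_mul.
have ineq : {ae (LC \x LC), forall q : V * V,
     line_part diff_pos (Q1 *m q.1 + L *m q.2)%R +
     line_part diff_pos (Q1 *m q.1 - L *m q.2)%R + 2%:E * line_part diff_neg (Q1 *m q.1)%R <=
     line_part diff_neg (Q1 *m q.1 + L *m q.2)%R +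
     line_part diff_neg (Q1 *m q.1 - L *m q.2)%R + 2%:E * line_part diff_pos (Q1 *m q.1)%R
     + k q.2}.
  have := ae_linear_pair Q1u Lu H; apply: filterS => q /=; rewrite !line_opE => h.
  rewrite /k mulrAC.
  by apply: (ereal_second_diff s10 _ _ _ _ _ _ h); exact: line_part_ge0.
have mLp := measurable_line_part mfp fp0; have mLm := measurable_line_part mfm fm0.
have := gauss_comparison Q1u Q2u QE mLp mLm mk (fun y => line_part_ge0 y fp0)
  (fun y => line_part_ge0 y fm0) k0 ineq.
rewrite (line_part_average Q2 mfp fp0) (line_part_average Q1 mfm fm0).
rewrite (line_part_average Q2 mfm fm0) (line_part_average Q1 mfp fp0).
have -> : \int[LC]_y (k y * (gam y)%:E) = (2 * K / (1 - s))%:E *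
    \int[LC]_z (enorm (L *m z) `^ (2 * s) * gam z)%:E.
  rewrite -ge0_integralZlT.
  - by apply: eq_integral => y _; rewrite -!EFinM mulrA.
  - apply/measurable_EFinP; apply: measurable_funM; last exact: measurable_gam.
    by apply: measurable_powR_enorm; exact: measurable_cV_mul.
  - by move=> y; rewrite lee_fin mulr_ge0 ?powR_ge0 ?gam_ge0.
  - by rewrite lee_fin divr_ge0 ?mulr_ge0 ?ltW.
have Tle := gauss_moment_linear s01 (_ : 0 < \tr (L *m L^T))%R.
rewrite LD in Tle; have {Tle} := Tle D0.
set T := \int[LC]_z _.
have T0 : 0 <= T by apply: integral_ge0 => z _; rewrite lee_fin mulr_ge0 ?powR_ge0 ?gam_ge0.
have msE := gauss_momentE s01 m0.
rewrite -(fineK (gauss_moment_fin_num m s01)) /gauss_moment msE.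
rewrite !frac_opE.
have cf := gauss_line_fin s01 m0; have c0 := gauss_line_gt0 m s01.
(* From here on the four averages are real numbers and may be moved across the inequality. *)
rewrite -(fineK (space_part_pos_fin Q1pos)) -(fineK (space_part_pos_fin Q2pos)).
rewrite -(fineK (space_part_neg_fin Q1pos Q1oo)) -(fineK (space_part_neg_fin Q2pos Q2oo)).
set a1 := fine (space_part diff_pos Q1); set a2 := fine (space_part diff_pos Q2).
set b1 := fine (space_part diff_neg Q1); set b2 := fine (space_part diff_neg Q2).
move: a1 a2 b1 b2 => a1 a2 b1 b2.
move: cf c0 T0; clearbody T; case: (gauss_line m s) => // c _; rewrite lte_fin => c0.
move=> T0 TB; have [t tE] : exists t, T = t%:E.
  by move: T0 TB; rewrite -EFinM; case: T => [t| |] //; exists t.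
move: TB; rewrite tE /= -!EFinM lee_fin => tle.
rewrite -!EFinD lee_fin => main.
rewrite lee_fin.
have n0 : (0 < n%:R `^ s :> R)%R by rewrite powR_gt0// ltr0n.
have -> : (cKs n K s * \tr D `^ s = K / (1 - s) * (sphere_area R n / 4) * C * (\tr D / n%:R) `^ s)%R.
  have -> : (\tr D `^ s = (\tr D / n%:R) `^ s * n%:R `^ s)%R.
    rewrite -powRM ?divr_ge0 ?ler0n ?(ltW D0)//.
    by rewrite divfK// pnatr_eq0.
  by rewrite /cKs; field; rewrite !gt_eqF.
apply: (comparison_rescale c0 _ _ _ tle).
- by rewrite divr_ge0 ?ltW.
- by rewrite ltW// frac_const_gt0.
- by rewrite (mulrA 2%R K).
Qed.

End main_inequality.

Unset Implicit Arguments.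

Theorem proposition5p1 (R : realType) (n : nat) (hn : (3 <= n)%N)
    (K : R) (hK : 0 < K) :
  (forall (s : R) (u : 'cV[R]_n -> R) (x : 'cV[R]_n) (Q1 Q2 : 'M[R]_n),
    0 < s < 1 ->
    continuous u ->
    L1_omega s u ->
    C2_touches_from_above u x ->
    {ae (lebesgue_cV R n \x lebesgue_cV R n)%E,
      forall p : 'cV[R]_n * 'cV[R]_n,
        (line_op s u x (p.1 + p.2)%R + line_op s u x (p.1 - p.2)%R
           - 2%:E * line_op s u x p.1
         <= (2 * K * enorm p.2 `^ (2 * s))%:E)%E} ->
    posdef Q1 -> posdef Q2 ->
    posdef (Q2 *m Q2 - Q1 *m Q1) ->
    (-oo < frac_op s Q1 u x)%E ->
    (-oo < frac_op s Q2 u x)%E ->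
    (frac_op s Q2 u x - frac_op s Q1 u x
       <= (cKs n K s * (\tr (Q2 *m Q2 - Q1 *m Q1)) `^ s)%:E)%E)
  /\ cKs n K s @[s --> (1 : R)^'-] --> K.
Proof.
split; last by apply: cKs_cvg; exact: leq_trans hn.
case: n hn => [//|m] m3 s u x Q1 Q2 s01 _ L1 touch H Q1p Q2p Dp Q1oo Q2oo.
apply: main_inequality => //; first exact: L1.1.
by rewrite -ltnS; exact: ltnW.
Qed.
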